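(* (a) Let $x_0\in\mathbb P(\mathbb R^n)$ and let $x_\infty=\lim_{t\to+\infty}x(t)$ be the limit of the negative gradient flow line $x(t)$ of $\nu_{\mathfrak p}$ through $x_0$. Then $$\|\mu_{\mathfrak p}(x_\infty)\|=\inf_{g\in G}\|\mu_{\mathfrak p}(gx_0)\|=\inf_{g\in U^{\mathbb C}}\|\mu(gx_0)\|.$$ (b) Let $x_0\in\mathbb P(\mathbb C^n)$ be such that $U^{\mathbb C}\cdot x_0\cap\mathbb P(\mathbb R^n)\neq\emptyset$. Then $$\inf_{g\in U^{\mathbb C}}\|\mu(gx_0)\|=\inf_{y\in U^{\mathbb C}\cdot x_0\cap\mathbb P(\mathbb R^n)}\|\mu_{\mathfrak p}(y)\|.$$
   Context: Let $G\subset \mathrm{SL}(n,\mathbb R)$ be a closed connected noncompact semisimple Lie subgroup with Lie algebra $\mathfrak g$ such that $G=K\exp(\mathfrak p)$, where $K=G\cap \mathrm{SO}(n)$, $\mathfrak p=\mathfrak g\cap \mathrm{Sym}_0(n)$ and $\mathrm{Sym}_0(n)$ is the space of trace-zero real symmetric $n\times n$ matrices; let $\mathfrak k$ be the Lie algebra of $K$. Assume that $G$ acts irreducibly on $\mathbb R^n$ and on $\mathbb C^n$. Let $U\subset\mathrm{SU}(n)$ be the compact connected semisimple subgroup with Lie algebra $\mathfrak u=\mathfrak k\oplus i\mathfrak p$, and let $U^{\mathbb C}=G^{\mathbb C}\subset\mathrm{SL}(n,\mathbb C)$ be its complexification (the Zariski closure of $G$). $\mathbb P(\mathbb R^n)\subset\mathbb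 P(\mathbb C^n)$ denotes the set of real points, with metric induced by the Fubini-Study metric. Fix an $\mathrm{Ad}(\mathrm{SU}(n))$-invariant scalar product $\langle\cdot,\cdot\rangle$ on $\mathfrak{su}(n)$, and on $i\mathfrak{su}(n)$ so that multiplication by $i$ is an isometry. The momentum map $\mu:\mathbb P(\mathbb C^n)\to\mathfrak u$ of the $U$-action is given by $\langle i\mu([z]),X\rangle=\frac{z^*Xz}{\|z\|^2}$ for all $X\in i\mathfrak u$, and the $G$-gradient map $\mu_{\mathfrak p}:\mathbb P(\mathbb C^n)\to\mathfrak p$ by $\langle\mu_{\mathfrak p}([z]),\beta\rangle=\frac{z^*\beta z}{\|z\|^2}$ for all $\beta\in\mathfrak p$ (orthogonal projection of $i\mu$ to $\mathfrak p$). Norms are those of $\langle\cdot,\cdot\rangle$. On $\mathbb P(\mathbb R^n)$ let $\nu_{\mathfrak p}(x)=\frac12\|\mu_{\mathfrak p}(x)\|^2$. For $\beta\in\mathfrak p$ let $\beta_{\mathbb P(\mathbb R^n)}(x)=\frac{d}{dt}\big|_{t=0}\exp(t\beta)x$; with the metric suitably normalized the gradient of $\nu_{\mathfrak p}$ at $x$ is $\beta_{\mathbb P(\mathbb R^n)}(x)$ with $\beta=\mu_{\mathfrak p}(x)$. The negative gradient flow line through $x_0$ is the solution of $\dot x(t)=-\beta(t)_{\mathbb P(\mathbb R^n)}(x(t))$, $\beta(t)=\mu_{\mathfrak p}(x(t))$, $x(0)=x_0$; it exists for all $t\in\mathbb R$ and the limit $x_\infty=\lim_{t\to+\infty}x(t)$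 exists. *)

(* Defs.v *)
From HB Require Import structures.
From mathcomp Require Import all_boot all_order all_algebra.
From mathcomp Require Import complex.
From mathcomp Require Import all_classical all_reals all_analysis.
(* not imported: its notations clash with those of MathComp-Analysis *)
From mathcomp Require mpoly.
Set Implicit Arguments.
Unset Strict Implicit.
Unset Printing Implicit Defensive.
Import Order.TTheory GRing.Theory Num.Theory.
Import numFieldNormedType.Exports.
Local Open Scope classical_set_scope.
Local Open Scope complex_scope.
Local Open Scope ring_scope.
Local Open Scope sesquilinear_scope.

Section MatrixLieGroups.
Variables (R : realType) (n : nat).
Implicit Types (G : set 'M[R]_n) (g a : {vspace 'M[R]_n}).

Definition expmx (A : 'M[R]_n) : 'M[R]_n :=
  limn (series (fun j : nat => (j`!%:R)^-1 *: A ^+ j)).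

Definition liebr (A B : 'M[R]_n) : 'M[R]_n := A *m B - B *m A.

(* A closed subgroup of GL(n, R) that lies in SL(n, R) is closed in SL(n, R)
   if and only if it is closed in 'M[R]_n. *)
Definition closed_subgroup_SL G : Prop :=
  [/\ G `<=` [set A | \det A = 1], G 1%:M,
      (forall A B, G A -> G B -> G (A *m B)),
      (forall A, G A -> G (invmx A)) & closed G].

Definition SO : set 'M[R]_n := [set A | A *m A^T = 1%:M /\ \det A = 1].

Definition is_lie_algebra G g : Prop :=
  forall A, A \in g <-> forall t : R, G (expmx (t *: A)).

Definition lie_ideal a g : Prop :=
  (a <= g)%VS /\ forall A B, A \in g -> B \in a -> liebr A B \in a.

Definition lie_derived a : {vspace 'M[R]_n} :=
  <<[seq liebr A B | A <- vbasis a, B <- vbasis a]>>%VS.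

Definition lie_solvable a : Prop := exists j, iter j lie_derived a = 0%VS.

Definition lie_semisimple g : Prop :=
  forall a, lie_ideal a g -> lie_solvable a -> a = 0%VS.

(* The intersection of g with Sym_0(n) *)
Definition ppart g : set 'M[R]_n :=
  [set A | [/\ A \in g, A^T = A & \tr A = 0]].

End MatrixLieGroups.

Definition act (F : fieldType) (n : nat) (A : 'M[F]_n)
    (L : {vspace 'cV[F]_n}) : {vspace 'cV[F]_n} :=
  (linfun (mulmx A) @: L)%VS.

Definition irreducible_on (F : fieldType) (n : nat) (S : set 'M[F]_n) : Prop :=
  (0 < n)%N /\
  forall W : {vspace 'cV[F]_n},
    (forall A, S A -> (act A W <= W)%VS) -> W = 0%VS \/ W = fullv.

(* P(F^n) is the set of one-dimensional subspaces of F^n. *)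
Definition projspace (F : fieldType) (n : nat) : set {vspace 'cV[F]_n} :=
  [set L | \dim L = 1%N].

Section RealProjectiveSpace.
Variables (R : realType) (n : nat).

(* The orthogonal projector onto the line L, i.e. v v^T / (v^T v) for any
   nonzero v in L.  The map projmx is an embedding of P(R^n) into the space of
   symmetric matrices as a closed submanifold, and the Fubini-Study metric is
   up to a constant factor induced by it; convergence in P(R^n) and velocities
   of curves in P(R^n) are expressed through this embedding. *)
Definition projmx (L : {vspace 'cV[R]_n}) : 'M[R]_n :=
  let v := vpick L in ((v^T *m v) 0 0)^-1 *: (v *m v^T).

Definition fundfield (b : 'M[R]_n) (L : {vspace 'cV[R]_n}) : 'M[R]_n :=
  derive1 (fun t : R => projmx (act (expmx (t *: b)) L)) 0.

Definition neg_flow_line (beta : {vspace 'cV[R]_n} -> 'M[R]_n)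
    (x0 : {vspace 'cV[R]_n}) (x : R -> {vspace 'cV[R]_n}) : Prop :=
  [/\ x 0 = x0, (forall t, projspace (x t)) &
      forall t : R, is_derive t 1 (projmx \o x) (- fundfield (beta (x t)) (x t))].

Definition flow_limit (x : R -> {vspace 'cV[R]_n})
    (xoo : {vspace 'cV[R]_n}) : Prop :=
  projspace xoo /\ projmx (x t) @[t --> +oo%R] --> projmx xoo.

End RealProjectiveSpace.

Section Complexification.
Variables (R : realType) (n : nat).
Local Notation C := R[i].

Definition cplxmx (p q : nat) (A : 'M[R]_(p, q)) : 'M[C]_(p, q) :=
  map_mx (real_complex R) A.

Definition cplxline (L : {vspace 'cV[R]_n}) : {vspace 'cV[C]_n} :=
  <<[seq cplxmx v | v <- vbasis L]>>%VS.

(* P(R^n) inside P(C^n) *)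
Definition realpoints : set {vspace 'cV[C]_n} :=
  cplxline @` @projspace R n.

Definition zariski_closure (S : set 'M[C]_n) : set 'M[C]_n :=
  [set A | forall f : mpoly.mpoly (n * n) C,
     (forall B, S B -> mpoly.meval (fun l => mxvec B 0 l) f = 0) ->
     mpoly.meval (fun l => mxvec A 0 l) f = 0].

(* u = k (+) i p *)
Definition ualg (g k : {vspace 'M[R]_n}) : set 'M[C]_n :=
  [set X | exists A B, [/\ A \in k, ppart g B & X = cplxmx A + 'i%C *: cplxmx B]].

Definition su : set 'M[C]_n := [set X | X^t* = - X /\ \tr X = 0].
Definition SU : set 'M[C]_n := [set V | V \is unitarymx /\ \det V = 1].

(* ip is only meaningful on su(n); its values elsewhere are unconstrained. *)
Definition invariant_scalar_product (ip : 'M[C]_n -> 'M[C]_n -> R) : Prop :=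
  [/\ (forall (c : R) X Y Z, su X -> su Y -> su Z ->
         ip (c%:C *: X + Y) Z = c * ip X Z + ip Y Z),
      (forall X Y, su X -> su Y -> ip X Y = ip Y X),
      (forall X, su X -> X != 0 -> 0 < ip X X) &
      (forall V X Y, SU V -> su X -> su Y ->
         ip (V *m X *m invmx V) (V *m Y *m invmx V) = ip X Y)].

(* The scalar product on i su(n) that makes multiplication by i an isometry. *)
Definition ipH (ip : 'M[C]_n -> 'M[C]_n -> R) (X Y : 'M[C]_n) : R :=
  ip ('i%C *: X) ('i%C *: Y).

(* z^* X z / ||z||^2 *)
Definition rayleigh (X : 'M[C]_n) (z : 'cV[C]_n) : C :=
  (z^t* *m X *m z) 0 0 / (z^t* *m z) 0 0.

Definition is_momentum_map (ip : 'M[C]_n -> 'M[C]_n -> R)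
    (g k : {vspace 'M[R]_n}) (mu : {vspace 'cV[C]_n} -> 'M[C]_n) : Prop :=
  forall z : 'cV[C]_n, z != 0 ->
    ualg g k (mu <[z]>%VS) /\
    forall X, [set 'i%C *: Y | Y in ualg g k] X ->
      (ipH ip ('i%C *: mu <[z]>%VS) X)%:C = rayleigh X z.

Definition is_gradient_map (ip : 'M[C]_n -> 'M[C]_n -> R)
    (g : {vspace 'M[R]_n}) (mup : {vspace 'cV[C]_n} -> 'M[R]_n) : Prop :=
  forall z : 'cV[C]_n, z != 0 ->
    ppart g (mup <[z]>%VS) /\
    forall b, ppart g b ->
      (ipH ip (cplxmx (mup <[z]>%VS)) (cplxmx b))%:C = rayleigh (cplxmx b) z.

Definition norm_su (ip : 'M[C]_n -> 'M[C]_n -> R) (X : 'M[C]_n) : R :=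
  Num.sqrt (ip X X).

Definition norm_p (ip : 'M[C]_n -> 'M[C]_n -> R) (B : 'M[R]_n) : R :=
  Num.sqrt (ipH ip (cplxmx B) (cplxmx B)).

Definition orbit_of (S : set 'M[C]_n) (L : {vspace 'cV[C]_n}) :
    set {vspace 'cV[C]_n} := [set act A L | A in S].

End Complexification.

(* Main.v *)
Require Import Defs.
From HB Require Import structures.
From mathcomp Require Import all_boot all_order all_algebra.
From mathcomp Require Import fingroup perm complex.
From mathcomp Require Import all_classical all_reals all_analysis.
From mathcomp Require mpoly.
From mathcomp Require Import ring lra.
Set Implicit Arguments.
Unset Strict Implicit.
Unset Printing Implicit Defensive.
Import Order.TTheory GRing.Theory Num.Theory.
Import numFieldNormedType.Exports.
Local Open Scope classical_set_scope.
Local Open Scope complex_scope.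
Local Open Scope ring_scope.
Local Open Scope sesquilinear_scope.

(** The negative gradient flow is replaced by its explicit Euler scheme, and the
    scheme is compared with an arbitrary element of the complexified group.

    An invariant scalar product on su(n) is a negative multiple -c of the trace
    form ([ip_trace]), so both norms of the theorem are sqrt c times Frobenius
    norms.  At real points i mu and mu_p coincide ([xi_real]).  The group U^C,
    given as a Zariski closure, enters only through three facts: it contains G, it
    is stable under left translations by G, and it lies in the group [normC] of
    all h in SL(n, C) such that Ad h preserves the complexification [gC] of g
    ([UC_normC]: this is a polynomial condition on h).

    Central estimate ([descent_bound]).  Fix a real line [v], some h in [normC],
    and put w = h v, xi = i mu([w]), s = |xi|.  The scheme
    y_0 = 1, y_(k+1) = exp(-eps mu_p(y_k v)) y_k stays in G.  Let F_k be the norm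
    of mu_p(y_k v), let M = y_N h^-1, and let X be the logarithm of the Gram matrix
    of M, so that M acts on lengths as exp(X / 2).
    - Each step decreases ln |y_k v|^2 by 2 eps c F_k^2 up to second order
      ([gstep_decrease]).
    - By Jensen's inequality <X w, w> / |w|^2 is at most
      ln |M w|^2 - ln |w|^2 = ln |y_N v|^2 - ln |w|^2 ([jensen_gram]).
    - X lies in i u, so the left-hand side is c times the pairing of xi and X.
    - This pairing is at least -s (const + 2 eps sum F_k) up to second order: X is
      an end point of a path with steps of length 2 eps F_k in the symmetric
      space of SL(n, C), for which a triangle inequality holds ([sing_bound]).
    Together, eps c sum F_k^2 <= A + c s (eps sum F_k) up to O(eps), with A
    independent of eps and N.  If F_k >= m during a long time, then m <= s
    ([limit_ineq]).

    Consequently the infimum of |mu_p| over G v is at most |mu(h v)| for every h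
    in [normC] ([orbit_inf_le]).  The Euler scheme stays close to the flow line
    during any bounded time ([euler_error], [flow_approx]), so that the same
    estimate bounds |mu_p| at the limit point by |mu(h v)| ([flow_limit_le]), and
    the limit point is a limit of points of the orbit ([orbit_inf_le_limit]).
    This gives (a).  For (b), if h x_0 is real and A lies in U^C, the first bound
    is applied at the real point h x_0 to A h^-1, which lies in [normC].

    That X lies in i u ([polar_in_gC]) is where irreducibility over C and the
    connectedness of G are used: ad X preserves [gC], being a polynomial in the
    adjoint action of the Gram matrix; what is left of X after orthogonal
    projection to [gC] commutes with g, hence with G ([commutes_with_G]), hence
    is a scalar, and it vanishes because X has trace 0. *)

(** * Hermitian, unitary and triangular matrices *)

Section ComplexMatrices.
Variable R : realType.
Local Notation C := R[i].
Implicit Types (m n p : nat).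

Definition sqmod (x : C) : R := complex.Re x ^+ 2 + complex.Im x ^+ 2.

Lemma sqmodE (x : C) : x * x^* = (sqmod x)%:C.
Proof.
case: x => a b; rewrite /sqmod /=; apply/eqP.
by rewrite eq_complex /=; apply/andP; split; apply/eqP; ring.
Qed.

Lemma sqmod_ge0 x : 0 <= sqmod x.
Proof. by rewrite addr_ge0 // sqr_ge0. Qed.

Lemma sqmod_eq0 x : (sqmod x == 0) = (x == 0).
Proof. by rewrite paddr_eq0 ?sqr_ge0 // !sqrf_eq0 eq_complex. Qed.

Lemma sqmodM x y : sqmod (x * y) = sqmod x * sqmod y.
Proof. by case: x => a b; case: y => c d; rewrite /sqmod /=; ring. Qed.

Lemma sqmodR (x : R) : sqmod x%:C = x ^+ 2.
Proof. by rewrite /sqmod /= expr0n addr0. Qed.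

Lemma sqmodJ (x : C) : sqmod x^* = sqmod x.
Proof. by case: x => a b; rewrite /sqmod /= sqrrN. Qed.

Lemma adjE m n (A : 'M[C]_(m, n)) i j : (A^t*) i j = (A j i)^*.
Proof. by rewrite !mxE. Qed.

Lemma adjK m n (A : 'M[C]_(m, n)) : (A^t*)^t* = A.
Proof. by apply/matrixP => i j; rewrite !adjE conjCK. Qed.

Lemma adjM m n p (A : 'M[C]_(m, n)) (B : 'M[C]_(n, p)) :
  (A *m B)^t* = B^t* *m A^t*.
Proof. by rewrite trmx_mul map_mxM. Qed.

Lemma adjD m n (A B : 'M[C]_(m, n)) : (A + B)^t* = A^t* + B^t*.
Proof. by rewrite linearD map_mxD. Qed.

Lemma adjN m n (A : 'M[C]_(m, n)) : (- A)^t* = - A^t*.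
Proof. by rewrite linearN map_mxN. Qed.

Lemma adjZ m n (a : C) (A : 'M[C]_(m, n)) : (a *: A)^t* = a^* *: A^t*.
Proof. by rewrite linearZ map_mxZ. Qed.

Lemma adj1 n : (1%:M : 'M[C]_n)^t* = 1%:M.
Proof. by rewrite tr_scalar_mx map_scalar_mx /= rmorph1. Qed.

Lemma unitaryL n (V : 'M[C]_n) : V \is unitarymx -> V *m V^t* = 1%:M.
Proof. by move/unitarymxP. Qed.

Lemma unitaryR n (V : 'M[C]_n) : V \is unitarymx -> V^t* *m V = 1%:M.
Proof. by rewrite -trmxC_unitary => /unitarymxP; rewrite adjK. Qed.

Lemma unitaryI n (V : 'M[C]_n) : V *m V^t* = 1%:M -> V \is unitarymx.
Proof. by move=> h; apply/unitarymxP. Qed.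

Lemma unitary_adj n (V : 'M[C]_n) : V \is unitarymx -> V^t* \is unitarymx.
Proof. by rewrite trmxC_unitary. Qed.

Definition sqn n (z : 'cV[C]_n) : R := \sum_i sqmod (z i 0).

Lemma sqn_ge0 n (z : 'cV[C]_n) : 0 <= sqn z.
Proof. by apply: sumr_ge0 => i _; apply: sqmod_ge0. Qed.

Lemma sqn_eq0 n (z : 'cV[C]_n) : (sqn z == 0) = (z == 0).
Proof.
rewrite /sqn psumr_eq0; last by move=> i _; apply: sqmod_ge0.
apply/allP/eqP => [h|-> i _]; last by rewrite /= mxE sqmod_eq0 eqxx.
apply/matrixP => i j; rewrite ord1 [RHS]mxE; apply/eqP; rewrite -sqmod_eq0.
exact: h (mem_index_enum _).
Qed.

Lemma sqn_gt0 n (z : 'cV[C]_n) : (0 < sqn z) = (z != 0).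
Proof. by rewrite lt_def sqn_ge0 andbT sqn_eq0. Qed.

Definition dg n (d : 'I_n -> R) : 'M[C]_n := diag_mx (\row_i (d i)%:C).

Lemma dgE n (d : 'I_n -> R) i j : dg d i j = (d i)%:C *+ (i == j).
Proof. by rewrite !mxE. Qed.

Lemma adj_dg n (d : 'I_n -> R) : (dg d)^t* = dg d.
Proof.
apply/matrixP => i j; rewrite adjE !dgE eq_sym; case: eqP => [->|_].
  by rewrite mulr1n; exact: conjc_real.
by rewrite mulr0n conjC0.
Qed.

Lemma dgM n (d e : 'I_n -> R) : dg d *m dg e = dg (fun i => d i * e i).
Proof.
apply/matrixP => i j; rewrite mul_diag_mx !mxE.
by case: eqP => _; rewrite ?mulr1n ?mulr0n ?mulr0 // rmorphM.
Qed.

Lemma dg1 n : dg (fun _ : 'I_n => 1) = 1%:M.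
Proof. by apply/matrixP => i j; rewrite dgE !mxE. Qed.

Lemma mxtrace_dg n (d : 'I_n -> R) : \tr (dg d) = (\sum_i d i)%:C.
Proof.
by rewrite /dg mxtrace_diag rmorph_sum; apply: eq_bigr => i _; rewrite mxE.
Qed.

Lemma det_dg n (d : 'I_n -> R) : \det (dg d) = (\prod_i d i)%:C.
Proof.
by rewrite /dg det_diag rmorph_prod; apply: eq_bigr => i _; rewrite mxE.
Qed.

(** Every Hermitian matrix is of this form ([herm_spectral]); its exponential,
    logarithm and powers are obtained by applying the function to [d]. *)
Definition udg n (V : 'M[C]_n) (d : 'I_n -> R) : 'M[C]_n := V *m dg d *m V^t*.

Lemma adj_udg n (V : 'M[C]_n) d : (udg V d)^t* = udg V d.
Proof. by rewrite /udg !adjM adjK adj_dg mulmxA. Qed.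

Lemma udgM n (V : 'M[C]_n) d e : V \is unitarymx ->
  udg V d *m udg V e = udg V (fun i => d i * e i).
Proof.
by move=> hV; rewrite /udg !mulmxA (mulmxKtV _ hV) // -(mulmxA V (dg d)) dgM.
Qed.

Lemma udg1 n (V : 'M[C]_n) : V \is unitarymx -> udg V (fun=> 1) = 1%:M.
Proof. by move=> hV; rewrite /udg dg1 mulmx1 unitaryL. Qed.

Lemma mxtrace_udg n (V : 'M[C]_n) d : V \is unitarymx ->
  \tr (udg V d) = (\sum_i d i)%:C.
Proof. by move=> hV; rewrite /udg mxtrace_mulC mulmxA (unitaryR hV) mul1mx mxtrace_dg. Qed.

Lemma det_udg n (V : 'M[C]_n) d : V \is unitarymx ->
  \det (udg V d) = (\prod_i d i)%:C.
Proof.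
move=> hV; rewrite /udg !det_mulmx mulrC mulrA -det_mulmx (unitaryR hV) det1 mul1r.
exact: det_dg.
Qed.

Lemma herm_spectral n (A : 'M[C]_n) : A^t* = A ->
  exists V d, V \is unitarymx /\ A = udg V d.
Proof.
move=> hA; have hh : A \is hermsymmx.
  by apply/is_hermitianmxP; rewrite expr0 scale1r hA.
have /orthomx_spectralP := hermitian_normalmx hh.
have /mxOverP hr := hermitian_spectral_diag_real hh.
set d := spectral_diag A; set P := spectralmx A => e.
have hP : P \is unitarymx by apply: spectral_unitarymx.
exists (P^t*), (fun i => complex.Re (d 0 i)); split.
  exact: unitary_adj.
rewrite /udg adjK; have -> : dg (fun i => complex.Re (d 0 i)) = diag_mx d.
  by rewrite /dg; congr diag_mx; apply/rowP => i; rewrite mxE RRe_real.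
by rewrite -(invmx_unitary hP); exact: e.
Qed.

Definition hq n (A : 'M[C]_n) (z : 'cV[C]_n) : C := (z^t* *m A *m z) 0 0.

Lemma hq_dg n d (z : 'cV[C]_n) : hq (dg d) z = (\sum_i d i * sqmod (z i 0))%:C.
Proof.
rewrite /hq -mulmxA mxE rmorph_sum; apply: eq_bigr => i _.
rewrite adjE mul_diag_mx !mxE [RHS]rmorphM -[X in _ = _ * X]sqmodE.
by rewrite mulrCA [X in _ * X]mulrC.
Qed.

Lemma hq1 n (z : 'cV[C]_n) : hq 1%:M z = (sqn z)%:C.
Proof. by rewrite -dg1 hq_dg; congr (_%:C); apply: eq_bigr => i _; rewrite mul1r. Qed.

Lemma hq_udg n V d (z : 'cV[C]_n) :
  hq (udg V d) z = (\sum_i d i * sqmod ((V^t* *m z) i 0))%:C.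
Proof. by rewrite -hq_dg /hq /udg adjM adjK !mulmxA. Qed.

Lemma hqMM n (M : 'M[C]_n) (z : 'cV[C]_n) : hq (M^t* *m M) z = (sqn (M *m z))%:C.
Proof. by rewrite -hq1 /hq adjM mulmx1 !mulmxA. Qed.

Lemma hqD n (A B : 'M[C]_n) (z : 'cV[C]_n) : hq (A + B) z = hq A z + hq B z.
Proof. by rewrite /hq mulmxDr mulmxDl mxE. Qed.

Lemma hqZ n a (A : 'M[C]_n) (z : 'cV[C]_n) : hq (a *: A) z = a * hq A z.
Proof. by rewrite /hq -scalemxAr -scalemxAl mxE. Qed.

Lemma sqn_unitary n (V : 'M[C]_n) (z : 'cV[C]_n) : V \is unitarymx ->
  sqn (V *m z) = sqn z.
Proof.
by move=> hV; apply: complexI; rewrite -hqMM (unitaryR hV) hq1.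
Qed.

(** The square of the Frobenius norm. *)
Definition frob2 m n (A : 'M[C]_(m, n)) : R := \sum_i \sum_j sqmod (A i j).

Lemma frob2_ge0 m n (A : 'M[C]_(m, n)) : 0 <= frob2 A.
Proof. by do 2!apply: sumr_ge0 => ? _; apply: sqmod_ge0. Qed.

Lemma frob2E m n (A : 'M[C]_(m, n)) : \tr (A *m A^t*) = (frob2 A)%:C.
Proof.
rewrite /mxtrace rmorph_sum; apply: eq_bigr => i _.
rewrite mxE rmorph_sum; apply: eq_bigr => j _.
by rewrite adjE sqmodE.
Qed.

Lemma frob2_adj m n (A : 'M[C]_(m, n)) : frob2 (A^t*) = frob2 A.
Proof. by apply: complexI; rewrite -!frob2E adjK mxtrace_mulC. Qed.

Lemma frob2_eq0 m n (A : 'M[C]_(m, n)) : frob2 A = 0 -> A = 0.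
Proof.
move=> /eqP; rewrite psumr_eq0 => [/allP h|i _]; last first.
  by apply: sumr_ge0 => ? _; apply: sqmod_ge0.
apply/matrixP => i j; rewrite mxE; apply/eqP; rewrite -sqmod_eq0.
have := h i (mem_index_enum _); rewrite /= psumr_eq0 => [/allP h'|? _].
  exact: h' (mem_index_enum _).
exact: sqmod_ge0.
Qed.

Lemma frob2_udg n (V : 'M[C]_n) d : V \is unitarymx ->
  frob2 (udg V d) = \sum_i d i ^+ 2.
Proof.
move=> hV; apply: complexI; rewrite -frob2E adj_udg udgM // mxtrace_udg //.
Qed.

Lemma frob2_unitary n (V A : 'M[C]_n) : V \is unitarymx ->
  frob2 (V^t* *m A *m V) = frob2 A.
Proof.
move=> hV; apply: complexI; rewrite -!frob2E !adjM adjK !mulmxA.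
by rewrite (mulmxtVK _ hV) mxtrace_mulC !mulmxA (unitaryL hV) mul1mx.
Qed.

Lemma trig_mulii n (A B : 'M[C]_n) i : is_trig_mx A -> is_trig_mx B ->
  (A *m B) i i = A i i * B i i.
Proof.
move=> /is_trig_mxP hA /is_trig_mxP hB; rewrite mxE (bigD1 i) //= big1 ?addr0 //.
move=> k; rewrite neq_lt => /orP [h|h]; first by rewrite hB ?mulr0.
by rewrite hA ?mul0r.
Qed.

Lemma trig_mul n (A B : 'M[C]_n) : is_trig_mx A -> is_trig_mx B ->
  is_trig_mx (A *m B).
Proof.
move=> /is_trig_mxP hA /is_trig_mxP hB; apply/is_trig_mxP => i j ij.
rewrite mxE big1 // => k _; have [h|h] := leqP k i.
  by rewrite hB ?mulr0 //; apply: leq_ltn_trans ij.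
by rewrite hA ?mul0r.
Qed.

Lemma trig_unit n (A : 'M[C]_n) i : is_trig_mx A -> A \in unitmx -> A i i != 0.
Proof.
move=> hA; rewrite unitmxE det_trig // unitfE => /prodf_neq0 h; exact: h.
Qed.

(** The rows of the inverse are determined one after the other by forward
    substitution. *)
Lemma trig_inv n (A : 'M[C]_n) : is_trig_mx A -> A \in unitmx ->
  is_trig_mx (invmx A).
Proof.
move=> hA uA; have /is_trig_mxP tA := hA; set S := invmx A.
have AS : A *m S = 1%:M by rewrite mulmxV.
suff h : forall m (i j : 'I_n), (i < m)%N -> (i < j)%N -> S i j = 0.
  by apply/is_trig_mxP => i j ij; apply: (h i.+1).
elim=> // m IH i j im ij.
have := congr1 (fun M : 'M[C]_n => M i j) AS.
rewrite !mxE (bigD1 i) //= big1; last first.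
  move=> k; rewrite neq_lt => /orP [ki|ki]; last by rewrite tA ?mul0r.
  by rewrite (IH k j) ?mulr0 //; [apply: leq_trans ki im|apply: ltn_trans ij].
rewrite addr0 -val_eqE /= (ltn_eqF ij) /= => /eqP.
by rewrite mulf_eq0 (negPf (trig_unit _ hA uA)) /= => /eqP.
Qed.

Lemma trig_inv_ii n (A : 'M[C]_n) i : is_trig_mx A -> A \in unitmx ->
  invmx A i i = (A i i)^-1.
Proof.
move=> hA uA; have := trig_mulii i hA (trig_inv hA uA).
rewrite mulmxV // !mxE eqxx /= => h; apply: (mulfI (trig_unit i hA uA)).
by rewrite -h mulfV // trig_unit.
Qed.

(** Row i of A is a combination of the first i + 1 Gram-Schmidt vectors, hence
    orthogonal to the later ones; this makes A Q^t* triangular. *)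
Lemma schmidt_factor n (A : 'M[C]_n) : exists L Q : 'M[C]_n,
  [/\ Q \is unitarymx, is_trig_mx L & A = L *m Q].
Proof.
have hQ : schmidt A \is unitarymx by apply: schmidt_unitarymx.
exists (A *m (schmidt A)^t*), (schmidt A); split=> //; last first.
  by rewrite -mulmxA (unitaryR hQ) mulmx1.
apply/is_trig_mxP => i j ij.
have /sub_sumsmxP [u hu] := row_schmidt_sub A i.
transitivity ((row i A *m (row j (schmidt A))^t*) 0 0).
  rewrite !mxE; apply: eq_bigr => k _; by rewrite !mxE.
rewrite hu mulmx_suml summxE big1 // => k ki.
have kj : k != j by rewrite -val_eqE /= neq_ltn (leq_ltn_trans ki ij).
have /submxP [w hw] : (u k *m <<row k (schmidt A)>> <= row k (schmidt A))%MS.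
  by apply: submx_trans (submxMl _ _) _; rewrite genmxE.
rewrite hw -mulmxA.
suff -> : row k (schmidt A) *m (row j (schmidt A))^t* = 0 by rewrite mulmx0 mxE.
have := congr1 (fun M : 'M[C]_n => M k j) (unitaryL hQ); rewrite !mxE (negPf kj) => h.
apply/matrixP => a b; rewrite !ord1 [RHS]mxE -[RHS]h.
rewrite !mxE; apply: eq_bigr => l _; by rewrite !mxE.
Qed.

End ComplexMatrices.

(** * Inequalities for the exponential and the logarithm *)

Section RealInequalities.
Variable R : realType.

Lemma le_of_eq (x y : R) : x = y -> x <= y.
Proof. by move=> ->. Qed.

Lemma sum_sq_entry (I : finType) (e : I -> R) s i : 0 <= s ->
  \sum_i e i ^+ 2 <= s ^+ 2 -> `|e i| <= s.
Proof.
move=> s0 he; rewrite -(ger0_norm s0) -ler_sqr ?nnegrE // !real_normK ?num_real //.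
apply: le_trans he; rewrite (bigD1 i) //= lerDl.
by apply: sumr_ge0 => k _; apply: sqr_ge0.
Qed.

(** After multiplication by exp(-x) >= 1 - x only a polynomial inequality is
    left. *)
Lemma expR_le_quad (x : R) : x <= 1 / 2 -> expR x <= 1 + x + 2 * x ^+ 2.
Proof.
move=> x2; have e1 : 1 - x <= expR (- x) by apply: le_trans (expR_ge1Dx _); lra.
suff h : 1 <= (1 + x + 2 * x ^+ 2) * expR (- x).
  have := ler_wpM2l (expR_ge0 x) h.
  by rewrite mulr1 mulrCA -expRD subrr expR0 mulr1.
have h0 : 0 <= 1 + x + 2 * x ^+ 2 by nra.
have h1 : 0 <= x ^+ 2 * (1 - 2 * x) by rewrite mulr_ge0 ?sqr_ge0 //; lra.
apply: le_trans (ler_wpM2l h0 e1); lra.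
Qed.

Lemma CS_sum (I : finType) (a b : I -> R) (A B : R) : 0 <= A -> 0 <= B ->
  \sum_i a i ^+ 2 <= A ^+ 2 -> \sum_i b i ^+ 2 <= B ^+ 2 ->
  \sum_i a i * b i <= A * B.
Proof.
move=> A0 B0 hA hB.
have zero (c : I -> R) : \sum_i c i ^+ 2 <= 0 -> forall i, c i = 0.
  move=> h i; apply/eqP; rewrite -sqrf_eq0 eq_le sqr_ge0 andbT.
  apply: le_trans h; rewrite (bigD1 i) //= lerDl.
  by apply: sumr_ge0 => j _; apply: sqr_ge0.
have [A00|A00] := eqVneq A 0.
  rewrite A00 mul0r big1 // => i _.
  by rewrite (zero a) ?mul0r //; move: hA; rewrite A00 expr0n.
have [B00|B00] := eqVneq B 0.
  rewrite B00 mulr0 big1 // => i _.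
  by rewrite (zero b) ?mulr0 //; move: hB; rewrite B00 expr0n.
have AB : 0 < A * B by rewrite mulr_gt0 // lt_def ?A00 ?B00.
have : 0 <= \sum_i (B * a i - A * b i) ^+ 2 by apply: sumr_ge0 => i _; apply: sqr_ge0.
have -> : \sum_i (B * a i - A * b i) ^+ 2 =
   B ^+ 2 * \sum_i a i ^+ 2 + A ^+ 2 * \sum_i b i ^+ 2 - 2 * (A * B) * \sum_i a i * b i.
  rewrite !mulr_sumr -big_split -sumrB /=; apply: eq_bigr => i _; ring.
move: hA hB; set x := \sum_i _; set y := \sum_i _; set z := \sum_i _ => hA hB h.
have h1 := ler_wpM2l (sqr_ge0 B) hA; have h2 := ler_wpM2l (sqr_ge0 A) hB.
have : (A * B) * z <= (A * B) * (A * B) by nra.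
by rewrite ler_pM2l.
Qed.

Lemma ln_le_sub1 (x : R) : 0 < x -> ln x <= x - 1.
Proof.
move=> x0; have := expR_ge1Dx (ln x); rewrite lnK ?posrE //; lra.
Qed.

(** Jensen's inequality for ln: the tangent line of ln at the mean lies above the
    graph. *)
Lemma ln_jensen (I : finType) (p d : I -> R) : (forall i, 0 <= p i) ->
  (forall i, 0 < d i) -> \sum_i p i = 1 ->
  \sum_i p i * ln (d i) <= ln (\sum_i p i * d i).
Proof.
move=> p0 d0 p1; set m := \sum_i p i * d i.
have m0 : 0 < m.
  rewrite lt_def; apply/andP; split; last first.
    by apply: sumr_ge0 => i _; rewrite mulr_ge0 // ltW.
  apply/eqP => /eqP; rewrite psumr_eq0 => [/allP h|i _]; last by rewrite mulr_ge0 // ltW.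
  have : \sum_i p i = 0.
    apply: big1 => i _; have := h i (mem_index_enum _).
    by rewrite /= mulf_eq0 (gt_eqF (d0 i)) orbF => /eqP.
  by rewrite p1 => /eqP; rewrite oner_eq0.
have h i : p i * ln (d i) <= p i * (ln m + (d i / m - 1)).
  apply: ler_wpM2l => //; rewrite -lerBlDl -ln_div ?posrE //.
  by apply: ln_le_sub1; rewrite divr_gt0.
apply: le_trans (ler_sum _ (fun i _ => h i)) _.
have -> : \sum_i p i * (ln m + (d i / m - 1)) = (ln m - 1) * \sum_i p i + m / m.
  rewrite {2}/m mulr_sumr mulr_suml -big_split /=; apply: eq_bigr => i _; ring.
rewrite p1 divff ?gt_eqF //; lra.
Qed.

End RealInequalities.

(** * QR factors and a triangle inequality for singular values *)

Section Triangle.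
Variable R : realType.
Local Notation C := R[i].
Variable n : nat.
Implicit Types (E Q T V : 'M[C]_n).

Lemma unitmx_adj E : E \in unitmx -> E^t* \in unitmx.
Proof.
move=> uE; have h : E^t* *m (invmx E)^t* = 1%:M by rewrite -adjM mulVmx // adj1.
by have [] := mulmx1_unit h.
Qed.

Lemma invmx_adj E : E \in unitmx -> invmx (E^t*) = (invmx E)^t*.
Proof.
move=> uE; have h : E^t* *m (invmx E)^t* = 1%:M by rewrite -adjM mulVmx // adj1.
by rewrite -[RHS](mulKmx (unitmx_adj uE)) h mulmx1.
Qed.

Lemma colM (A B : 'M[C]_n) i : col i (A *m B) = A *m col i B.
Proof. by rewrite !colE mulmxA. Qed.

Lemma sqn_col E i : sqn (col i E) = \sum_k sqmod (E k i).
Proof. by apply: eq_bigr => k _; rewrite mxE. Qed.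

(** T is the triangular factor of E in the frame formed by the columns of Q0.
    Its i-th diagonal entry is a component of the vector E q_i in an orthonormal
    basis, and the inverse of this entry is a component of the image of q_i under the
    inverse adjoint of E; so neither exceeds the length of the vector. *)
Lemma qr_bounds E Q0 : E \in unitmx -> Q0 \is unitarymx ->
  exists Q T, [/\ Q \is unitarymx, is_trig_mx T, T \in unitmx,
    E *m Q0 = Q *m T^t* &
    forall i, sqmod (T i i) <= sqn (E *m col i Q0) /\
      (sqmod (T i i))^-1 <= sqn ((invmx E)^t* *m col i Q0)].
Proof.
move=> uE hQ0; have [T [S [hS tT e]]] := schmidt_factor ((E *m Q0)^t*).
have e1 : E *m Q0 = S^t* *m T^t* by rewrite -adjM -e adjK.
have uS := unitary_adj hS.
have eT : T = Q0^t* *m E^t* *m S^t* by rewrite -adjM e (mulmxtVK _ hS).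
have uT : T \in unitmx.
  have uQ := unitmx_adj (unitarymx_unit hQ0).
  by rewrite eT 2!unitmx_mul uQ (unitarymx_unit uS) (unitmx_adj uE).
exists (S^t*), T; split => // i; split.
  have -> : E *m col i Q0 = S^t* *m col i (T^t*).
    by rewrite -!colM e1.
  rewrite sqn_unitary // sqn_col (bigD1 i) //= adjE sqmodJ lerDl.
  by apply: sumr_ge0 => k _; apply: sqmod_ge0.
have -> : (invmx E)^t* *m col i Q0 = S^t* *m col i (invmx T).
  rewrite -!colM; congr col; rewrite -invmx_adj //.
  have uE' := unitmx_adj uE.
  apply: (row_full_inj (A := E^t*)); first by rewrite row_full_unit.
  rewrite mulmxA mulmxV // mul1mx mulmxA.
  have -> : E^t* *m S^t* = Q0 *m T by rewrite eT !mulmxA (unitaryL hQ0) mul1mx.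
  by rewrite -mulmxA mulmxV // mulmx1.
rewrite sqn_unitary // sqn_col (bigD1 i) //= trig_inv_ii //.
have -> : sqmod (T i i)^-1 = (sqmod (T i i))^-1.
  have t0 := trig_unit i tT uT.
  apply: (mulfI (x := sqmod (T i i))); first by rewrite sqmod_eq0.
  by rewrite -sqmodM !mulfV ?sqmod_eq0 // -[1]/(1%:C) sqmodR expr1n.
by rewrite lerDl; apply: sumr_ge0 => k _; apply: sqmod_ge0.
Qed.

(** The number [b] controls how far the factor [E] can move the diagonal of a QR
    factor in the direction [e].  Quantifying over all frames [Q0], and over all
    [t] that satisfy the bounds of [qr_bounds], is what lets the bounds of
    successive factors be added. *)
Definition diagbound (e : 'I_n -> R) E (b : R) := E \in unitmx /\
  forall Q0 (t : 'I_n -> R), Q0 \is unitarymx ->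
  (forall i, [/\ 0 < t i, t i <= sqn (E *m col i Q0) &
     (t i)^-1 <= sqn ((invmx E)^t* *m col i Q0)]) ->
  - \sum_i e i * ln (t i) <= b.

(** QR factors are multiplicative along a product: the unitary factor of one step
    is the frame of the next, and the triangular factors multiply, so that the
    logarithms of their diagonal entries add. *)
Lemma diagbound_acc e (E M : nat -> 'M[C]_n) (b : nat -> R) :
  M 0%N = E 0%N -> (forall k, M k.+1 = E k.+1 *m M k) ->
  (forall k, diagbound e (E k) (b k)) ->
  forall V k, V \is unitarymx ->
  exists Q T, [/\ Q \is unitarymx, is_trig_mx T, T \in unitmx,
    M k *m V = Q *m T^t* &
   - \sum_i e i * ln (sqmod (T i i)) <= \sum_(j < k.+1) b j].
Proof.
move=> M0 MS hb V k hV; elim: k => [|k [Q [T [hQ tT uT eMV le]]]].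
  have [uE hE] := hb 0%N.
  have [Q [T [hQ tT uT eQT ht]]] := qr_bounds uE hV.
  exists Q, T; split; rewrite ?M0 // big_ord_recl big_ord0 addr0.
  apply: hE hV _ => i; have [h1 h2] := ht i; split => //.
  by rewrite lt_def sqmod_ge0 andbT sqmod_eq0 trig_unit.
have [uE hE] := hb k.+1.
have [Q' [T' [hQ' tT' uT' eQT' ht]]] := qr_bounds uE hQ.
exists Q', (T *m T'); split=> //.
- exact: trig_mul.
- by rewrite unitmx_mul uT.
- by rewrite MS -mulmxA eMV mulmxA eQT' adjM mulmxA.
rewrite big_ord_recr /=.
have pos (S : 'M[C]_n) i : is_trig_mx S -> S \in unitmx -> 0 < sqmod (S i i).
  by move=> tS uS; rewrite lt_def sqmod_ge0 andbT sqmod_eq0 trig_unit.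
have -> : \sum_i e i * ln (sqmod ((T *m T') i i)) =
  \sum_i e i * ln (sqmod (T i i)) + \sum_i e i * ln (sqmod (T' i i)).
  rewrite -big_split /=; apply: eq_bigr => i _.
  by rewrite trig_mulii // sqmodM lnM ?posrE ?pos // mulrDr.
rewrite opprD; apply: lerD => //; apply: hE hQ _ => i.
by have [h1 h2] := ht i; split => //; exact: pos.
Qed.

(** If V diagonalises the Gram matrix of M_k, then the columns of M_k V are
    orthogonal, and its triangular factor is diagonal with the singular values of
    M_k as entries.  This is the triangle inequality in the symmetric space of
    positive definite matrices, tested against the weights [e]. *)
Lemma sing_bound e (E M : nat -> 'M[C]_n) (b : nat -> R) V d k :
  M 0%N = E 0%N -> (forall k, M k.+1 = E k.+1 *m M k) ->
  (forall k, diagbound e (E k) (b k)) ->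
  V \is unitarymx -> (M k)^t* *m M k = udg V d ->
  - \sum_i e i * ln (d i) <= \sum_(j < k.+1) b j.
Proof.
move=> M0 MS hb hV eM; have [Q [T [hQ tT uT eMV]]] := diagbound_acc M0 MS hb k hV.
have -> // : \sum_i e i * ln (sqmod (T i i)) = \sum_i e i * ln (d i).
apply: eq_bigr => i _; congr (_ * ln _).
have eTT : T *m T^t* = dg d.
  have e1 : T^t* = Q^t* *m (M k *m V) by rewrite eMV mulmxA (unitaryR hQ) mul1mx.
  have e2 : T = V^t* *m (M k)^t* *m Q by rewrite -[LHS]adjK e1 2!adjM adjK.
  rewrite e1 {1}e2 mulmxA -(mulmxA _ Q) (unitaryL hQ) mulmx1 mulmxA.
  rewrite -(mulmxA _ _ (M k)).
  by rewrite eM /udg !mulmxA (unitaryR hV) mul1mx -mulmxA (unitaryR hV) mulmx1.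
have : T^t* = invmx T *m dg d by rewrite -eTT mulKmx.
move/(congr1 (fun A : 'M[C]_n => A i i)).
rewrite adjE [in RHS]/dg mul_mx_diag !mxE trig_inv_ii // => h.
have t0 := trig_unit i tT uT.
by apply: complexI; rewrite -sqmodE h mulrA mulfV // mul1r.
Qed.

End Triangle.

(** * Exponential factors and Jensen's inequality *)

Section Steps.
Variable R : realType.
Local Notation C := R[i].
Variable n : nat.
Implicit Types (E Q T V U : 'M[C]_n) (z w : 'cV[C]_n).

Definition hqr (A : 'M[C]_n) z : R := complex.Re (hq A z).

Lemma hqr_udg V (d : 'I_n -> R) z :
  hqr (udg V d) z = \sum_i d i * sqmod ((V^t* *m z) i 0).
Proof. by rewrite /hqr hq_udg. Qed.

Lemma hqrMM E z : hqr (E^t* *m E) z = sqn (E *m z).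
Proof. by rewrite /hqr hqMM. Qed.

Lemma sum_sqmod_unitary V z : V \is unitarymx ->
  \sum_i sqmod ((V^t* *m z) i 0) = sqn z.
Proof. by move=> hV; rewrite -(sqn_unitary z (unitary_adj hV)). Qed.

Lemma sqmod_unitary_le V z i : V \is unitarymx -> sqmod ((V^t* *m z) i 0) <= sqn z.
Proof.
move=> hV; rewrite -(sum_sqmod_unitary _ hV) (bigD1 i) //= lerDl.
by apply: sumr_ge0 => k _; apply: sqmod_ge0.
Qed.

(** Here E is exp(-eps B), up to a unitary factor, with B = [udg U b]; the bound
    expands |E z|^2 to second order. *)
Lemma sqn_exp_le E U b eps z : U \is unitarymx ->
  E^t* *m E = udg U (fun i => expR (- (2 * eps * b i))) ->
  (forall i, `|2 * eps * b i| <= 1 / 2) -> sqn z = 1 ->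
  sqn (E *m z) <= 1 - 2 * eps * hqr (udg U b) z + 8 * eps ^+ 2 * \sum_i b i ^+ 2.
Proof.
move=> hU eE hb z1; rewrite -hqrMM eE !hqr_udg.
set p := fun i => sqmod ((U^t* *m z) i 0).
have p0 i : 0 <= p i by apply: sqmod_ge0.
have p1 i : p i <= 1 by rewrite -z1; apply: sqmod_unitary_le.
have sp : \sum_i p i = 1 by rewrite sum_sqmod_unitary.
rewrite -[X in X - _]sp !mulr_sumr -sumrB -big_split /=; apply: ler_sum => i _.
have h := @expR_le_quad R (- (2 * eps * b i)).
have {}h : expR (- (2 * eps * b i)) <= 1 - 2 * eps * b i + 2 * (2 * eps * b i) ^+ 2.
  rewrite -[X in _ <= _ + _ * X]sqrrN; apply: h.
  by apply: le_trans (hb i); apply: le_trans (ler_norm _) _; rewrite normrN.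
apply: le_trans (ler_wpM2r (p0 i) h) _.
have h2 : (2 * eps * b i) ^+ 2 * p i <= (2 * eps * b i) ^+ 2 * 1.
  by apply: ler_wpM2l; rewrite ?sqr_ge0.
rewrite -/(p i); lra.
Qed.

Lemma unit_gram E U (d : 'I_n -> R) : U \is unitarymx -> (forall i, d i != 0) ->
  E^t* *m E = udg U d -> E \in unitmx.
Proof.
move=> hU d0 eE; have : \det (E^t* *m E) != 0.
  rewrite eE det_udg // -[0]/(0%:C) (inj_eq (@complexI R)).
  by apply/prodf_neq0 => i _.
by rewrite det_mulmx mulf_eq0 negb_or unitmxE unitfE => /andP [].
Qed.

Lemma gram_inv E U (d : 'I_n -> R) : U \is unitarymx -> (forall i, d i != 0) ->
  E^t* *m E = udg U d ->
  ((invmx E)^t*)^t* *m (invmx E)^t* = udg U (fun i => (d i)^-1).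
Proof.
move=> hU d0 eE; have uE := unit_gram hU d0 eE.
rewrite adjK -invmx_adj //.
have e1 : udg U (fun i => (d i)^-1) *m (E^t* *m E) = 1%:M.
  rewrite eE udgM // -[RHS](udg1 hU); congr udg.
  by apply/funext => i; rewrite mulVf.
have e2 : udg U (fun i => (d i)^-1) *m E^t* = invmx E.
  by rewrite -[LHS](mulmxK uE) -(mulmxA _ (E^t*) E) e1 mul1mx.
by rewrite -e2 (mulmxK (unitmx_adj uE)).
Qed.

Lemma hq_col E Q i : hq E (col i Q) = (Q^t* *m E *m Q) i i.
Proof.
rewrite /hq.
have -> : (col i Q)^t* = row i (Q^t*) by apply/matrixP => a b; rewrite !mxE.
by rewrite -row_mul !mxE; apply: eq_bigr => j _; rewrite !mxE.
Qed.

Lemma sqn_col1 Q i : Q \is unitarymx -> sqn (col i Q) = 1.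
Proof.
move=> hQ; apply: complexI.
by rewrite -hq1 hq_col mulmx1 (unitaryR hQ) mxE eqxx.
Qed.

(** The diagonal of a matrix is at most as long as the matrix itself. *)
Lemma sum_hqr_le U b Q : U \is unitarymx -> Q \is unitarymx ->
  \sum_i hqr (udg U b) (col i Q) ^+ 2 <= \sum_i b i ^+ 2.
Proof.
move=> hU hQ; rewrite -(frob2_udg b hU) -(frob2_unitary (udg U b) hQ) /frob2.
apply: ler_sum => i _; rewrite (bigD1 i) //= -hq_col /hqr.
apply: (@le_trans _ _ (sqmod (hq (udg U b) (col i Q)))).
  by rewrite /sqmod lerDl sqr_ge0.
by rewrite lerDl; apply: sumr_ge0 => k _; apply: sqmod_ge0.
Qed.

(** In a frame (q_i) the logarithm of the squared i-th diagonal entry is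
    -2 eps <B q_i, q_i> up to a quadratic error.  Cauchy-Schwarz bounds the
    weighted sum of the linear terms by s F. *)
Lemma diagbound_step (e : 'I_n -> R) (s eps F : R) E U b :
  0 <= s -> 0 <= eps -> 0 <= F ->
  \sum_i e i ^+ 2 <= s ^+ 2 -> \sum_i b i ^+ 2 = F ^+ 2 -> U \is unitarymx ->
  E^t* *m E = udg U (fun i => expR (- (2 * eps * b i))) ->
  (forall i, `|2 * eps * b i| <= 1 / 2) ->
  diagbound e E (s * (2 * eps * F + 8 * n%:R * eps ^+ 2 * F ^+ 2)).
Proof.
move=> s0 eps0 F0 he hb hU eE hs.
have d0 i : expR (- (2 * eps * b i)) != 0 by rewrite gt_eqF // expR_gt0.
have uE := unit_gram hU d0 eE.
split=> // Q0 t hQ0 ht.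
pose be i := hqr (udg U b) (col i Q0).
have up i : ln (t i) <= - 2 * eps * be i + 8 * eps ^+ 2 * F ^+ 2.
  have [t0 h1 _] := ht i; apply: le_trans (ln_le_sub1 t0) _.
  have := sqn_exp_le hU eE hs (sqn_col1 i hQ0).
  rewrite -/(be i) hb => h2; lra.
have lo i : - ln (t i) <= 2 * eps * be i + 8 * eps ^+ 2 * F ^+ 2.
  have [t0 _ h1] := ht i; rewrite -lnV ?posrE //.
  apply: le_trans (ln_le_sub1 _) _; first by rewrite invr_gt0.
  have eE' : ((invmx E)^t*)^t* *m (invmx E)^t* =
     udg U (fun i => expR (- (2 * eps * (- b i)))).
    rewrite (gram_inv hU d0 eE); congr udg; apply/funext => j.
    by rewrite -expRN mulrN.
  have hs' j : `|2 * eps * (- b j)| <= 1 / 2 by rewrite mulrN normrN.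
  have := sqn_exp_le hU eE' hs' (sqn_col1 i hQ0).
  have -> : \sum_i (- b i) ^+ 2 = F ^+ 2.
    by rewrite -hb; apply: eq_bigr => j _; rewrite sqrrN.
  have -> : hqr (udg U (fun i => - b i)) (col i Q0) = - be i.
    by rewrite /be !hqr_udg -sumrN; apply: eq_bigr => j _; rewrite mulNr.
  move=> h2; lra.
have es i : `|e i| <= s := sum_sq_entry i s0 he.
have key i : - (e i * ln (t i)) <= 2 * eps * (e i * be i) + s * (8 * eps ^+ 2 * F ^+ 2).
  have hK : 0 <= 8 * eps ^+ 2 * F ^+ 2 by rewrite !mulr_ge0 ?sqr_ge0.
  have h : `|ln (t i) + 2 * eps * be i| <= 8 * eps ^+ 2 * F ^+ 2.
    by rewrite ler_norml; have := up i; have := lo i => ? ?; apply/andP; split; lra.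
  have : `|e i * (ln (t i) + 2 * eps * be i)| <= s * (8 * eps ^+ 2 * F ^+ 2).
    by rewrite normrM; apply: ler_pM.
  rewrite ler_norml => /andP [h1 _]; lra.
rewrite -sumrN; apply: le_trans (ler_sum _ (fun i _ => key i)) _.
rewrite big_split /= -mulr_sumr sumr_const card_ord -mulr_natr.
have hbe : \sum_i e i * be i <= s * F.
  by apply: CS_sum => //; rewrite -hb; apply: sum_hqr_le.
have := ler_wpM2l (mulr_ge0 (ler0n R 2) eps0) hbe; lra.
Qed.

Lemma sqn_mul_le E z : sqn z = 1 -> sqn (E *m z) <= frob2 E.
Proof.
move=> z1; have [U [w [hU eE]]] : exists U (w : 'I_n -> R), U \is unitarymx /\ E^t* *m E = udg U w.
  by apply: herm_spectral; rewrite adjM adjK.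
have w0 i : 0 <= w i.
  have := sqn_ge0 (E *m col i U); rewrite -hqrMM eE /hqr hq_col /udg.
  by rewrite -!mulmxA unitaryR // mulmx1 mulmxA unitaryR // mul1mx dgE eqxx.
have -> : frob2 E = \sum_i w i.
  apply: complexI; rewrite -(mxtrace_udg w hU) -eE.
  by rewrite -frob2E mxtrace_mulC.
rewrite -hqrMM eE hqr_udg; apply: ler_sum => i _.
by rewrite ler_piMr // -z1; apply: sqmod_unitary_le.
Qed.

(** A crude bound is enough for the factor that does not depend on the step
    size. *)
Lemma diagbound_first (e : 'I_n -> R) (s : R) E : 0 <= s -> E \in unitmx ->
  \sum_i e i ^+ 2 <= s ^+ 2 ->
  diagbound e E (s * (n%:R * (frob2 E + frob2 (invmx E)))).
Proof.
move=> s0 uE he; split => // Q0 t hQ0 ht.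
have es i : `|e i| <= s := sum_sq_entry i s0 he.
have key i : - (e i * ln (t i)) <= s * (frob2 E + frob2 (invmx E)).
  have [t0 h1 h2] := ht i.
  have u1 : ln (t i) <= frob2 E.
    apply: le_trans (ln_le_sub1 t0) _; apply: le_trans (sqn_mul_le E (sqn_col1 i hQ0)).
    by lra.
  have u2 : - ln (t i) <= frob2 (invmx E).
    rewrite -lnV ?posrE //; apply: le_trans (ln_le_sub1 _) _; first by rewrite invr_gt0.
    rewrite -frob2_adj; apply: le_trans (sqn_mul_le _ (sqn_col1 i hQ0)).
    by lra.
  have : `|e i * ln (t i)| <= s * (frob2 E + frob2 (invmx E)).
    rewrite normrM; apply: ler_pM => //.
    have f1 := frob2_ge0 E; have f2 := frob2_ge0 (invmx E).
    by rewrite ler_norml; apply/andP; split; lra.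
  by rewrite ler_norml => /andP [h3 _]; lra.
rewrite -sumrN; apply: le_trans (ler_sum _ (fun i _ => key i)) _.
by rewrite sumr_const card_ord -mulr_natr; lra.
Qed.

(** The weights in Jensen's inequality are those of z in the eigenbasis of the
    Gram matrix. *)
Lemma jensen_gram E V (d : 'I_n -> R) z : V \is unitarymx -> (forall i, 0 < d i) ->
  E^t* *m E = udg V d -> sqn z = 1 ->
  hqr (udg V (fun i => ln (d i))) z <= ln (sqn (E *m z)).
Proof.
move=> hV d0 eE z1; rewrite -hqrMM eE !hqr_udg.
have := @ln_jensen R _ (fun i => sqmod ((V^t* *m z) i 0)) d
  (fun i => sqmod_ge0 _) d0.
rewrite (sum_sqmod_unitary _ hV) => /(_ z1) h.
have -> : \sum_i ln (d i) * sqmod ((V^t* *m z) i 0) =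
  \sum_i sqmod ((V^t* *m z) i 0) * ln (d i) by apply: eq_bigr => i _; rewrite mulrC.
apply: le_trans h _; apply: le_of_eq; congr ln.
by apply: eq_bigr => i _; rewrite mulrC.
Qed.

Lemma gram_pos E : E \in unitmx -> exists V (d : 'I_n -> R),
  [/\ V \is unitarymx, forall i, 0 < d i & E^t* *m E = udg V d].
Proof.
move=> uE; have [V [d [hV eE]]] : exists U (w : 'I_n -> R), U \is unitarymx /\ E^t* *m E = udg U w.
  by apply: herm_spectral; rewrite adjM adjK.
exists V, d; split=> // i.
have -> : d i = sqn (E *m col i V).
  rewrite -hqrMM eE /hqr hq_col /udg.
  by rewrite -!mulmxA unitaryR // mulmx1 mulmxA unitaryR // mul1mx dgE eqxx.
rewrite sqn_gt0; apply/eqP => h.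
have e : col i V = 0 by rewrite -[LHS](mulKmx uE) h mulmx0.
have s0 : sqn (0 : 'cV[C]_n) = 0 by apply/eqP; rewrite sqn_eq0.
by have := sqn_col1 i hV; rewrite e s0 => /eqP; rewrite eq_sym oner_eq0.
Qed.

End Steps.

(** * Invariant scalar products on su(n) *)

Section InvariantProduct.
Variable R : realType.
Local Notation C := R[i].
Variable n : nat.
Implicit Types (X Y Z V : 'M[C]_n).

Lemma suD X Y : su X -> su Y -> su (X + Y).
Proof. by move=> [x1 x2] [y1 y2]; split; rewrite ?adjD ?mxtraceD ?x1 ?y1 ?x2 ?y2 ?opprD ?addr0. Qed.

Lemma su0 : su (0 : 'M[C]_n).
Proof. by split; [apply/matrixP => i j; rewrite adjE !mxE conjC0 oppr0 | rewrite mxtrace0]. Qed.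

Lemma suZ (a : R) X : su X -> su (a%:C *: X).
Proof.
move=> [x1 x2]; split; last by rewrite mxtraceZ x2 mulr0.
by rewrite adjZ x1 scalerN; congr (- (_ *: _)); exact: conjc_real.
Qed.

Lemma conj_i : ('i%C : C)^* = - 'i%C.
Proof. by apply/eqP; rewrite eq_complex /= oppr0 !eqxx. Qed.

Lemma su_herm X : X^t* = X -> \tr X = 0 -> su ('i%C *: X).
Proof.
move=> h t; split; last by rewrite mxtraceZ t mulr0.
by rewrite adjZ h conj_i scaleNr.
Qed.

Lemma su_iX X : su X -> exists H : 'M[C]_n, [/\ H^t* = H, \tr H = 0 & X = 'i%C *: H].
Proof.
move=> [h t]; exists (- 'i%C *: X); split; rewrite ?mxtraceZ ?t ?mulr0 //.
  by rewrite adjZ h scalerN -scaleNr rmorphN /= conj_i opprK.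
by rewrite scalerA mulrN -expr2 sqr_i opprK scale1r.
Qed.

Variable ip : 'M[C]_n -> 'M[C]_n -> R.
Hypothesis hip : invariant_scalar_product ip.

Lemma ipDl X Y Z : su X -> su Y -> su Z -> ip (X + Y) Z = ip X Z + ip Y Z.
Proof. by have [h _ _ _] := hip; move=> hX hY hZ; have := h 1 X Y Z hX hY hZ; rewrite rmorph1 scale1r mul1r. Qed.

Lemma ip0l Z : su Z -> ip 0 Z = 0.
Proof.
move=> hZ; have := ipDl su0 su0 hZ; rewrite addr0 => /eqP.
by rewrite -[X in X == _]addr0 (inj_eq (addrI _)) => /eqP.
Qed.

Lemma ipC X Y : su X -> su Y -> ip X Y = ip Y X.
Proof. by have [_ h _ _] := hip; exact: h. Qed.

Lemma ipZl a X Z : su X -> su Z -> ip (a%:C *: X) Z = a * ip X Z.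
Proof.
have [h _ _ _] := hip; move=> hX hZ; have := h a X 0 Z hX su0 hZ.
by rewrite !addr0 ip0l ?addr0.
Qed.

Lemma su_sum (I : finType) (d : I -> R) (N : I -> 'M[C]_n) :
  (forall k, su (N k)) -> su (\sum_k (d k)%:C *: N k).
Proof. by move=> hN; elim/big_rec: _ => [|k x _ hx]; [exact: su0|apply: suD => //; apply: suZ]. Qed.

Lemma ip_suml (I : finType) (d : I -> R) (N : I -> 'M[C]_n) Z :
  (forall k, su (N k)) -> su Z -> ip (\sum_k (d k)%:C *: N k) Z = \sum_k d k * ip (N k) Z.
Proof.
move=> hN hZ; suff : su (\sum_k (d k)%:C *: N k) /\
  ip (\sum_k (d k)%:C *: N k) Z = \sum_k d k * ip (N k) Z by case.
elim/big_rec2: _ => [|k x y _ [hx e]]; first by split; [exact: su0|rewrite ip0l].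
by split; [apply: suD => //; apply: suZ|rewrite ipDl ?ipZl ?e //; apply: suZ].
Qed.

(** i times the traceless part of the k-th diagonal matrix unit.  These matrices
    span the diagonal part of su(n), and their sum is 0. *)
Definition cartan (k : 'I_n) : 'M[C]_n :=
  'i%C *: dg (fun j => (j == k)%:R - n%:R^-1 : R).

Lemma su_cartan k : su (cartan k).
Proof.
apply: su_herm; first exact: adj_dg.
have n0 : (0 < n)%N by case: n k => [[]|].
rewrite mxtrace_dg sumrB (bigD1 k) //= big1 => [|j /negPf -> //].
rewrite eqxx sumr_const card_ord addr0 -[X in _ - X]mulr_natr mulVf ?subrr //.
by rewrite pnatr_eq0 -lt0n.
Qed.

Lemma sum_cartan (d : 'I_n -> R) : \sum_k d k = 0 ->
  'i%C *: dg d = \sum_k (d k)%:C *: cartan k.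
Proof.
move=> d0; apply/matrixP => i j; rewrite mxE summxE dgE.
case: (eqVneq i j) => [->|ij]; last first.
  rewrite mulr0n mulr0 big1 // => k _.
  by rewrite !mxE (negPf ij) mulr0n !mulr0.
rewrite mulr1n.
transitivity ('i%C * (\sum_k d k * ((j == k)%:R - n%:R^-1))%:C); last first.
  rewrite rmorph_sum mulr_sumr; apply: eq_bigr => k _.
  by rewrite !mxE eqxx mulr1n rmorphM /= mulrCA.
congr (_ * _%:C).
transitivity (\sum_k (d k * (j == k)%:R - d k / n%:R)); last first.
  by apply: eq_bigr => k _; rewrite mulrBr.
rewrite sumrB -mulr_suml d0 mul0r subr0 (bigD1 j) //= eqxx mulr1 big1 ?addr0 //.
by move=> k /negPf; rewrite eq_sym => ->; rewrite mulr0.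
Qed.

(** A transposition with one sign changed, which makes the determinant 1. *)
Definition swapmx (i j : 'I_n) : 'M[C]_n :=
  perm_mx (tperm i j) *m dg (fun k => if k == i then -1 else 1 : R).

Lemma swapmx_unitary i j : swapmx i j \is unitarymx.
Proof.
apply: unitaryI; rewrite /swapmx adjM adj_dg -mulmxA (mulmxA (dg _)) dgM.
have -> : (fun k => (if k == i then -1 else 1) * (if k == i then -1 else 1) : R) = (fun=> 1).
  by apply/funext => k; case: eqP => _; rewrite ?mulr1 // mulrNN mulr1.
rewrite dg1 mul1mx tr_perm_mx map_perm_mx -perm_mxM mulgV; exact: perm_mx1.
Qed.

Lemma swapmx_det i j : i != j -> \det (swapmx i j) = 1.
Proof.
move=> ij; rewrite det_mulmx det_perm odd_tperm ij det_dg (bigD1 i) //= eqxx.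
rewrite big1 => [|k /negPf -> //]; rewrite mulr1 expr1 rmorphN rmorph1 mulrNN mulr1 //.
Qed.

Lemma swapmx_conj i j (e : 'I_n -> R) :
  swapmx i j *m dg e *m (swapmx i j)^t* = dg (fun k => e (tperm i j k)).
Proof.
set s := fun k => if k == i then -1 else 1 : R.
have es : dg s *m dg e *m dg s = dg e.
  rewrite !dgM; congr dg; apply/funext => k; rewrite /s.
  by case: eqP => _; rewrite ?mulr1 ?mul1r // mulrN1 mulN1r opprK.
rewrite /swapmx -/s adjM adj_dg !mulmxA.
rewrite -(mulmxA _ (dg s) (dg e)) -(mulmxA _ (dg s *m dg e)) es.
rewrite tr_perm_mx map_perm_mx -row_permE -col_permE.
by apply/matrixP => a b; rewrite !mxE (inj_eq perm_inj).
Qed.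

Lemma cartan_swap i j k :
  swapmx i j *m cartan k *m invmx (swapmx i j) = cartan (tperm i j k).
Proof.
rewrite (invmx_unitary (swapmx_unitary i j)) /cartan -scalemxAr -scalemxAl swapmx_conj.
congr (_ *: dg _); apply/funext => l; congr (_%:R - _).
by rewrite -(inj_eq (@perm_inj _ (tperm i j))) tpermK.
Qed.

Let B k l := ip (cartan k) (cartan l).

Lemma B_swap i j k l : B (tperm i j k) (tperm i j l) = B k l.
Proof.
have [->|ij] := eqVneq i j; first by rewrite tperm1 !perm1.
have [_ _ _ h] := hip; rewrite /B -!cartan_swap; apply: h; try exact: su_cartan.
by split; [exact: swapmx_unitary|exact: swapmx_det].
Qed.

Lemma B_diag k k0 : B k k = B k0 k0.
Proof. by rewrite -(B_swap k k0) tpermL. Qed.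

Lemma B_offdiag k l k0 l0 : k != l -> k0 != l0 -> B k l = B k0 l0.
Proof.
move=> kl kl0; rewrite -(B_swap k k0) tpermL; set l' := tperm _ _ _.
have hl' : k0 != l' by rewrite -(tpermL k k0) (inj_eq perm_inj).
by rewrite -(B_swap l' l0) tpermL tpermD // eq_sym.
Qed.

(** Permutations of the coordinates preserve the Gram matrix of the family
    [cartan], so it has one value on the diagonal and one off it.  On coefficients
    of sum 0 only the difference of the two values survives. *)
Lemma ip_diag_exists : (1 < n)%N -> exists2 c, 0 < c &
  forall d : 'I_n -> R, \sum_k d k = 0 ->
    ip ('i%C *: dg d) ('i%C *: dg d) = c * \sum_k d k ^+ 2.
Proof.
move=> n1; pose k0 := Ordinal (ltnW n1); pose l0 := Ordinal n1.
have kl0 : k0 != l0 by [].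
have key (d : 'I_n -> R) : \sum_k d k = 0 ->
    ip ('i%C *: dg d) ('i%C *: dg d) = (B k0 k0 - B k0 l0) * \sum_k d k ^+ 2.
  move=> d0; rewrite sum_cartan //.
  rewrite ip_suml; [|exact: su_cartan|apply: su_sum; exact: su_cartan].
  rewrite mulr_sumr; apply: eq_bigr => k _.
  rewrite ipC; [|exact: su_cartan|apply: su_sum; exact: su_cartan].
  rewrite ip_suml; [|exact: su_cartan|exact: su_cartan].
  rewrite (bigD1 k) //= -/(B k k) (B_diag k k0).
  have -> : \sum_(i < n | i != k) d i * ip (cartan i) (cartan k) =
     (\sum_(i < n | i != k) d i) * B k0 l0.
    rewrite mulr_suml; apply: eq_bigr => i ik; congr (_ * _).
    exact: B_offdiag.
  have -> : \sum_(i < n | i != k) d i = - d k.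
    by have := d0; rewrite (bigD1 k) //= => h; apply/eqP; rewrite -addr_eq0 addrC h.
  ring.
exists (B k0 k0 - B k0 l0) => //.
pose d k : R := (k == k0)%:R - (k == l0)%:R.
have d0 : \sum_k d k = 0.
  rewrite sumrB (bigD1 k0) //= big1 => [|i /negPf -> //].
  by rewrite (bigD1 l0) //= big1 ?eqxx ?addr0 ?subrr // => i /negPf ->.
have hd := key d d0.
have d2 : 0 < \sum_k d k ^+ 2.
  rewrite (bigD1 k0) //= /d eqxx /= subr0 expr1n ltr_wpDr //.
  by apply: sumr_ge0 => i _; apply: sqr_ge0.
rewrite -(pmulr_lgt0 _ d2) -hd.
have [_ _ h _] := hip; apply: h.
  by apply: su_herm; rewrite ?adj_dg // mxtrace_dg d0.
apply/eqP => /(congr1 (fun A : 'M[C]_n => A k0 k0)); rewrite mxE dgE eqxx mulr1n mxE /d eqxx /= subr0.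
by move/eqP; rewrite mulr1 eq_complex /= oner_eq0 andbF.
Qed.

(** Multiplying one eigenvector by a phase brings the determinant to 1. *)
Lemma special_spectral (H : 'M[C]_n) : (0 < n)%N -> H^t* = H ->
  exists V d, [/\ V \is unitarymx, \det V = 1 & H = udg V d].
Proof.
move=> n0 hH; have [V [d [hV eH]]] := herm_spectral hH.
(* the phase that corrects the determinant sits on the eigenvector k0 *)
pose k0 := Ordinal n0; pose u : 'rV[C]_n := \row_i (if i == k0 then (\det V)^* else 1).
have dV : \det V * (\det V)^* = 1.
  have -> : (\det V)^* = \det (V^t*) by rewrite det_map_mx det_tr.
  by rewrite -det_mulmx (unitaryL hV) det1.
have uu : diag_mx u *m (diag_mx u)^t* = 1%:M.
  rewrite tr_diag_mx map_diag_mx mulmx_diag.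
  apply/matrixP => i j; rewrite !mxE; congr (_ *+ _).
  by case: eqP => _ /=; rewrite ?conjC1 ?mulr1 // conjCK mulrC dV.
have comm : diag_mx u *m dg d = dg d *m diag_mx u.
  by rewrite /dg !mulmx_diag; congr diag_mx; apply/rowP => i; rewrite !mxE mulrC.
exists (V *m diag_mx u), d; split.
- by apply: unitaryI; rewrite adjM mulmxA -(mulmxA V) uu mulmx1 (unitaryL hV).
- rewrite det_mulmx det_diag (bigD1 k0) //= big1 => [|i /negPf h]; last by rewrite mxE h.
  by rewrite mxE eqxx mulr1.
rewrite eH /udg adjM -!mulmxA; congr (_ *m _).
by rewrite (mulmxA _ (dg d)) comm -mulmxA (mulmxA (diag_mx u)) uu mul1mx.
Qed.

(** Every element of su(n) is conjugate under SU(n) to a diagonal one, so the two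
    quadratic forms agree by [ip_diag_exists], and the bilinear forms by
    polarisation. *)
Lemma ip_trace : (0 < n)%N -> exists2 c, 0 < c &
  forall X Y, su X -> su Y -> ip X Y = - c * complex.Re (\tr (X *m Y)).
Proof.
move=> n0; have [n1|n1] := leqP n 1.
  exists 1 => // X Y [_ tX] hY.
  have -> : X = 0.
    have en : n = 1%N by apply/eqP; rewrite eqn_leq n1.
    move: X tX; rewrite en => X tX; apply/matrixP => i j; rewrite !ord1 [RHS]mxE -tX.
    by rewrite /mxtrace big_ord_recl big_ord0 addr0.
  by rewrite ip0l // mul0mx mxtrace0 mulr0.
have [c c0 hc] := ip_diag_exists n1; exists c => //.
have [_ _ _ hinv] := hip.
have Q X : su X -> ip X X = - c * complex.Re (\tr (X *m X)).
  move=> hX; have [H [hH tH eX]] := su_iX hX.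
  have [V [d [hV dV eH]]] := special_spectral n0 hH.
  have sd : \sum_i d i = 0 by apply: complexI; rewrite -(mxtrace_udg d hV) -eH tH.
  have eX2 : X = V *m ('i%C *: dg d) *m invmx V.
    by rewrite eX eH /udg (invmx_unitary hV) -scalemxAr -scalemxAl.
  have sX : su ('i%C *: dg d) by apply: su_herm; rewrite ?adj_dg // mxtrace_dg sd.
  rewrite {1 2}eX2 hinv // hc //.
  rewrite eX -scalemxAl -scalemxAr scalerA -expr2 sqr_i eH udgM // mxtraceZ.
  rewrite mxtrace_udg // mulN1r raddfN /= mulrNN; congr (_ * _).
move=> X Y hX hY.
have e1 := Q _ (suD hX hY).
have e2 : ip (X + Y) (X + Y) = ip X X + ip Y Y + 2 * ip X Y.
  rewrite ipDl //; last exact: suD.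
  rewrite (ipC hX (suD hX hY)) (ipC hY (suD hX hY)) !ipDl // (ipC hY hX); ring.
have e3 : \tr ((X + Y) *m (X + Y)) = \tr (X *m X) + \tr (Y *m Y) + (\tr (X *m Y) + \tr (X *m Y)).
  rewrite mulmxDl !mulmxDr !mxtraceD (mxtrace_mulC Y X); ring.
have ReD (x y : C) : complex.Re (x + y) = complex.Re x + complex.Re y.
  by case: x; case: y.
move: e1; rewrite e2 e3 !Q // !ReD.
move=> e; lra.
Qed.

End InvariantProduct.

(** * Matrix norms and the matrix exponential *)

Section MatrixNorm.
Variable R : realType.

Lemma mx_entry_le m n (A : 'M[R]_(m, n)) i j : `|A i j| <= `|A|.
Proof.
rewrite [X in _ <= X]mx_normrE; exact: (le_bigmax _ (fun ij => `|A ij.1 ij.2|) (i, j)).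
Qed.

Lemma mx_norm_le m n (A : 'M[R]_(m, n)) c : 0 <= c -> (forall i j, `|A i j| <= c) -> `|A| <= c.
Proof.
move=> c0 h; rewrite [X in X <= _]mx_normrE; apply: bigmax_le => // ij _; exact: h.
Qed.

Lemma mx_normM m n p (A : 'M[R]_(m, n)) (B : 'M[R]_(n, p)) :
  `|A *m B| <= n%:R * (`|A| * `|B|).
Proof.
apply: mx_norm_le => [|i j]; first by rewrite !mulr_ge0.
rewrite mxE; apply: le_trans (ler_norm_sum _ _ _) _.
have -> : n%:R * (`|A| * `|B|) = \sum_(k < n) (`|A| * `|B|).
  by rewrite sumr_const card_ord mulr_natl.
by apply: ler_sum => k _; rewrite normrM ler_pM // mx_entry_le.
Qed.

Lemma mx_norm1 n : `|1%:M : 'M[R]_n| <= 1.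
Proof.
by apply: mx_norm_le => // i j; rewrite mxE; case: eqP => _; rewrite ?normr1 ?normr0.
Qed.

Lemma cvg_fsum (I : finType) (f : I -> nat -> R) (l : I -> R) :
  (forall i, f i k @[k --> \oo] --> l i) ->
  (\sum_i f i k) @[k --> \oo] --> \sum_i l i.
Proof.
move=> h; elim: (index_enum I) => [|i r IH].
  by rewrite big_nil; under eq_fun do rewrite big_nil; exact: cvg_cst.
by rewrite big_cons; under eq_fun do rewrite big_cons; exact: cvgD.
Qed.

Lemma cvg_mx m n (u : nat -> 'M[R]_(m, n)) (l : 'M[R]_(m, n)) :
  (forall i j, u k i j @[k --> \oo] --> l i j) -> u @ \oo --> l.
Proof.
move=> h; apply/cvgrPdist_le => e e0.
have : \forall k \near \oo, forall ij : 'I_m * 'I_n, `|l ij.1 ij.2 - u k ij.1 ij.2| <= e.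
  apply: filter_forall => -[i j] /=.
  by have /cvgrPdist_le := h i j; apply.
apply: filterS => k hk; apply: mx_norm_le; first exact: ltW.
by move=> i j; rewrite !mxE; apply: (hk (i, j)).
Qed.

Lemma cvg_coord m n (u : nat -> 'M[R]_(m, n)) (l : 'M[R]_(m, n)) :
  u @ \oo --> l -> forall i j, u k i j @[k --> \oo] --> l i j.
Proof.
move=> /cvgrPdist_le h i j; apply/cvgrPdist_le => e e0.
have := h e e0; apply: filterS => k; apply: le_trans.
by have := mx_entry_le (l - u k) i j; rewrite !mxE.
Qed.

Arguments cvg_coord [m n u l] _ _ _.

Lemma cvg_mulmx m n p q (P : 'M[R]_(m, n)) (Q : 'M[R]_(p, q)) u l :
  u @ \oo --> l -> (P *m u k *m Q) @[k --> \oo] --> P *m l *m Q.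
Proof.
move=> /cvgrPdist_le h; apply/cvgrPdist_le => e e0.
set c := p%:R * (n%:R * `|P|) * `|Q| + 1.
have c0 : 0 < c by rewrite ltr_wpDl // !mulr_ge0.
have := h (e / c) (divr_gt0 e0 c0); apply: filterS => k hk.
rewrite -mulmxBl -mulmxBr.
apply: le_trans (mx_normM _ _) _.
have h1 := mx_normM P (l - u k).
apply: (@le_trans _ _ (p%:R * (n%:R * (`|P| * `|l - u k|) * `|Q|))).
  by rewrite ler_wpM2l // ler_wpM2r.
apply: (@le_trans _ _ (c * `|l - u k|)).
  rewrite /c mulrDl mul1r -[X in X <= _]addr0 lerD //.
  by apply: le_of_eq; ring.
by rewrite mulrC -ler_pdivlMr.
Qed.

End MatrixNorm.

Arguments cvg_coord [R m n u l] _ _ _.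

Section MatrixExp.
Variable R : realType.
Variable n : nat.
Implicit Types A B P Q S : 'M[R]_n.

Definition expmx_part A N : 'M[R]_n := \sum_(j < N) (j`!%:R)^-1 *: A ^+ j.
Definition exp_part (x : R) N : R := \sum_(j < N) (j`!%:R)^-1 * x ^+ j.

Lemma exp_part_cvg x : exp_part x @ \oo --> expR x.
Proof.
have -> : exp_part x = series (exp_coeff x).
  apply/funext => N; rewrite /exp_part /series /= big_mkord.
  by apply: eq_bigr => j _; rewrite /exp_coeff mulrC.
exact: is_cvg_series_exp_coeff.
Qed.

Arguments exp_part_cvg : clear implicits.

Lemma exp_part_le x N : 0 <= x -> exp_part x N <= expR x.
Proof.
move=> x0; have -> : expR x = limn (exp_part x) by apply/esym/cvg_lim => //; exact: exp_part_cvg.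
apply: nondecreasing_cvgn_le; last by apply/cvg_ex; exists (expR x); exact: exp_part_cvg.
apply/nondecreasing_seqP => k; rewrite /exp_part big_ord_recr /= lerDl.
by rewrite mulr_ge0 // ?exprn_ge0 // invr_ge0.
Qed.

Lemma mx_normX A j : `|A ^+ j| <= (n%:R * `|A|) ^+ j.
Proof.
elim: j => [|j IH]; first exact: mx_norm1.
rewrite exprS; apply: le_trans (mx_normM _ _) _.
by rewrite mulrA exprS ler_wpM2l // mulr_ge0.
Qed.

Lemma expmx_term_le A j : `|(j`!%:R)^-1 *: A ^+ j| <= (j`!%:R)^-1 * (n%:R * `|A|) ^+ j.
Proof.
rewrite normrZ ger0_norm ?invr_ge0 ?ler0n //.
by rewrite ler_wpM2l ?invr_ge0 ?ler0n // mx_normX.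
Qed.

Lemma expmx_cvg A : expmx_part A @ \oo --> expmx A.
Proof.
suff : cvgn (expmx_part A).
  have e : expmx_part A = series (fun j : nat => (j`!%:R)^-1 *: A ^+ j).
    by apply/funext => N; rewrite /expmx_part /series /= big_mkord.
  by rewrite /expmx e => h; exact: h.
have h i j : cvgn (fun N => expmx_part A N i j).
  pose v k := ((k`!%:R)^-1 *: A ^+ k) i j.
  have -> : (fun N => expmx_part A N i j) = series v.
    by apply/funext => N; rewrite /expmx_part /series /= big_mkord summxE.
  apply: normed_cvg.
  apply: (series_le_cvg (v_ := exp_coeff (n%:R * `|A|))).
  - by move=> k /=.
  - by move=> k; apply: exp_coeff_ge0; rewrite mulr_ge0.
  - move=> k /=; apply: le_trans (mx_entry_le _ _ _) _.
    by apply: le_trans (expmx_term_le _ _) _; rewrite /exp_coeff /= mulrC.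
  - exact: is_cvg_series_exp_coeff.
apply/cvg_ex; exists (\matrix_(i, j) limn (fun N => expmx_part A N i j)).
by apply: cvg_mx => i j; rewrite mxE; exact: h.
Qed.

Lemma expmx_unique A B : expmx_part A @ \oo --> B -> expmx A = B.
Proof.
move=> h; apply/matrixP => i j.
have h1 := cvg_coord (@expmx_cvg A) i j; have h2 := cvg_coord h i j.
by rewrite -(cvg_lim (@Rhausdorff R) h1) (cvg_lim (@Rhausdorff R) h2).
Qed.

Lemma expmx_conj P Q A : Q *m P = 1%:M -> expmx (P *m A *m Q) = P *m expmx A *m Q.
Proof.
move=> QP; apply: expmx_unique.
suff -> : expmx_part (P *m A *m Q) = fun k => P *m expmx_part A k *m Q.
  by apply: cvg_mulmx; exact: expmx_cvg.
have PQ : P *m Q = 1%:M by apply: mulmx1C.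
apply/funext => N; rewrite /expmx_part mulmx_sumr mulmx_suml; apply: eq_bigr => j _.
rewrite -scalemxAr -scalemxAl; congr (_ *: _).
elim: (nat_of_ord j) => [|k IH]; first by rewrite !expr0 mulmx1 PQ.
rewrite !exprS IH !mulmxE -!mulrA; congr (_ * (_ * _)).
by rewrite mulrA [Q * P]QP mul1r.
Qed.

Lemma expmx_tr A : expmx A^T = (expmx A)^T.
Proof.
apply: expmx_unique; apply: cvg_mx => i j; rewrite mxE.
have -> : (fun k => expmx_part A^T k i j) = (fun k => expmx_part A k j i).
  apply/funext => k; rewrite /expmx_part !summxE; apply: eq_bigr => l _.
  rewrite !mxE; congr (_ * _).
  have -> : A^T ^+ l = (A ^+ l)^T; last by rewrite mxE.
  elim: (nat_of_ord l) => [|m IH]; first by rewrite !expr0; apply/matrixP => a b; rewrite !mxE eq_sym.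
  by rewrite exprS exprSr IH -!mulmxE trmx_mul.
exact: cvg_coord (@expmx_cvg A) _ _.
Qed.

(** The tail of the series is dominated by the tail of exp(n |A|). *)
Lemma expmx_quad A : n%:R * `|A| <= 1 / 2 ->
  `|expmx A - 1%:M - A| <= 2 * (n%:R * `|A|) ^+ 2.
Proof.
set x := n%:R * `|A| => x2.
have x0 : 0 <= x by rewrite mulr_ge0.
have part N : `|expmx_part A N.+2 - 1%:M - A| <= 2 * x ^+ 2.
  rewrite /expmx_part !big_ord_recl /= !fact0 factS fact0 !invr1 !scale1r expr0 expr1.
  rewrite [1 + _]addrC addrK addrC addKr.
  apply: le_trans (ler_norm_sum _ _ _) _.
  have h : \sum_(i < N) (((bump 0 (bump 0 i))`!%:R)^-1 * x ^+ (bump 0 (bump 0 i))) <= 2 * x ^+ 2.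
    have := exp_part_le N.+2 x0; rewrite /exp_part !big_ord_recl /= !fact0 factS fact0 !invr1 !mul1r expr0 expr1.
    have := expR_le_quad x2; set s := \sum_(i < N) _; lra.
  by apply: le_trans h; apply: ler_sum => i _; exact: expmx_term_le.
apply: mx_norm_le => [|i j]; first by rewrite mulr_ge0 // sqr_ge0.
have := cvg_coord (@expmx_cvg A) i j; rewrite -(cvg_shiftn 2) => hc.
rewrite !mxE.
have hc' : `|expmx_part A (k + 2)%N i j - 1%:M i j - A i j| @[k --> \oo] --> `|expmx A i j - 1%:M i j - A i j|.
  by apply: cvg_norm; apply: cvgB; [apply: cvgB => //; exact: cvg_cst|exact: cvg_cst].
rewrite !mxE in hc'.
apply: (closed_cvg (fun y => y <= 2 * x ^+ 2) _ _ _ hc').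
- exact: closed_le.
- apply: nearW => k; rewrite addn2.
  by apply: le_trans (part k); have := mx_entry_le (expmx_part A k.+2 - 1%:M - A) i j; rewrite !mxE.
Qed.

(** Splits the square of the Cauchy product of two partial sums into the triangle
    that gives the partial sum of the product and the remaining terms. *)
Lemma sum_triangle (V : lmodType R) (c : nat -> nat -> R) (f : nat -> V) N :
  \sum_(i < N) \sum_(j < N) c i j *: f (i + j)%N =
  \sum_(k < N) (\sum_(i < k.+1) c i (k - i)%N) *: f k +
  \sum_(i < N) \sum_(j < N | (N <= i + j)%N) c i j *: f (i + j)%N.
Proof.
transitivity (\sum_(i < N) (\sum_(j < N | ~~ (N <= i + j)%N) c i j *: f (i + j)%N +
    \sum_(j < N | (N <= i + j)%N) c i j *: f (i + j)%N)).
  by apply: eq_bigr => i _; rewrite (bigID (fun j : 'I_N => (N <= i + j)%N)) /= addrC.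
rewrite big_split /=; congr (_ + _).
transitivity (\sum_(i < N) \sum_(k < N | (i <= k)%N) c i (k - i)%N *: f k).
  apply: eq_bigr => i _.
  pose g k := c i (k - i)%N *: f k.
  transitivity (\sum_(0 <= j < N - i) g (j + i)%N).
    rewrite (big_nat_widen 0 (N - i) N) ?leq_subr // big_mkord.
    apply: eq_big => j; first by rewrite -ltnNge ltn_subRL.
    by rewrite /g addnK addnC.
  rewrite -(big_addn 0 N i predT g) add0n.
  by rewrite big_geq_mkord.
rewrite (exchange_big_dep predT) //=; apply: eq_bigr => k _.
rewrite scaler_suml (big_ord_widen N (fun i => c i (k - i)%N *: f k)) //.
Qed.

Lemma exp_binom (s t : R) k :
  \sum_(i < k.+1) ((i`!%:R)^-1 * s ^+ i) * (((k - i)`!%:R)^-1 * t ^+ (k - i)) =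
  (k`!%:R)^-1 * (s + t) ^+ k.
Proof.
rewrite addrC exprDn mulr_sumr; apply: eq_bigr => i _.
have ik : (i <= k)%N by rewrite -ltnS.
have f0 m : (m`!%:R : R) != 0 by rewrite pnatr_eq0 -lt0n fact_gt0.
rewrite -(bin_fact ik) -[X in _ = _ * X]mulr_natr !natrM.
have b0 : ('C(k, i)%:R : R) != 0 by rewrite pnatr_eq0 -lt0n bin_gt0.
by field; rewrite !f0 b0.
Qed.

Lemma exprZmx A (a : R) k : (a *: A) ^+ k = a ^+ k *: A ^+ k.
Proof.
elim: k => [|k IH]; first by rewrite !expr0 scale1r.
by rewrite !exprS IH -!mulmxE -scalemxAl -scalemxAr scalerA.
Qed.

(** The remaining terms of the Cauchy product are dominated by those of the scalar
    series with |s| n |A| and |t| n |A|, and the latter tend to 0. *)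
Lemma expmx_scaleD A (s t : R) : expmx ((s + t) *: A) = expmx (s *: A) *m expmx (t *: A).
Proof.
pose c (u v : R) i j : R := (i`!%:R)^-1 * u ^+ i * ((j`!%:R)^-1 * v ^+ j).
pose x := `|s| * (n%:R * `|A|); pose y := `|t| * (n%:R * `|A|).
have prod_e (V : lmodType R) (pw : nat -> V) (u v : R) N :
   \sum_(i < N) \sum_(j < N) c u v i j *: pw (i + j)%N -
   \sum_(k < N) ((k`!%:R)^-1 * (u + v) ^+ k) *: pw k
   = \sum_(i < N) \sum_(j < N | (N <= i + j)%N) c u v i j *: pw (i + j)%N.
  rewrite sum_triangle; under eq_bigr do rewrite exp_binom.
  by rewrite addrC addKr.
have bound N : `|expmx_part (s *: A) N *m expmx_part (t *: A) N - expmx_part ((s + t) *: A) N|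
   <= exp_part x N * exp_part y N - exp_part (x + y) N.
  have -> : exp_part x N * exp_part y N - exp_part (x + y) N =
    \sum_(i < N) \sum_(j < N | (N <= i + j)%N) c x y i j * 1 ^+ (i + j)%N.
    rewrite -[RHS](prod_e R^o (fun k => 1 ^+ k)) /exp_part mulr_suml; congr (_ - _).
      apply: eq_bigr => i _; rewrite mulr_sumr; apply: eq_bigr => j _.
      by rewrite expr1n [RHS]mulr1.
    by apply: eq_bigr => i _; rewrite expr1n [RHS]mulr1.
  have -> : expmx_part (s *: A) N *m expmx_part (t *: A) N - expmx_part ((s + t) *: A) N =
    \sum_(i < N) \sum_(j < N | (N <= i + j)%N) c s t i j *: A ^+ (i + j)%N.
    rewrite -(prod_e _ (fun k => A ^+ k)) /expmx_part mulmx_suml; congr (_ - _).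
      apply: eq_bigr => i _; rewrite mulmx_sumr; apply: eq_bigr => j _.
      by rewrite !exprZmx -!scalemxAl -!scalemxAr !scalerA exprD mulmxE /c; congr (_ *: _); ring.
    by apply: eq_bigr => k _; rewrite exprZmx scalerA.
  apply: le_trans (ler_norm_sum _ _ _) _; apply: ler_sum => i _.
  apply: le_trans (ler_norm_sum _ _ _) _; apply: ler_sum => j _.
  rewrite normrZ expr1n mulr1 /c !normrM !normrX !(ger0_norm (x := _^-1)) ?invr_ge0 //.
  apply: le_trans (ler_wpM2l _ (mx_normX A (i + j))) _.
    by rewrite !mulr_ge0 ?exprn_ge0 ?invr_ge0.
  rewrite /x /y !exprMn !exprD; apply: le_of_eq; ring.
have lim0 : (exp_part x N * exp_part y N - exp_part (x + y) N) @[N --> \oo] --> (0 : R).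
  have -> : (0 : R) = expR x * expR y - expR (x + y) by rewrite expRD subrr.
  by apply: cvgB; [apply: cvgM|]; exact: exp_part_cvg.
apply: expmx_unique; apply: cvg_mx => i j.
have h1 : (expmx_part (s *: A) N *m expmx_part (t *: A) N) i j @[N --> \oo] -->
    (expmx (s *: A) *m expmx (t *: A)) i j.
  rewrite mxE; under eq_fun do rewrite mxE.
  apply: cvg_fsum => k; apply: cvgM; apply: cvg_coord; exact: expmx_cvg.
have h2 : ((expmx_part (s *: A) N *m expmx_part (t *: A) N) i j - expmx_part ((s + t) *: A) N i j)
    @[N --> \oo] --> (0 : R).
  apply/norm_cvg0P; apply: (squeeze_cvgr _ (cvg_cst 0) lim0).
  apply: nearW => N /=; rewrite normr_ge0 /=; apply: le_trans (bound N).
  set B := expmx_part _ _ *m _; set D := expmx_part _ _.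
  by have := mx_entry_le (B - D) i j; rewrite !mxE.
have -> : (fun N => expmx_part ((s + t) *: A) N i j) = (fun N =>
    (expmx_part (s *: A) N *m expmx_part (t *: A) N) i j -
    ((expmx_part (s *: A) N *m expmx_part (t *: A) N) i j - expmx_part ((s + t) *: A) N i j)).
  by apply/funext => N; rewrite subKr.
by rewrite -[X in _ --> X]subr0; exact: cvgB h1 h2.
Qed.

Lemma expmx0 : expmx (0 : 'M[R]_n) = 1%:M.
Proof.
have := @expmx_quad 0; rewrite normr0 mulr0 subr0 expr0n mulr0 => /(_ _).
rewrite normr_le0 subr_eq0 => h; apply/eqP; apply: h; lra.
Qed.

Lemma expmxN A : expmx (- A) *m expmx A = 1%:M.
Proof.
by have := expmx_scaleD A (-1) 1; rewrite addNr scale0r expmx0 scaleN1r scale1r.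
Qed.

Lemma expmx_unit A : expmx A \in unitmx.
Proof. by have [] := mulmx1_unit (expmxN A). Qed.

Lemma expmx_natmul A m : expmx (m%:R *: A) = expmx A ^+ m.
Proof.
elim: m => [|m IH]; first by rewrite scale0r expmx0.
by rewrite -[in LHS]natr1 expmx_scaleD IH exprSr scale1r.
Qed.

End MatrixExp.

Section CplxExp.
Variable R : realType.
Local Notation C := R[i].
Variable n : nat.

Lemma cplxmxE p q (A : 'M[R]_(p, q)) i j : cplxmx A i j = (A i j)%:C.
Proof. by rewrite mxE. Qed.

Lemma cplxmxM p q r (A : 'M[R]_(p, q)) (B : 'M[R]_(q, r)) :
  cplxmx (A *m B) = cplxmx A *m cplxmx B.
Proof. by rewrite /cplxmx map_mxM. Qed.

Lemma cplxmxD p q (A B : 'M[R]_(p, q)) : cplxmx (A + B) = cplxmx A + cplxmx B.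
Proof. by rewrite /cplxmx map_mxD. Qed.

Lemma cplxmxN p q (A : 'M[R]_(p, q)) : cplxmx (- A) = - cplxmx A.
Proof. by rewrite /cplxmx map_mxN. Qed.

Lemma cplxmxZ p q a (A : 'M[R]_(p, q)) : cplxmx (a *: A) = a%:C *: cplxmx A.
Proof. by rewrite /cplxmx map_mxZ. Qed.

Lemma cplxmx1 : cplxmx (1%:M : 'M[R]_n) = 1%:M.
Proof. by rewrite /cplxmx map_mx1. Qed.

Lemma cplxmx_adj p q (A : 'M[R]_(p, q)) : (cplxmx A)^t* = cplxmx A^T.
Proof. by apply/matrixP => i j; rewrite adjE !mxE; exact: conjc_real. Qed.

Lemma udgE (V : 'M[C]_n) d i j :
  udg V d i j = \sum_k (d k)%:C * (V i k * (V j k)^*).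
Proof.
rewrite /udg mxE; apply: eq_bigr => k _; rewrite adjE /dg mul_mx_diag !mxE.
by rewrite mulrAC mulrC.
Qed.

(** Holds for partial sums, and passes to the limit in the real and imaginary
    parts of each entry. *)
Lemma expmx_spectral (S : 'M[R]_n) (V : 'M[C]_n) d : V \is unitarymx ->
  cplxmx S = udg V d -> cplxmx (expmx S) = udg V (fun i => expR (d i)).
Proof.
move=> hV eS.
have part N : cplxmx (expmx_part S N) = udg V (fun i => exp_part (d i) N).
  have pw j : cplxmx (S ^+ j) = udg V (fun i => d i ^+ j).
    elim: j => [|j IH]; first by rewrite expr0 [LHS]cplxmx1 -(udg1 hV); congr udg; apply/funext => i; rewrite expr0.
    by rewrite exprS -mulmxE cplxmxM IH eS (udgM _ _ hV); congr udg; apply/funext => i; rewrite exprS.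
  apply/matrixP => a b; rewrite udgE.
  rewrite /expmx_part cplxmxE summxE rmorph_sum /=.
  transitivity (\sum_(j < N) \sum_k (j`!%:R^-1)%:C * ((d k ^+ j)%:C * (V a k * (V b k)^*))).
    apply: eq_bigr => j _; rewrite mxE rmorphM /=.
    by rewrite -[X in _ * X = _]cplxmxE pw udgE mulr_sumr.
  rewrite exchange_big /=; apply: eq_bigr => k _.
  rewrite /exp_part rmorph_sum mulr_suml; apply: eq_bigr => j _.
  by rewrite mulrA -rmorphM.
apply/matrixP => a b.
pose w k := V a k * (V b k)^*.
have Re_e N : expmx_part S N a b = \sum_k exp_part (d k) N * complex.Re (w k).
  have := congr1 (fun A : 'M[C]_n => complex.Re (A a b)) (part N).
  rewrite cplxmxE udgE /= => ->.
  elim/big_rec2: _ => // k x y _ <-; rewrite -/(w k).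
  by case: (w k) y => ? ? [? ?] /=; rewrite mul0r subr0.
have Im_e N : \sum_k exp_part (d k) N * complex.Im (w k) = 0.
  have := congr1 (fun A : 'M[C]_n => complex.Im (A a b)) (part N).
  rewrite cplxmxE udgE /= => e; rewrite [RHS]e {e}; apply/esym.
  elim/big_rec2: _ => // k x y _ <-; rewrite -/(w k).
  by case: (w k) y => ? ? [? ?] /=; rewrite mul0r addr0.
have cv (f : 'I_n -> R) : (\sum_k exp_part (d k) N * f k) @[N --> \oo] --> \sum_k expR (d k) * f k.
  apply: (@cvg_fsum R _ (fun k N => exp_part (d k) N * f k) (fun k => expR (d k) * f k)) => k.
  exact: (cvgM (@exp_part_cvg R (d k)) (cvg_cst (f k))).
have e1 : expmx S a b = \sum_k expR (d k) * complex.Re (w k).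
  have h1 := cvg_coord (@expmx_cvg R n S) a b; have h2 := cv (fun k => complex.Re (w k)).
  rewrite (funext Re_e) in h1.
  by rewrite -(cvg_lim (@Rhausdorff R) h1) (cvg_lim (@Rhausdorff R) h2).
have e2 : \sum_k expR (d k) * complex.Im (w k) = 0.
  have h2 := cv (fun k => complex.Im (w k)).
  rewrite (funext Im_e) in h2.
  rewrite -(cvg_lim (@Rhausdorff R) h2).
  exact: (cvg_lim (@Rhausdorff R) (cvg_cst _)).
rewrite cplxmxE udgE e1.
transitivity ((\sum_k expR (d k) * complex.Re (w k)) +i* (\sum_k expR (d k) * complex.Im (w k))).
  by rewrite e2.
elim/big_rec3: _ => // k x y z _ h; rewrite -/(w k) -h.
by case: (w k) => ? ? /=; apply/eqP; rewrite eq_complex /= !mul0r subr0 addr0 !eqxx.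
Qed.

End CplxExp.

(** * The Lie algebra of a closed subgroup *)

Section LieBasics.
Variable R : realType.
Variable n : nat.
Implicit Types (A B D S T P : 'M[R]_n) (U : {vspace 'M[R]_n}).

Lemma le0_of_quad (a C delta : R) : 0 < delta ->
  (forall t, 0 < t -> t <= delta -> t * a <= C * t ^+ 2) -> a <= 0.
Proof.
move=> d0 h; rewrite leNgt; apply/negP => a0.
have C1 : 0 < `|C| + 1 by rewrite ltr_wpDl.
pose t := Num.min delta (a / (2 * (`|C| + 1))).
have t0 : 0 < t by rewrite lt_min d0 divr_gt0 // mulr_gt0.
have td : t <= delta by rewrite ge_min lexx.
have ta : t <= a / (2 * (`|C| + 1)) by rewrite ge_min lexx orbT.
have := h t t0 td.
have : C * t ^+ 2 <= (`|C| + 1) * t * t.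
  rewrite expr2 mulrA !ler_wpM2r // ?(ltW t0) //.
  by apply: le_trans (ler_norm _) _; rewrite lerDl.
have : (`|C| + 1) * t <= a / 2.
  have := ler_wpM2l (ltW C1) ta.
  have -> // : (`|C| + 1) * (a / (2 * (`|C| + 1))) = a / 2.
  by field; rewrite gt_eqF.
nra.
Qed.

Lemma le0_eps (a M : R) : (forall e, 0 < e -> a <= M * e) -> a <= 0.
Proof.
move=> h; apply: (@le0_of_quad a M 1) => // t t0 _.
by rewrite expr2 mulrA [leRHS]mulrC ler_wpM2l ?(ltW t0) // h.
Qed.

Lemma lin_bound (f : 'End('M[R]_n)) : exists2 M, 0 <= M & forall X, `|f X| <= M * `|X|.
Proof.
exists (\sum_i \sum_j `|f (delta_mx i j)|).
  by do 2!apply: sumr_ge0 => ? _.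
move=> X; rewrite {1}(matrix_sum_delta X) linear_sum mulr_suml.
apply: le_trans (ler_norm_sum _ _ _) _; apply: ler_sum => i _.
rewrite linear_sum mulr_suml.
apply: le_trans (ler_norm_sum _ _ _) _; apply: ler_sum => j _.
by rewrite linearZ normrZ mulrC ler_wpM2l // mx_entry_le.
Qed.

Lemma vspace_kernel U : exists f : 'End('M[R]_n), forall X, (X \in U) = (f X == 0).
Proof.
exists (\1 - projv U)%VF => X; rewrite add_lfunE opp_lfunE id_lfunE subr_eq0.
apply/idP/eqP => [h|->]; first by rewrite projv_id.
exact: memv_proj.
Qed.

(** A subspace is the kernel of a linear map, and linear maps are Lipschitz. *)
Lemma vspace_closed U D : (forall e, 0 < e -> exists2 E, E \in U & `|D - E| <= e) -> D \in U.
Proof.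
move=> h; have [f hf] := vspace_kernel U; have [M M0 hM] := lin_bound f.
rewrite hf -normr_le0; apply: (@le0_eps _ M) => e e0.
have [E EU hE] := h e e0; have /eqP fE : f E == 0 by rewrite -hf.
have -> : f D = f (D - E) by rewrite (linearB f) /= fE subr0.
by apply: le_trans (hM _) _; rewrite ler_wpM2l.
Qed.

(** D is the limit of E / t. *)
Lemma vspace_deriv U D (C delta : R) : 0 < delta ->
  (forall t, 0 < t -> t <= delta -> exists2 E, E \in U & `|E - t *: D| <= C * t ^+ 2) ->
  D \in U.
Proof.
move=> d0 h; apply: vspace_closed => e e0.
have C1 : 0 < `|C| + 1 by rewrite ltr_wpDl.
pose t := Num.min delta (e / (`|C| + 1)).
have t0 : 0 < t by rewrite lt_min d0 divr_gt0.
have td : t <= delta by rewrite ge_min lexx.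
have ta : t <= e / (`|C| + 1) by rewrite ge_min lexx orbT.
have [E EU hE] := h t t0 td; exists (t^-1 *: E); first exact: memvZ.
have -> : D - t^-1 *: E = - (t^-1 *: (E - t *: D)).
  by rewrite scalerBr scalerA mulVf ?gt_eqF // scale1r opprB.
rewrite normrN normrZ gtr0_norm ?invr_gt0 // mulrC ler_pdivrMr //.
apply: le_trans hE _; rewrite expr2 mulrA ler_wpM2r ?(ltW t0) //.
apply: (@le_trans _ _ ((`|C| + 1) * t)).
  by rewrite ler_wpM2r ?(ltW t0) // (le_trans (ler_norm _)) // lerDl.
by rewrite mulrC -ler_pdivlMr.
Qed.

Lemma expmx_quad_t A : exists C delta, [/\ 0 <= C, 0 < delta & forall t, `|t| <= delta ->
  `|expmx (t *: A) - 1%:M - t *: A| <= C * t ^+ 2].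
Proof.
pose x := n%:R * `|A|; have x0 : 0 <= x by rewrite mulr_ge0.
have x1 : 0 < 2 * (x + 1) by rewrite mulr_gt0 // ltr_wpDl.
exists (2 * x ^+ 2), (2 * (x + 1))^-1; split.
- by rewrite mulr_ge0 // sqr_ge0.
- by rewrite invr_gt0.
move=> t ht; have e : n%:R * `|t *: A| = `|t| * x by rewrite normrZ mulrCA.
have hh : `|t| * x <= 1 / 2.
  apply: (@le_trans _ _ ((2 * (x + 1))^-1 * (x + 1))).
    by apply: ler_pM => //; rewrite lerDl.
  apply: le_of_eq; field.
  by rewrite gt_eqF // ltr_wpDl.
have := @expmx_quad R n (t *: A); rewrite e => /(_ hh).
have -> // : 2 * (`|t| * x) ^+ 2 = 2 * x ^+ 2 * t ^+ 2.
by rewrite exprMn real_normK ?num_real //; ring.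
Qed.

Lemma expmx_lin_t A : exists C delta, [/\ 0 <= C, 0 < delta & forall t, `|t| <= delta ->
  `|expmx (t *: A) - 1%:M| <= C * `|t|].
Proof.
have [C [delta [C0 d0 h]]] := expmx_quad_t A.
exists (C * delta + `|A|), delta; split=> //; first by rewrite addr_ge0 // mulr_ge0 // ltW.
move=> t ht; have -> : expmx (t *: A) - 1%:M = (expmx (t *: A) - 1%:M - t *: A) + t *: A.
  by rewrite subrK.
apply: le_trans (ler_normD _ _) _; rewrite mulrDl normrZ; apply: lerD; last by rewrite mulrC.
apply: le_trans (h t ht) _; rewrite -mulrA ler_wpM2l //.
by rewrite -real_normK ?num_real // expr2 ler_wpM2r.
Qed.

Variables (G K : set 'M[R]_n) (g k : {vspace 'M[R]_n}).
Hypothesis hG : closed_subgroup_SL G.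
Hypothesis hg : is_lie_algebra G g.
Hypothesis hK : K = G `&` @SO R n.
Hypothesis hk : is_lie_algebra K k.
Hypothesis hpolar : G = [set A *m expmx B | A in K & B in ppart g].

Lemma G_det A : G A -> \det A = 1. Proof. by have [h _ _ _ _] := hG; exact: h. Qed.
Lemma G_mul A B : G A -> G B -> G (A *m B). Proof. by have [_ _ h _ _] := hG; exact: h. Qed.
Lemma G_inv A : G A -> G (invmx A). Proof. by have [_ _ _ h _] := hG; exact: h. Qed.
Lemma G_unit A : G A -> A \in unitmx.
Proof. by move=> h; rewrite unitmxE G_det // unitr1. Qed.

Lemma g_exp A : A \in g -> G (expmx A).
Proof. by move=> /hg /(_ 1); rewrite scale1r. Qed.

(** K consists of orthogonal matrices and p of symmetric ones. *)
Lemma G_tr A : G A -> G A^T.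
Proof.
rewrite [in X in X -> _]hpolar => -[P + [B [Bg Bs Bt] <-]]; rewrite hK => -[GP [Po _]].
rewrite trmx_mul -expmx_tr Bs; apply: G_mul; first exact: g_exp.
by have -> : P^T = invmx P; [rewrite -[LHS](mulKmx (G_unit GP)) Po mulmx1|exact: G_inv].
Qed.

Lemma g_tr A : A \in g -> A^T \in g.
Proof.
move=> /hg h; apply/hg => t.
have -> : t *: A^T = (t *: A)^T by rewrite linearZ.
by rewrite expmx_tr; apply: G_tr.
Qed.

Lemma g_Ad P A : G P -> A \in g -> P *m A *m invmx P \in g.
Proof.
move=> GP /hg h; apply/hg => t.
have -> : t *: (P *m A *m invmx P) = P *m (t *: A) *m invmx P.
  by rewrite -scalemxAr -scalemxAl.
rewrite expmx_conj ?mulVmx ?G_unit //.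
by apply: G_mul; [apply: G_mul|apply: G_inv].
Qed.

Lemma invmx_expmx A : invmx (expmx A) = expmx (- A).
Proof. by rewrite -[RHS](mulmxK (expmx_unit A)) expmxN mul1mx. Qed.

(** The bracket is the derivative at 0 of Ad(exp(tA)) B, a curve in g. *)
Lemma g_bracket A B : A \in g -> B \in g -> A *m B - B *m A \in g.
Proof.
move=> Ag Bg; have [C1 [d1 [C10 d10 h1]]] := expmx_quad_t A.
have [C2 [d2 [C20 d20 h2]]] := expmx_lin_t A.
pose N : R := n%:R.
apply: (@vspace_deriv _ _ (N * (C1 * `|B|) + N * (`|B| * C1) +
   N * ((N * (C2 * `|B|) + N * (`|B| * C2)) * C2)) (Num.min d1 d2)).
  by rewrite lt_min d10.
move=> t t0; rewrite le_min => /andP [td1 td2].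
have At : t *: A \in g by apply: memvZ.
set X := expmx (t *: A).
have GX : G X by apply: g_exp.
exists (X *m B *m invmx X - B); first by apply: memvB => //; apply: g_Ad.
have h1t : `|X - 1%:M - t *: A| <= C1 * t ^+ 2 by apply: h1; rewrite gtr0_norm.
have h2t : `|X - 1%:M| <= C2 * t by rewrite -[X in _ * X](gtr0_norm t0); apply: h2; rewrite gtr0_norm.
have h3t : `|invmx X - 1%:M| <= C2 * t.
  by have := h2 (- t); rewrite normrN (gtr0_norm t0) scaleNr -invmx_expmx; apply.
set r := X - 1%:M - t *: A in h1t *.
set y := X - 1%:M in h2t *.
set z := invmx X - 1%:M in h3t *.
have -> : X *m B *m invmx X - B - t *: (A *m B - B *m A) =
  (r *m B - B *m r) + (y *m B - B *m y) *m z.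
  have e1 : y *m B - B *m y = X *m B - B *m X.
    by rewrite /y mulmxBl mulmxBr mul1mx mulmx1 opprB addrA subrK.
  have e2 : r *m B - B *m r = X *m B - B *m X - t *: (A *m B - B *m A).
    rewrite /r -/y mulmxBl mulmxBr opprB [_ - B *m y]addrC addrACA e1; congr (_ + _).
    by rewrite scalerBr opprB -scalemxAl -scalemxAr addrC.
  rewrite e1 e2 /z mulmxBr mulmx1 [(X *m B - B *m X) *m invmx X]mulmxBl.
  by rewrite (mulmxK (G_unit GX)) [RHS]addrC addrA subrK.
have N0 : 0 <= N by [].
have b1 : `|r *m B| <= N * (C1 * `|B|) * t ^+ 2.
  apply: le_trans (mx_normM _ _) _; rewrite -mulrA ler_wpM2l // mulrAC.
  by rewrite ler_wpM2r.
have b2 : `|B *m r| <= N * (`|B| * C1) * t ^+ 2.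
  by apply: le_trans (mx_normM _ _) _; rewrite -mulrA ler_wpM2l // -mulrA ler_wpM2l.
have b3 : `|y *m B| <= N * (C2 * `|B|) * t.
  apply: le_trans (mx_normM _ _) _; rewrite -mulrA ler_wpM2l // mulrAC.
  by rewrite ler_wpM2r.
have b4 : `|B *m y| <= N * (`|B| * C2) * t.
  by apply: le_trans (mx_normM _ _) _; rewrite -mulrA ler_wpM2l // -mulrA ler_wpM2l.
have b5 : `|y *m B - B *m y| <= (N * (C2 * `|B|) + N * (`|B| * C2)) * t.
  by rewrite mulrDl; apply: le_trans (ler_normB _ _) (lerD b3 b4).
apply: le_trans (ler_normD _ _) _; rewrite mulrDl; apply: lerD.
  by rewrite mulrDl; apply: le_trans (ler_normB _ _) (lerD b1 b2).
apply: le_trans (mx_normM _ _) _; rewrite -mulrA ler_wpM2l //.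
by rewrite expr2 mulrACA; apply: ler_pM.
Qed.

(** The first order term of the equation exp(tA) exp(tA)^T = 1. *)
Lemma k_skew A : A \in k -> A^T = - A.
Proof.
move=> /hk h.
have [C1 [d1 [C10 d10 h1]]] := expmx_quad_t A.
have [C2 [d2 [C20 d20 h2]]] := expmx_quad_t A^T.
apply/eqP; rewrite -addr_eq0 -normr_le0.
apply: (@le0_of_quad _ (C1 + C2) (Num.min d1 d2)); first by rewrite lt_min d10.
move=> t t0; rewrite le_min => /andP [td1 td2].
have := h t; rewrite hK => -[GX [XX _]]; set X := expmx (t *: A) in GX XX *.
have e : expmx (t *: A^T) = expmx ((- t) *: A).
  have -> : t *: A^T = (t *: A)^T by rewrite linearZ.
  rewrite expmx_tr scaleNr -invmx_expmx.
  by rewrite -[LHS](mulKmx (expmx_unit (t *: A))) XX mulmx1.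
have b1 := h2 t; rewrite gtr0_norm // in b1; have {}b1 := b1 td2.
have b2 := h1 (- t); rewrite normrN gtr0_norm // -e sqrrN in b2; have {}b2 := b2 td1.
rewrite -[t in t * _](gtr0_norm t0) -normrZ.
have -> : t *: (A^T + A) = (expmx (t *: A^T) - 1%:M - - t *: A) - (expmx (t *: A^T) - 1%:M - t *: A^T).
  by rewrite opprB [RHS]addrC addrA subrK scaleNr opprK scalerDr.
by apply: le_trans (ler_normB _ _) _; rewrite mulrDl; apply: lerD.
Qed.

Lemma skew_in_k A : A \in g -> A^T = - A -> A \in k.
Proof.
move=> Ag As; apply/hk => t.
have Gt : G (expmx (t *: A)) by move/hg: Ag.
rewrite hK; split => //; split; last exact: G_det.
by rewrite -expmx_tr linearZ /= As scalerN -invmx_expmx mulmxV ?expmx_unit.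
Qed.

Lemma k_sub_g A : A \in k -> A \in g.
Proof. by move=> /hk h; apply/hg => t; have := h t; rewrite hK => -[]. Qed.

Lemma sym_spectral S : S^T = S -> exists (V : 'M[R[i]]_n) d, V \is unitarymx /\ cplxmx S = udg V d.
Proof. by move=> hS; apply: herm_spectral; rewrite cplxmx_adj hS. Qed.

Lemma mxtrace_cplx A : \tr (cplxmx A) = (\tr A)%:C.
Proof. by rewrite /cplxmx trace_map_mx. Qed.

Lemma det_cplx A : \det (cplxmx A) = (\det A)%:C.
Proof. by rewrite /cplxmx det_map_mx. Qed.

(** The exponential of S has determinant 1 as an element of SL(n), so the
    eigenvalues of S add up to 0. *)
Lemma sym_in_p S : S \in g -> S^T = S -> ppart g S.
Proof.
move=> Sg Ss; split => //; have [V [d [hV eS]]] := sym_spectral Ss.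
have := G_det (g_exp Sg); move/(congr1 (real_complex R)).
rewrite -det_cplx (expmx_spectral hV eS) det_udg // => /complexI.
have -> : \prod_i expR (d i) = expR (\sum_i d i).
  by elim/big_rec2: _ => [|i x y _ ->]; rewrite ?expR0 // expRD.
rewrite -expR0 => /expR_inj h.
by apply: complexI; rewrite -mxtrace_cplx eS mxtrace_udg // h.
Qed.

End LieBasics.

(** * Connectedness: commuting with g and commuting with G *)

Section Connected.
Variable R : realType.
Variable n : nat.
Implicit Types (A B D S T P Q h : 'M[R]_n).

Lemma closed_metric (F : set 'M[R]_n) :
  (forall P, (forall e, 0 < e -> exists2 Q, F Q & `|P - Q| <= e) -> F P) -> closed F.
Proof.
move=> h P clP; apply: h => e e0.
have [Q [FQ bQ]] := clP _ (nbhsx_ballx P e e0); exists Q => //.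
by move: bQ; rewrite -ball_normE => /ltW.
Qed.

Lemma metric_closed (F : set 'M[R]_n) P : closed F ->
  (forall e, 0 < e -> exists2 Q, F Q & `|P - Q| <= e) -> F P.
Proof.
move=> cF h; apply: cF => B /nbhs_ballP [e /= e0 hB].
have [Q FQ hQ] := h (e / 2) (divr_gt0 e0 (ltr0Sn _ _)).
exists Q; split => //; apply: hB; rewrite -ball_normE /=.
by apply: le_lt_trans hQ _; rewrite ltr_pdivrMr // ltr_pMr // ltr1n.
Qed.

(** Bolzano-Weierstrass, transported from row vectors. *)
Lemma bounded_cluster (u : nat -> 'M[R]_n) : (forall j, `|u j| <= 1) ->
  exists L, forall eta J, 0 < eta -> exists2 j, (J <= j)%N & `|u j - L| <= eta.
Proof.
move=> hu; pose A : set 'rV[R]_(n * n) := [set v | `|v| <= 1].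
have cA : compact A.
  apply: bounded_closed_compact.
    by exists 1; split => // M M1 v /= hv; apply: le_trans hv (ltW M1).
  apply: closed_comp (@closed_le R 1); by move=> v _; apply: norm_continuous.
have vu j : A (mxvec (u j)).
  apply: mx_norm_le => // i k; rewrite ord1.
  by case/mxvec_indexP: k => a b; rewrite mxvecE; apply: le_trans (mx_entry_le _ _ _) (hu j).
have [|p [_ hp]] := cA ((fun j => mxvec (u j)) @ \oo) _.
  by exists 0%N => // j _; apply: vu.
exists (vec_mx p) => eta J eta0.
have [|v [[j Jj <-] bv]] := hp [set mxvec (u j) | j in [set j | (J <= j)%N]] _ _ (nbhsx_ballx p eta eta0).
  by exists J => // j /= Jj; exists j.
exists j => //; move: bv; rewrite -ball_normE /= => bv.
apply: mx_norm_le => [|a b]; first exact: ltW.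
apply: le_trans (ltW bv).
have := mx_entry_le (p - mxvec (u j)) 0 (mxvec_index a b).
by rewrite !mxE mxvecE distrC.
Qed.

Lemma expmx_le B : `|expmx B| <= expR (n%:R * `|B|).
Proof.
apply: mx_norm_le => [|i j]; first exact: expR_ge0.
have hc : `|expmx_part B k i j| @[k --> \oo] --> `|expmx B i j|.
  by apply: cvg_norm; apply: cvg_coord; exact: expmx_cvg.
apply: (closed_cvg (fun y => y <= expR (n%:R * `|B|)) _ _ _ hc); first exact: closed_le.
apply: nearW => k; apply: le_trans (mx_entry_le _ _ _) _.
apply: le_trans (@exp_part_le R _ k _); last by rewrite mulr_ge0.
apply: le_trans (ler_norm_sum _ _ _) _; apply: ler_sum => l _; exact: expmx_term_le.
Qed.

Lemma expmx_comm S B : S *m B = B *m S -> S *m expmx B = expmx B *m S.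
Proof.
move=> h; have hp N : S *m expmx_part B N = expmx_part B N *m S.
  rewrite /expmx_part mulmx_sumr mulmx_suml; apply: eq_bigr => j _.
  rewrite -scalemxAr -scalemxAl; congr (_ *: _).
  elim: (nat_of_ord j) => [|k IH]; first by rewrite expr0 mulmx1 mul1mx.
  by rewrite exprS -!mulmxE mulmxA h -[LHS]mulmxA IH mulmxA.
have h1 := cvg_mulmx (P := S) (Q := 1%:M) (@expmx_cvg R n B).
have h2 := cvg_mulmx (P := 1%:M) (Q := S) (@expmx_cvg R n B).
rewrite mulmx1 in h1; rewrite mul1mx in h2.
have e : (fun k => S *m expmx_part B k *m 1%:M) = (fun k => 1%:M *m expmx_part B k *m S).
  by apply/funext => k; rewrite mulmx1 mul1mx hp.
rewrite e in h1.
apply/matrixP => i j.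
have c1 := cvg_coord h1 i j; have c2 := cvg_coord h2 i j.
by rewrite -(cvg_lim (@Rhausdorff R) c1) (cvg_lim (@Rhausdorff R) c2).
Qed.

Variables (G : set 'M[R]_n) (g : {vspace 'M[R]_n}).
Hypothesis hG : closed_subgroup_SL G.
Hypothesis hg : is_lie_algebra G g.

Lemma G_one : G 1%:M. Proof. by have [_ h _ _ _] := hG. Qed.
Lemma G_closed : closed G. Proof. by have [_ _ _ _ h] := hG. Qed.
Lemma G_exp_pow X m : G X -> G (X ^+ m).
Proof.
move=> GX; elim: m => [|m IH]; first exact: G_one.
by rewrite exprS; apply: (G_mul hG).
Qed.

(** Induction on m with X^(m+1) - Y^(m+1) = X (X^m - Y^m) + (X - Y) Y^m. *)
Lemma pow_diff (X Y : 'M[R]_n) (s q M : R) m : 0 <= s -> 0 <= q -> 0 <= M ->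
  `|X - 1%:M| <= s -> `|X - Y| <= q -> (forall j, (j <= m)%N -> `|Y ^+ j| <= M) ->
  `|X ^+ m - Y ^+ m| <= (1 + n%:R * s) ^+ m * (m%:R * (n%:R * (q * M))).
Proof.
move=> s0 q0 M0 hX hXY; elim: m => [|m IH] hY; first by rewrite !expr0 subrr normr0 mul0r mulr0.
have {}IH := IH (fun j jm => hY j (leqW jm)).
set r := n%:R * (q * M) in IH *.
have r0 : 0 <= r by rewrite !mulr_ge0.
have e : X ^+ m.+1 - Y ^+ m.+1 = (X ^+ m - Y ^+ m) + (X - 1%:M) *m (X ^+ m - Y ^+ m) + (X - Y) *m Y ^+ m.
  rewrite !exprS -!mulmxE [(X - 1%:M) *m _]mulmxBl mul1mx.
  by rewrite [_ + (X *m _ - _)]addrC subrK mulmxBr mulmxBl addrA subrK.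
rewrite e; apply: le_trans (ler_normD _ _) _.
have b1 : `|(X - Y) *m Y ^+ m| <= r.
  apply: le_trans (mx_normM _ _) _; rewrite ler_wpM2l //; apply: ler_pM => //.
  exact: hY.
have b2 : `|X ^+ m - Y ^+ m + (X - 1%:M) *m (X ^+ m - Y ^+ m)| <= (1 + n%:R * s) * `|X ^+ m - Y ^+ m|.
  apply: le_trans (ler_normD _ _) _; rewrite mulrDl mul1r lerD2l.
  by apply: le_trans (mx_normM _ _) _; rewrite mulrA ler_wpM2r // ler_wpM2l.
have p1 : 1 <= 1 + n%:R * s by rewrite lerDl mulr_ge0.
have p0 := le_trans (@ler01 R) p1.
apply: le_trans (lerD b2 b1) _.
apply: le_trans (lerD (ler_wpM2l p0 IH) (lexx r)) _.
apply: (@le_trans _ _ ((1 + n%:R * s) ^+ m.+1 * (m%:R * r) + r)).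
  by rewrite exprS -[X in _ <= X + _]mulrA lexx.
rewrite -[in leRHS]natr1 [X in _ <= _ * X]mulrDl mul1r mulrDr lerD2l.
by rewrite ler_peMl // exprn_ege1.
Qed.

(** For t > 0 the powers (1 + X)^m with m |X| close to t converge to exp(tL), and
    they lie in the closed group G. *)
Lemma tangent_in_g L :
  (forall eta, 0 < eta -> exists X, [/\ G (1%:M + X), 0 < `|X|, `|X| <= eta &
     `|X - `|X| *: L| <= eta * `|X|]) -> L \in g.
Proof.
move=> hL.
have pos t : 0 <= t -> G (expmx (t *: L)).
  move=> t0; apply: (metric_closed G_closed) => e e0.
  have [C1 [d1 [C10 d10 h1]]] := expmx_quad_t L.
  have [C2 [d2 [C20 d20 h2]]] := expmx_lin_t L.
  pose N : R := n%:R; have N0 : 0 <= N by [].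
  pose M := expR (N * (t * `|L|)); have M0 : 0 <= M := expR_ge0 _.
  pose K := expR (N * t) * (t * (N * ((1 + C1) * M))) + N * (M * C2).
  have K0 : 0 <= K.
    rewrite addr_ge0 // !mulr_ge0 ?expR_ge0 // addr_ge0 //.
  have K1 : 0 < K + 1 by rewrite ltr_wpDl.
  pose eta := Num.min (Num.min d1 d2) (e / (K + 1)).
  have eta0 : 0 < eta by rewrite !lt_min d10 d20 divr_gt0.
  have [X [GX X0 Xeta hX]] := hL eta eta0.
  have : eta <= eta by []; rewrite {2}/eta !le_min => /andP [/andP [eta1 eta2] eta3].
  set s := `|X| in X0 Xeta hX.
  have ts0 : 0 <= t / s by rewrite divr_ge0 // ltW.
  have /andP [m1 m2] := truncn_itv ts0; set m := Num.truncn _ in m1 m2.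
  have ms : m%:R * s <= t by rewrite -ler_pdivlMr.
  have ms2 : t - m%:R * s <= s.
    have : t < (m.+1)%:R * s by rewrite -ltr_pdivrMr.
    by rewrite -natr1 mulrDl mul1r => /ltW; rewrite -lerBlDl.
  pose Y := expmx (s *: L).
  have Ypow j : Y ^+ j = expmx ((j%:R * s) *: L) by rewrite -scalerA expmx_natmul.
  have Yle u : 0 <= u -> u <= t -> `|expmx (u *: L)| <= M.
    move=> u0 ut; apply: le_trans (expmx_le _) _; rewrite ler_expR ler_wpM2l //.
    by rewrite normrZ ger0_norm // ler_wpM2r.
  have Xm : `|(1%:M + X) ^+ m - Y ^+ m| <= expR (N * t) * (t * (N * ((1 + C1) * M))) * eta.
    have := @pow_diff (1%:M + X) Y s (s * eta * (1 + C1)) M m (ltW X0).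
    rewrite !mulr_ge0 ?addr_ge0 ?(ltW X0) ?(ltW eta0) // => /(_ isT M0).
    have -> : 1%:M + X - 1%:M = X by rewrite addrC addKr.
    move=> /(_ (lexx _)) h.
    have {}h : `|(1%:M + X) ^+ m - Y ^+ m| <= (1 + n%:R * s) ^+ m * (m%:R * (n%:R * (s * eta * (1 + C1) * M))).
      apply: h.
        have -> : 1%:M + X - Y = (X - s *: L) - (Y - 1%:M - s *: L).
          by rewrite opprB addrA subrK opprB addrA [X + _]addrC.
        apply: le_trans (ler_normB _ _) _; rewrite mulrDr mulr1; apply: lerD.
          by rewrite mulrC.
        apply: le_trans (h1 s _) _; first by rewrite gtr0_norm // (le_trans Xeta).
        by rewrite mulrC expr2 ler_wpM2r // ler_wpM2l // ltW.
      move=> j jm; rewrite Ypow; apply: Yle; first by rewrite mulr_ge0 // ltW.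
      by apply: le_trans ms; rewrite ler_wpM2r ?(ltW X0) // ler_nat.
    apply: le_trans h _.
    have -> : expR (N * t) * (t * (N * ((1 + C1) * M))) * eta = expR (N * t) * (t * (N * (eta * (1 + C1) * M))) by ring.
    apply: ler_pM.
    - by rewrite exprn_ge0 // addr_ge0 // mulr_ge0 // ltW.
    - by rewrite !mulr_ge0 ?addr_ge0 ?(ltW X0) ?(ltW eta0).
    - apply: (@le_trans _ _ (expR (N * s) ^+ m)).
        by rewrite lerXn2r ?nnegrE ?expR_ge0 ?addr_ge0 ?mulr_ge0 ?(ltW X0) // expR_ge1Dx.
      by rewrite -expRM_natl ler_expR mulrCA ler_wpM2l.
    have -> : m%:R * (n%:R * (s * eta * (1 + C1) * M)) = (m%:R * s) * (N * (eta * (1 + C1) * M)).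
      by rewrite /N; ring.
    by apply: ler_wpM2r => //; rewrite !mulr_ge0 ?addr_ge0 ?(ltW eta0).
  exists ((1%:M + X) ^+ m); first exact: G_exp_pow.
  have -> : expmx (t *: L) - (1%:M + X) ^+ m = (expmx (t *: L) - Y ^+ m) - ((1%:M + X) ^+ m - Y ^+ m).
    by rewrite opprB addrA subrK.
  apply: le_trans (ler_normB _ _) _.
  have b2 : `|expmx (t *: L) - Y ^+ m| <= N * (M * C2) * eta.
    have -> : expmx (t *: L) - Y ^+ m = Y ^+ m *m (expmx ((t - m%:R * s) *: L) - 1%:M).
      by rewrite mulmxBr mulmx1 Ypow -expmx_scaleD [_ * s + _]addrC subrK.
    apply: le_trans (mx_normM _ _) _; rewrite -mulrA ler_wpM2l // -mulrA; apply: ler_pM => //.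
      by rewrite Ypow; apply: Yle => //; rewrite mulr_ge0 // ltW.
    have ge : 0 <= t - m%:R * s by rewrite subr_ge0.
    apply: le_trans (h2 _ _) _.
      by rewrite ger0_norm // (le_trans ms2) // (le_trans Xeta).
    by rewrite ger0_norm // ler_wpM2l // (le_trans ms2).
  apply: le_trans (lerD b2 Xm) _; rewrite -mulrDl addrC -/K.
  apply: (@le_trans _ _ ((K + 1) * eta)); first by rewrite ler_wpM2r ?(ltW eta0) // lerDl.
  by rewrite mulrC -ler_pdivlMr.
apply/hg => t; have [t0|t0] := leP 0 t; first exact: pos.
have := pos (- t); rewrite oppr_ge0 => /(_ (ltW t0)) /(G_inv hG).
by rewrite invmx_expmx scaleNr opprK.
Qed.

Variable S : 'M[R]_n.
Hypothesis comS : forall A, A \in g -> S *m A = A *m S.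

(** Since [G] is connected, it is enough that this centraliser of [S] be open and
    closed in [G]. *)
Let H : set 'M[R]_n := [set P | G P /\ P *m S = S *m P].

Lemma commutant1 : H 1%:M. Proof. by split; [exact: G_one|rewrite mul1mx mulmx1]. Qed.
Lemma commutant_mul P Q : H P -> H Q -> H (P *m Q).
Proof.
move=> [GP cP] [GQ cQ]; split; first exact: (G_mul hG).
by rewrite -mulmxA cQ mulmxA cP mulmxA.
Qed.

Lemma commutant_exp A : A \in g -> H (expmx A).
Proof.
move=> Ag; split; first exact: (g_exp hg).
by rewrite expmx_comm // comS.
Qed.

Lemma comm_closed P : (forall e, 0 < e -> exists2 Q, Q *m S = S *m Q & `|P - Q| <= e) ->
  P *m S = S *m P.
Proof.
move=> h; apply/eqP; rewrite -subr_eq0 -normr_le0.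
apply: (@le0_eps _ _ (n%:R * `|S| + n%:R * `|S|)) => e e0.
have [Q cQ hQ] := h e e0.
have -> : P *m S - S *m P = (P - Q) *m S - S *m (P - Q).
  by rewrite mulmxBl mulmxBr cQ opprB addrA subrK.
apply: le_trans (ler_normB _ _) _; rewrite mulrDl; apply: lerD.
  by apply: le_trans (mx_normM _ _) _; rewrite -mulrA ler_wpM2l // mulrC ler_wpM2l.
by apply: le_trans (mx_normM _ _) _; rewrite -mulrA ler_wpM2l // ler_wpM2l.
Qed.

(** The distance from P to the closed set H is positive, and the factor 2 leaves
    room for a point that almost realises it. *)
Lemma near_minimiser P : G P -> ~ H P -> exists h, [/\ H h, 0 < `|P - h|,
  `|P - h| <= 2 * `|P - 1%:M| & forall h', H h' -> `|P - h| <= 2 * `|P - h'|].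
Proof.
move=> GP nHP; pose E := [set `|P - h| | h in H].
have E0 : has_inf E.
  by split; [exists `|P - 1%:M|, 1%:M => //; exact: commutant1|exists 0 => _ [h _ <-]].
have D0 : 0 < inf E.
  rewrite ltNge; apply/negP => D0; apply: nHP; split => //.
  apply: comm_closed => e e0.
  have [_ [h [Gh ch] <-] lt] := inf_adherent e0 E0; exists h => //.
  by apply: ltW; apply: lt_le_trans lt _; rewrite -[leRHS]add0r lerD2r.
have [_ [h Hh <-] lt] := inf_adherent D0 E0.
have low h' : H h' -> inf E <= `|P - h'| by move=> Hh'; apply: ge_inf; [exact: (proj2 E0)|exists h'].
have two h' : H h' -> `|P - h| <= 2 * `|P - h'|.
  move=> Hh'; apply: le_trans (ltW lt) _; have := low _ Hh'; lra.
exists h; split=> //; last by apply: two; exact: commutant1.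
exact: lt_le_trans D0 (low _ Hh).
Qed.

(** Otherwise there are P_j in G, outside H, that tend to 1.  Let h_j in H almost
    minimise the distance to P_j and write h_j^-1 P_j = 1 + X_j.  The directions
    X_j / |X_j| cluster at some L, which is in g by [tangent_in_g]; then
    h_j exp(|X_j| L) is in H and much closer to P_j than h_j is. *)
Lemma commutant_nbhs1 : exists2 delta, 0 < delta & forall P, G P -> `|P - 1%:M| < delta -> H P.
Proof.
apply: contrapT => hn.
pose c j : R := j.+1%:R^-1.
have ex j : exists P, [/\ G P, `|P - 1%:M| < c j & ~ H P].
  apply: contrapT => h; apply: hn; exists (c j); first by rewrite invr_gt0.
  by move=> P GP hP; apply: contrapT => nH; apply: h; exists P.
have [P hP] := choice ex.
have ex2 j : exists h, [/\ H h, 0 < `|P j - h|,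
  `|P j - h| <= 2 * `|P j - 1%:M| & forall h', H h' -> `|P j - h| <= 2 * `|P j - h'|].
  by have [GP _ nHP] := hP j; exact: near_minimiser.
have [h hh] := choice ex2.
pose X j := invmx (h j) *m (P j - h j).
have uh j : h j \in unitmx by have [[Gh _] _ _ _] := hh j; exact: (G_unit hG Gh).
have hX j : h j *m X j = P j - h j by rewrite /X mulmxA mulmxV // mul1mx.
have GX j : G (1%:M + X j).
  have -> : 1%:M + X j = invmx (h j) *m P j.
    by rewrite /X mulmxBr mulVmx // addrC subrK.
  have [[Gh _] _ _ _] := hh j; have [GP _ _] := hP j.
  by apply: (G_mul hG) => //; exact: (G_inv hG).
have X0 j : 0 < `|X j|.
  rewrite normr_gt0; apply/eqP => e; have [_ + _ _] := hh j.
  by rewrite -hX e mulmx0 normr0 ltxx.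
pose N : R := n%:R; have N0 : 0 <= N by [].
have inv_lt e : 0 < e -> exists J, forall j, (J <= j)%N -> c j < e.
  move=> e0; exists (Num.truncn e^-1) => j Jj.
  rewrite /c invf_plt ?posrE //; apply: lt_le_trans (truncnS_gt _) _.
  by rewrite ler_nat ltnS.
have hh1 j : `|h j - 1%:M| <= 3 * c j.
  have -> : h j - 1%:M = (P j - 1%:M) - (P j - h j).
    by rewrite opprB [RHS]addrC addrA subrK.
  have [_ hP1 _] := hP j; have [_ _ hP2 _] := hh j.
  apply: le_trans (ler_normB _ _) _; move: hP1 hP2; set a := `|_ - 1%:M|; set b := `|_ - h j|; lra.
have [J0 hJ0] : exists J, forall j, (J <= j)%N -> 3 * c j <= 1 / (2 * (N + 1)).
  have p : 0 < 1 / (6 * (N + 1)) by rewrite divr_gt0 // mulr_gt0 // ltr_wpDl.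
  have [J hJ] := inv_lt _ p; exists J => j Jj.
  have := ltW (hJ j Jj).
  have -> : 1 / (2 * (N + 1)) = 3 * (1 / (6 * (N + 1))).
    by field; rewrite gt_eqF // ltr_wpDl.
  by move=> h'; rewrite ler_wpM2l.
have hXe j : (J0 <= j)%N -> `|X j| <= 2 * `|P j - h j|.
  move=> Jj; have e : X j = (P j - h j) - (h j - 1%:M) *m X j.
    by rewrite mulmxBl mul1mx hX opprB addrC subrK.
  have : `|X j| <= `|P j - h j| + `|(h j - 1%:M) *m X j| by rewrite {1}e ler_normB.
  have : `|(h j - 1%:M) *m X j| <= 1 / 2 * `|X j|.
    apply: le_trans (mx_normM _ _) _; rewrite mulrA ler_wpM2r //.
    apply: (@le_trans _ _ ((N + 1) * (1 / (2 * (N + 1))))).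
      apply: ler_pM => //; first by rewrite lerDl.
      exact: le_trans (hh1 j) (hJ0 j Jj).
    apply: le_of_eq; field.
    by rewrite gt_eqF // ltr_wpDl.
  lra.
have Xlt j : (J0 <= j)%N -> `|X j| <= 4 * c j.
  move=> Jj; have := hXe j Jj; have [_ hP1 _] := hP j; have [_ _ hP2 _] := hh j; lra.
have vle j : `| `|X j|^-1 *: X j| <= 1.
  by rewrite normrZ ger0_norm ?invr_ge0 // mulVf // gt_eqF.
have [L hL] := bounded_cluster vle.
have sc j eta : `| `|X j|^-1 *: X j - L| <= eta -> `|X j - `|X j| *: L| <= eta * `|X j|.
  move=> he; have -> : X j - `|X j| *: L = `|X j| *: (`|X j|^-1 *: X j - L).
    by rewrite scalerBr scalerA mulfV ?gt_eqF // scale1r.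
  by rewrite normrZ normr_id mulrC ler_wpM2r.
have Lg : L \in g.
  apply: tangent_in_g => eta eta0.
  have [J hJ] := inv_lt (eta / 4) (divr_gt0 eta0 (ltr0Sn _ _)).
  have [j Jj hj] := hL eta (maxn J J0) eta0; exists (X j); split => //; last exact: sc.
  move: Jj; rewrite geq_max => /andP [Jj J0j].
  have := Xlt j J0j; have := hJ j Jj; lra.
have [C1 [d1 [C10 d10 h1]]] := expmx_quad_t L.
pose eta := Num.min d1 (1 / (32 * (N + 1) * (C1 + 1))).
have C1p : 0 < C1 + 1 by rewrite ltr_wpDl.
have N1p : 0 < N + 1 by rewrite ltr_wpDl.
have eta0 : 0 < eta by rewrite lt_min d10 divr_gt0 // !mulr_gt0.
have : eta <= eta by []; rewrite {2}/eta !le_min => /andP [eta1 eta2].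
have [J hJ] := inv_lt (eta / 4) (divr_gt0 eta0 (ltr0Sn _ _)).
have [j Jj hj] := hL eta (maxn J J0) eta0.
move: Jj; rewrite geq_max => /andP [Jj J0j].
have seta : `|X j| <= eta by have := Xlt j J0j; have := hJ j Jj; lra.
have [Hh e0 _ /(_ (h j *m expmx (`|X j| *: L)))] := hh j.
have -> : P j - h j *m expmx (`|X j| *: L) = h j *m (1%:M + X j - expmx (`|X j| *: L)).
  by rewrite mulmxBr mulmxDr mulmx1 hX [h j + _]addrC subrK.
move=> /(_ (commutant_mul Hh (commutant_exp (memvZ _ Lg)))).
set s := `|X j| in seta *.
have s0 : 0 <= s by apply: normr_ge0.
(* 1 + X_j and exp(|X_j| L) agree to first order, with a small relative error *)
have b1 : `|1%:M + X j - expmx (s *: L)| <= (C1 + 1) * eta * s.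
  have -> : 1%:M + X j - expmx (s *: L) = (X j - s *: L) - (expmx (s *: L) - 1%:M - s *: L).
    by rewrite opprB addrA subrK opprB addrA [X j + _]addrC.
  apply: le_trans (ler_normB _ _) _; rewrite mulrDl mul1r mulrDl addrC; apply: lerD; last exact: sc.
  apply: le_trans (h1 s _) _; first by rewrite ger0_norm // (le_trans seta).
  by rewrite expr2 mulrA ler_wpM2r // ler_wpM2l.
have b2 : `|h j| <= 2.
  have -> : h j = (h j - 1%:M) + 1%:M by rewrite subrK.
  apply: le_trans (ler_normD _ _) _.
  have := mx_norm1 R n; have := le_trans (hh1 j) (hJ0 j J0j).
  have : 1 / (2 * (N + 1)) <= 1.
    rewrite ler_pdivrMr ?mulr_gt0 // mul1r; have := N0; lra.
  lra.
have b3 : (C1 + 1) * eta <= 1 / (32 * (N + 1)).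
  have := ler_wpM2l (ltW C1p) eta2.
  have -> // : (C1 + 1) * (1 / (32 * (N + 1) * (C1 + 1))) = 1 / (32 * (N + 1)).
  by field; rewrite !gt_eqF.
have b4 : `|h j *m (1%:M + X j - expmx (s *: L))| <= 1 / 16 * s.
  apply: le_trans (mx_normM _ _) _.
  apply: (@le_trans _ _ (N * (2 * (1 / (32 * (N + 1)) * s)))).
    rewrite ler_wpM2l //; apply: ler_pM => //.
    by apply: le_trans b1 _; rewrite ler_wpM2r.
  have -> : N * (2 * (1 / (32 * (N + 1)) * s)) = N / (N + 1) * (1 / 16 * s).
    by field; rewrite gt_eqF.
  rewrite ler_piMl //; first by rewrite mulr_ge0.
  by rewrite ler_pdivrMr // mul1r lerDl.
have := hXe j J0j; rewrite -/s.
move: e0 b4; set a := `|P j - h j|; set b := `|h j *m _|; lra.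
Qed.

(** A subgroup that contains a neighbourhood of 1 is open; being also closed, the
    centraliser of S is all of the connected group G. *)
Lemma commutes_with_G : connected G -> forall P, G P -> P *m S = S *m P.
Proof.
move=> cG; have [delta d0 hd] := commutant_nbhs1.
suff -> : G = H by move=> P [].
apply/esym; apply: cG; first by exists 1%:M; exact: commutant1.
  pose r h := delta / (n%:R * `|invmx h| + 1).
  have r0 h : 0 < r h by rewrite divr_gt0 // ltr_wpDl // mulr_ge0.
  exists (\bigcup_(h in H) ball h (r h)).
    by apply: bigcup_open => h _; apply: ball_open; apply: r0.
  apply/seteqP; split => [P HP|P [GP [h Hh]]].
    by split; [case: HP|exists P => //; apply: ballxx].
  rewrite -ball_normE /= => hP.
  have [Gh _] := Hh; have uh := G_unit hG Gh.
  have -> : P = h *m (invmx h *m P) by rewrite mulmxA mulmxV // mul1mx.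
  apply: commutant_mul => //; apply: hd; first by apply: (G_mul hG) => //; exact: (G_inv hG).
  have -> : invmx h *m P - 1%:M = invmx h *m (P - h) by rewrite mulmxBr mulVmx.
  apply: le_lt_trans (mx_normM _ _) _.
  rewrite mulrA; apply: (@le_lt_trans _ _ ((n%:R * `|invmx h| + 1) * `|P - h|)).
    by rewrite ler_wpM2r // lerDl.
  rewrite mulrC -ltr_pdivlMr ?ltr_wpDl ?mulr_ge0 //.
  by rewrite -normrN opprB.
exists [set P | P *m S = S *m P]; last by apply/seteqP; split.
by apply: closed_metric => P; exact: comm_closed.
Qed.

End Connected.

(** * Schur's lemma and the normaliser of the complexified Lie algebra *)

Section Complexified.
Variable R : realType.
Local Notation C := R[i].
Variable n : nat.
Implicit Types (A B D S T P : 'M[R]_n) (X Y : 'M[C]_n) (U : {vspace 'M[R]_n}).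

Definition rmx p q (X : 'M[C]_(p, q)) : 'M[R]_(p, q) := map_mx (@complex.Re R) X.
Definition imx p q (X : 'M[C]_(p, q)) : 'M[R]_(p, q) := map_mx (@complex.Im R) X.

Lemma rimx p q (X : 'M[C]_(p, q)) : X = cplxmx (rmx X) + 'i%C *: cplxmx (imx X).
Proof. by apply/matrixP => i j; rewrite !mxE; exact: complexE. Qed.

Lemma rmxE p q (A B : 'M[R]_(p, q)) : rmx (cplxmx A + 'i%C *: cplxmx B) = A.
Proof. by apply/matrixP => i j; rewrite !mxE /= !mul0r mul1r subrr addr0. Qed.

Lemma imxE p q (A B : 'M[R]_(p, q)) : imx (cplxmx A + 'i%C *: cplxmx B) = B.
Proof. by apply/matrixP => i j; rewrite !mxE /= !mul0r mul1r !add0r. Qed.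

(** Schur's lemma: an eigenspace of S over C is invariant, hence everything. *)
Lemma scalar_of_commutant (F : set 'M[R]_n) S :
  irreducible_on [set cplxmx A | A in F] -> (forall P, F P -> P *m S = S *m P) ->
  exists c, S = c%:M.
Proof.
move=> [n0 irr] cS.
have [a /eigenvalueP [v hv v0]] := eigenvalue_closed (cplxmx S^T) n0.
pose W := lker (linfun (mulmx (cplxmx S - a%:M)) : 'Hom('cV[C]_n, 'cV[C]_n)).
have memW w : (w \in W) = (cplxmx S *m w == a *: w).
  by rewrite memv_ker lfunE /= mulmxBl mul_scalar_mx subr_eq0.
have stable (A : 'M[C]_n) : [set cplxmx B | B in F] A -> (act A W <= W)%VS.
  move=> [P FP <-]; apply/subvP => _ /memv_imgP [w wW ->].
  move: wW; rewrite !memW lfunE /= => /eqP wW.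
  by rewrite mulmxA -cplxmxM -cS // cplxmxM -mulmxA wW -scalemxAr.
have [W0|W1] := irr W stable.
  have : v^T \in W.
    rewrite memW; apply/eqP.
    have -> : cplxmx S = (cplxmx S^T)^T by rewrite /cplxmx map_trmx trmxK.
    by rewrite -trmx_mul hv linearZ.
  by rewrite W0 memv0 -[0]trmx0 (inj_eq (@trmx_inj _ _ _)) (negPf v0).
have eS : cplxmx S = a%:M.
  apply/matrixP => i j; have : delta_mx j 0 \in W by rewrite W1 memvf.
  rewrite memW => /eqP /(congr1 (fun M : 'cV[C]_n => M i 0)).
  rewrite -colE !mxE => ->; by rewrite eqxx andbT mulr_natr.
exists (complex.Re a); apply/matrixP => i j.
have := congr1 (fun M : 'M[C]_n => complex.Re (M i j)) eS; rewrite !mxE /= => ->.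
by case: eqP => _; rewrite ?mulr1n ?mulr0n.
Qed.

Lemma mxtrace_sq_eq0 A : \tr (A *m A^T) = 0 -> A = 0.
Proof.
move=> h; have : cplxmx A = 0.
  apply: frob2_eq0; apply: complexI.
  by rewrite -frob2E cplxmx_adj -cplxmxM mxtrace_cplx h.
by move/eqP; rewrite /cplxmx map_mx_eq0 => /eqP.
Qed.

(** The linear map X -> (tr (X b_i^T))_i is injective on U because
    tr (X X^T) = 0 only for X = 0; by dimension it is onto already from U. *)
Lemma ortho_proj U A : exists2 A1, A1 \in U & forall B, B \in U -> \tr ((A - A1) *m B^T) = 0.
Proof.
pose d := \dim U; pose b := vbasis U.
pose psi (X : 'M[R]_n) : 'rV[R]_d := \row_i \tr (X *m (b`_i)^T).
have psi_lin : linear psi.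
  by move=> c X Y; apply/rowP => i; rewrite !mxE mulmxDl -scalemxAl mxtraceD mxtraceZ.
pose psiL := GRing.isLinear.Build R 'M[R]_n 'rV[R]_d _ psi psi_lin.
pose psi' : {linear 'M[R]_n -> 'rV[R]_d} := HB.pack psi psiL.
pose f : 'Hom('M[R]_n, 'rV[R]_d) := linfun psi'.
have fE (X : 'M[R]_n) : f X = psi X by rewrite lfunE.
have ortho (X : 'M[R]_n) : psi X = 0 -> forall B, B \in U -> \tr (X *m B^T) = 0.
  move=> h B BU; rewrite (coord_vbasis BU) linear_sum mulmx_sumr linear_sum big1 // => i _.
  rewrite linearZ -scalemxAr linearZ /=.
  have := congr1 (fun M : 'rV[R]_d => M 0 i) h; rewrite !mxE => ->; by rewrite mulr0.
have inj : (U :&: lker f)%VS = 0%VS.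
  apply/eqP; rewrite -subv0; apply/subvP => X; rewrite memv_cap memv_ker fE => /andP [XU /eqP h].
  by rewrite memv0; apply/eqP; apply: mxtrace_sq_eq0; apply: ortho.
have full : (f @: U)%VS = fullv.
  apply/eqP; rewrite eqEdim subvf limg_dim_eq // dimvf /dim /= mul1n //.
have : f A \in (f @: U)%VS by rewrite full memvf.
move=> /memv_imgP [A1 A1U e]; exists A1 => // B BU; apply: ortho => //.
by rewrite -fE linearB /= e subrr.
Qed.

Lemma interpolation (s : seq C) (F : C -> C) : uniq s ->
  exists p : {poly C}, forall x, x \in s -> p.[x] = F x.
Proof.
elim: s => [|a s IH] /=; first by exists 0.
move=> /andP [as_ us]; have [p hp] := IH us.
pose q := \prod_(y <- s) ('X - y%:P).
have qa : q.[a] != 0.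
  rewrite -[_ == 0]/(root q a) root_prod_XsubC //.
exists (p + ((F a - p.[a]) / q.[a])%:P * q) => x; rewrite inE => /orP [/eqP ->|xs].
  by rewrite !hornerE mulfVK // addrC subrK.
have /eqP qx : root q x by rewrite root_prod_XsubC.
by rewrite !hornerE qx mulr0 addr0 hp.
Qed.

End Complexified.

Section Normaliser.
Variable R : realType.
Local Notation C := R[i].
Variable n : nat.
Implicit Types (A B D S T P : 'M[R]_n) (X Y h : 'M[C]_n).
Variables (G : set 'M[R]_n) (g : {vspace 'M[R]_n}).

(** The complexification of g as a set of complex matrices. *)
Definition gC X := (rmx X \in g) /\ (imx X \in g).

Lemma gC0 : gC 0.
Proof. by split; rewrite /rmx /imx ?map_mx0 ?mem0v. Qed.

Lemma gCD X Y : gC X -> gC Y -> gC (X + Y).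
Proof.
move=> [x1 x2] [y1 y2]; split.
  have -> : rmx (X + Y) = rmx X + rmx Y.
    by apply/matrixP => i j; rewrite !mxE; case: (X i j) (Y i j) => ? ? [].
  exact: memvD.
have -> : imx (X + Y) = imx X + imx Y.
  by apply/matrixP => i j; rewrite !mxE; case: (X i j) (Y i j) => ? ? [].
exact: memvD.
Qed.

Lemma gCZ a X : gC X -> gC (a *: X).
Proof.
move=> [x1 x2]; split.
  have -> : rmx (a *: X) = complex.Re a *: rmx X - complex.Im a *: imx X.
    by apply/matrixP => i j; rewrite !mxE; case: a (X i j) => ? ? [].
  by apply: memvB; apply: memvZ.
have -> : imx (a *: X) = complex.Im a *: rmx X + complex.Re a *: imx X.
  by apply/matrixP => i j; rewrite !mxE; case: a (X i j) => ? ? [? ?] /=; rewrite addrC.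
by apply: memvD; apply: memvZ.
Qed.

Lemma gC_cplx A : A \in g -> gC (cplxmx A).
Proof.
move=> h; have -> : cplxmx A = cplxmx A + 'i%C *: cplxmx 0 by rewrite /cplxmx map_mx0 scaler0 addr0.
by split; rewrite ?rmxE ?imxE ?mem0v.
Qed.

(** The normaliser of [gC] in SL(n, C).  It stands in for U^C, which it contains:
    unlike a Zariski closure it is visibly stable under products, inverses and
    adjoints. *)
Definition normC h := \det h = 1 /\
  forall Y, gC Y -> gC (h *m Y *m invmx h) /\ gC (invmx h *m Y *m h).

Lemma normC_unit h : normC h -> h \in unitmx.
Proof. by move=> [d _]; rewrite unitmxE d unitr1. Qed.

Lemma invmxM (F : fieldType) m (A B : 'M[F]_m) : A \in unitmx -> B \in unitmx ->
  invmx (A *m B) = invmx B *m invmx A.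
Proof.
move=> uA uB; have uAB : A *m B \in unitmx by rewrite unitmx_mul uA.
by rewrite -[RHS](mulmxK uAB) !mulmxA (mulmxKV uA) (mulVmx uB) mul1mx.
Qed.

Lemma normC_mul h1 h2 : normC h1 -> normC h2 -> normC (h1 *m h2).
Proof.
move=> N1 N2; have u1 := normC_unit N1; have u2 := normC_unit N2.
have [d1 a1] := N1; have [d2 a2] := N2.
split; first by rewrite det_mulmx d1 d2 mulr1.
move=> Y hY; rewrite invmxM //; split.
  have [h _] := a2 Y hY; have [{}h _] := a1 _ h.
  by move: h; rewrite !mulmxA.
have [_ h] := a1 Y hY; have [_ {}h] := a2 _ h.
by move: h; rewrite !mulmxA.
Qed.

Lemma normC_inv h : normC h -> normC (invmx h).
Proof.
move=> [d a]; split; first by rewrite det_inv d invr1.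
by move=> Y /a [? ?]; rewrite invmxK.
Qed.

Hypothesis hG : closed_subgroup_SL G.
Hypothesis hg : is_lie_algebra G g.
Hypothesis g_trH : forall A, A \in g -> A^T \in g.

Lemma gC_adj X : gC X -> gC (X^t*).
Proof.
move=> [x1 x2]; split.
  have -> : rmx (X^t*) = (rmx X)^T by apply/matrixP => i j; rewrite !mxE; case: (X j i).
  exact: g_trH.
have -> : imx (X^t*) = - (imx X)^T by apply/matrixP => i j; rewrite !mxE; case: (X j i).
by rewrite memvN; exact: g_trH.
Qed.

Lemma normC_adj h : normC h -> normC (h^t*).
Proof.
move=> N; have [d a] := N; have uh := normC_unit N.
split; first by rewrite det_map_mx det_tr d /= conjC1.
move=> Y hY; rewrite invmx_adj //.
have [h1 h2] := a _ (gC_adj hY); split.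
  by move: (gC_adj h2); rewrite !adjM adjK !mulmxA.
by move: (gC_adj h1); rewrite !adjM adjK !mulmxA.
Qed.

Lemma invmx_cplx P : P \in unitmx -> invmx (cplxmx P) = cplxmx (invmx P).
Proof. by move=> _; rewrite /cplxmx map_invmx. Qed.

Lemma rmx_conj A B X : rmx (cplxmx A *m X *m cplxmx B) = A *m rmx X *m B.
Proof.
rewrite {1}(rimx X) mulmxDr mulmxDl -scalemxAr -scalemxAl -!cplxmxM; exact: rmxE.
Qed.

Lemma imx_conj A B X : imx (cplxmx A *m X *m cplxmx B) = A *m imx X *m B.
Proof.
rewrite {1}(rimx X) mulmxDr mulmxDl -scalemxAr -scalemxAl -!cplxmxM; exact: imxE.
Qed.

Lemma normC_G P : G P -> normC (cplxmx P).
Proof.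
move=> GP; have uP := G_unit hG GP; have GPi := G_inv hG GP.
split; first by rewrite det_cplx (G_det hG GP).
move=> Y [y1 y2]; rewrite invmx_cplx // /gC !rmx_conj !imx_conj; split; split.
- exact: (g_Ad hG hg).
- exact: (g_Ad hG hg).
- by rewrite -{2}(invmxK P); exact: (g_Ad hG hg).
- by rewrite -{2}(invmxK P); exact: (g_Ad hG hg).
Qed.

Hypothesis g_brH : forall A B, A \in g -> B \in g -> A *m B - B *m A \in g.
Hypothesis hconn : connected G.
Hypothesis hirrC : irreducible_on [set cplxmx A | A in G].

Lemma mxtrace_oppr m (A : 'M[R]_m) : \tr (- A) = - \tr A.
Proof. by rewrite -scaleN1r mxtraceZ mulN1r. Qed.

(** Let S1 be the orthogonal projection of S to g and Z = the commutator of
    S - S1 and Y.  Then Z is in g, and tr (Z Z^T) is the scalar product of S - S1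
    with the commutator of Z and Y^T, an element of g, hence 0.
    So S - S1 commutes with g, therefore with G. *)
Lemma normalizer_scalar S : (forall Y : 'M[R]_n, Y \in g -> S *m Y - Y *m S \in g) ->
  exists S1 c, S1 \in g /\ S = S1 + c%:M.
Proof.
move=> hS; have [S1 S1g ort] := ortho_proj g S.
have [c ec] : exists c, S - S1 = c%:M.
  apply: scalar_of_commutant hirrC _; apply: (commutes_with_G hG hg) => // Y Yg.
  apply/eqP; rewrite -subr_eq0; apply/eqP; apply: mxtrace_sq_eq0.
  set Z := (S - S1) *m Y - Y *m (S - S1).
  have Zg : Z \in g.
    have -> : Z = (S *m Y - Y *m S) - (S1 *m Y - Y *m S1).
      by rewrite /Z mulmxBl mulmxBr !opprD !opprK addrACA.
    by apply: memvB; [apply: hS|apply: g_brH].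
  have -> : \tr (Z *m Z^T) = \tr ((S - S1) *m (Z *m Y^T - Y^T *m Z)^T).
    have -> : (Z *m Y^T - Y^T *m Z)^T = Y *m Z^T - Z^T *m Y.
      by rewrite linearB /= !trmx_mul trmxK.
    have -> : Z *m Z^T = (S - S1) *m Y *m Z^T - Y *m ((S - S1) *m Z^T).
      by rewrite mulmxA -mulmxBl.
    rewrite mulmxBr !mxtraceD !mxtrace_oppr.
    by rewrite (mxtrace_mulC Y) !mulmxA.
  by apply: ort; apply: g_brH => //; apply: g_trH.
by exists S1, c; split => //; rewrite -ec addrC subrK.
Qed.

Lemma uconjM (V : 'M[C]_n) X Y : V \is unitarymx ->
  (V *m X *m V^t*) *m (V *m Y *m V^t*) = V *m (X *m Y) *m V^t*.
Proof.
move=> hV; transitivity (V *m X *m (V^t* *m V) *m Y *m V^t*); first by rewrite !mulmxA.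
by rewrite (unitaryR hV) mulmx1 !mulmxA.
Qed.

(** In the eigenbasis of h, Ad h multiplies the (i, j) entry by d_i / d_j and
    ad (ln h) multiplies it by ln (d_i / d_j).  Interpolation gives a polynomial p
    with ad (ln h) = p (Ad h), and Ad h preserves [gC]. *)
Lemma normC_log h V d : normC h -> V \is unitarymx -> (forall i, 0 < d i) ->
  h = udg V d -> forall Y, gC Y ->
  gC (udg V (fun i => ln (d i)) *m Y - Y *m udg V (fun i => ln (d i))).
Proof.
move=> N hV d0 eh Y hY; set X := udg V _.
have uh := normC_unit N.
have ih : invmx h = udg V (fun i => (d i)^-1).
  have e : udg V (fun i => (d i)^-1) *m h = 1%:M.
    rewrite eh (udgM _ _ hV) -(udg1 hV); congr udg; apply/funext => i.
    by rewrite mulVf // gt_eqF.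
  by rewrite -[LHS]mul1mx -e (mulmxK uh).
pose Z := fix Z k := if k is k'.+1 then h *m Z k' *m invmx h else Y.
have hZ k : gC (Z k) by elim: k => [//|k IH] /=; have [] := N.2 _ IH.
pose Y' := V^t* *m Y *m V.
have [W WE] : exists W : nat -> 'M[C]_n,
    forall k i j, W k i j = (d i / d j)%:C ^+ k * Y' i j.
  by exists (fun k => \matrix_(i, j) ((d i / d j)%:C ^+ k * Y' i j)) => k i j; rewrite mxE.
have WS k : dg d *m W k *m dg (fun i => (d i)^-1) = W k.+1.
  apply/matrixP => i j; rewrite /dg mul_mx_diag mul_diag_mx !mxE !WE exprS.
  have -> : (d i / d j)%:C = (d i)%:C * ((d j)^-1)%:C by rewrite rmorphM.
  set a := (d i)%:C; set b := (_^-1)%:C; set e := _ ^+ k; set y := Y' i j.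
  by rewrite -!mulrA; congr (a * _); rewrite mulrA mulrC.
have W0 : W 0%N = Y' by apply/matrixP => i j; rewrite WE expr0 mul1r.
have ZE k : Z k = V *m W k *m V^t*.
  elim: k => [|k IH] /=.
    by rewrite W0 /Y' !mulmxA (unitaryL hV) mul1mx -mulmxA (unitaryL hV) mulmx1.
  have e1 := uconjM (dg d) (W k) hV.
  have e2 := uconjM (dg d *m W k) (dg (fun i => (d i)^-1)) hV.
  have e3 : h *m Z k *m invmx h = udg V d *m (V *m W k *m V^t*) *m udg V (fun i => (d i)^-1).
    by rewrite -IH -eh -ih.
  apply: (etrans e3); apply: (etrans (congr1 (mulmx^~ _) e1)); apply: (etrans e2).
  exact: (congr1 (fun M : 'M[C]_n => V *m M *m V^t*) (WS k)).
pose D := dg (fun i => ln (d i)).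
have DE : D *m Y' - Y' *m D = \matrix_(i, j) ((ln (d i / d j))%:C * Y' i j).
  apply/matrixP => i j; rewrite /D /dg mul_mx_diag mul_diag_mx !mxE ln_div ?posrE // rmorphB /=.
  by rewrite mulrBl [X in _ - X]mulrC.
have XE : X *m Y - Y *m X = V *m (D *m Y' - Y' *m D) *m V^t*.
  have eY : Y = V *m Y' *m V^t*.
    by rewrite /Y' !mulmxA (unitaryL hV) mul1mx -mulmxA (unitaryL hV) mulmx1.
  have e1 : X *m Y = V *m (D *m Y') *m V^t* by rewrite [in LHS]eY; exact: (uconjM D Y' hV).
  have e2 : Y *m X = V *m (Y' *m D) *m V^t* by rewrite [in LHS]eY; exact: (uconjM Y' D hV).
  by rewrite e1 e2 mulmxBr mulmxBl.
have [p hp] := interpolation (fun x => (ln (complex.Re x))%:C)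
  (undup_uniq [seq (d ij.1 / d ij.2)%:C | ij : 'I_n * 'I_n]).
have -> : X *m Y - Y *m X = \sum_(k < size p) p`_k *: Z k.
  have -> : \sum_(k < size p) p`_k *: Z k = V *m (\sum_(k < size p) p`_k *: W k) *m V^t*.
    rewrite mulmx_sumr mulmx_suml; apply: eq_bigr => k _.
    by rewrite -scalemxAr -scalemxAl ZE.
  rewrite XE; suff -> : D *m Y' - Y' *m D = \sum_(k < size p) p`_k *: W k by [].
  rewrite DE; apply/matrixP => i j; rewrite mxE summxE.
  have <- : p.[(d i / d j)%:C] = (ln (d i / d j))%:C.
    rewrite hp // mem_undup; apply/mapP; exists (i, j) => //; exact: mem_enum.
  by rewrite horner_coef mulr_suml; apply: eq_bigr => k _; rewrite [RHS]mxE WE mulrA.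
by elim/big_rec: _ => [|k x _ hx]; [exact: gC0|apply: gCD => //; apply: gCZ].
Qed.

Hypothesis hpolar_tr : forall A, A \in g -> \tr A = 0.

(** With X = ln (h^t* h), ad X preserves [gC] by [normC_log].  So the real and
    imaginary parts of X normalise g and lie in g up to scalars, and the scalars
    vanish since tr X = ln (det (h^t* h)) = 0. *)
Lemma polar_in_gC h V d : normC h -> V \is unitarymx -> (forall i, 0 < d i) ->
  h^t* *m h = udg V d -> gC (udg V (fun i => ln (d i))).
Proof.
move=> N hV d0 eh; set X := udg V _.
have N2 : normC (udg V d) by rewrite -eh; apply: normC_mul => //; exact: normC_adj.
have ad Y := normC_log N2 hV d0 (erefl _) (Y := Y).
have trX : \tr X = 0.
  rewrite /X mxtrace_udg //; congr (_%:C).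
  have /complexI dd : (\prod_i d i)%:C = 1%:C :> C by rewrite -(det_udg d hV); have [-> _] := N2.
  have <- : ln (\prod_i d i) = \sum_i ln (d i).
    suff : 0 < \prod_i d i /\ ln (\prod_i d i) = \sum_i ln (d i) by case.
    elim/big_rec2: _ => [|i x y _ [y0 <-]]; first by rewrite ln1.
    by rewrite mulr_gt0 // lnM ?posrE.
  by rewrite dd ln1.
have part S (hS : forall Y : 'M[R]_n, Y \in g -> S *m Y - Y *m S \in g) (tS : \tr S = 0) : S \in g.
  (* traces: S and S1 have trace 0, hence so does the scalar, and n > 0 *)
  have [S1 [c [S1g eS]]] := normalizer_scalar hS.
  move: tS; rewrite eS linearD /= hpolar_tr // add0r mxtrace_scalar -mulr_natr => /eqP.
  have n0 := hirrC.1.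
  rewrite mulf_eq0 pnatr_eq0 eqn0Ngt n0 orbF => /eqP ->.
  by rewrite raddf0 addr0.
have eq1 (Y : 'M[R]_n) : X *m cplxmx Y - cplxmx Y *m X =
   cplxmx (rmx X *m Y - Y *m rmx X) + 'i%C *: cplxmx (imx X *m Y - Y *m imx X).
  rewrite {1 2}(rimx X) mulmxDl mulmxDr -scalemxAl -scalemxAr -!cplxmxM.
  by rewrite !cplxmxD !cplxmxN scalerBr opprD addrACA.
have re : forall Y : 'M[R]_n, Y \in g -> rmx X *m Y - Y *m rmx X \in g.
  by move=> Y Yg; have [] := ad _ (gC_cplx Yg); rewrite eq1 rmxE.
have im : forall Y : 'M[R]_n, Y \in g -> imx X *m Y - Y *m imx X \in g.
  by move=> Y Yg; have [_] := ad _ (gC_cplx Yg); rewrite eq1 imxE.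
have trRe : \tr (rmx X) = complex.Re (\tr X).
  by rewrite /rmx /mxtrace; elim/big_rec2: _ => // i x y _ ->; rewrite mxE; case: (X i i) x y => ? ? [? ?] y.
have trIm : \tr (imx X) = complex.Im (\tr X).
  by rewrite /imx /mxtrace; elim/big_rec2: _ => // i x y _ ->; rewrite mxE; case: (X i i) x y => ? ? [? ?] y.
by split; apply: part => //; rewrite ?trRe ?trIm trX.
Qed.

End Normaliser.

(** * The Zariski closure *)

Section Zariski.
Variable R : realType.
Local Notation C := R[i].
Variable n : nat.
Implicit Types (X Y : 'M[C]_n) (F : 'M[C]_n -> C).

Definition polyfun F := exists f : mpoly.mpoly (n * n) C,
  forall X, F X = mpoly.meval (fun l => mxvec X 0 l) f.

Lemma polyfun_cst c : polyfun (fun=> c).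
Proof. by exists (mpoly.mpolyC (n * n) c) => X; rewrite mpoly.mevalC. Qed.

Lemma polyfun_coord i j : polyfun (fun X => X i j).
Proof.
exists (mpoly.mpolyX C (mpoly.mnm1 (mxvec_index i j))) => X.
by rewrite mpoly.mevalXU mxvecE.
Qed.

Lemma polyfunD F1 F2 : polyfun F1 -> polyfun F2 -> polyfun (fun X => F1 X + F2 X).
Proof. by move=> [f1 h1] [f2 h2]; eexists => X; rewrite h1 h2; apply/esym/mpoly.mevalD. Qed.

Lemma polyfunM F1 F2 : polyfun F1 -> polyfun F2 -> polyfun (fun X => F1 X * F2 X).
Proof. by move=> [f1 h1] [f2 h2]; eexists => X; rewrite h1 h2; apply/esym/mpoly.mevalM. Qed.

Lemma polyfun_eq F1 F2 : F1 =1 F2 -> polyfun F1 -> polyfun F2.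
Proof. by move=> e [f h]; exists f => X; rewrite -e. Qed.

Lemma polyfun_sum (I : Type) (r : seq I) (P : pred I) (F : I -> 'M[C]_n -> C) :
  (forall i, polyfun (F i)) -> polyfun (fun X => \sum_(i <- r | P i) F i X).
Proof.
move=> h; elim: r => [|i r IH].
  by apply: polyfun_eq (polyfun_cst 0) => X; rewrite big_nil.
apply: (@polyfun_eq (fun X => (if P i then F i X else 0) + \sum_(i <- r | P i) F i X)).
  by move=> X; rewrite big_cons; case: ifP => // _; rewrite add0r.
by apply: polyfunD => //; case: (P i) => //; exact: polyfun_cst.
Qed.

Lemma polyfun_prod (I : Type) (r : seq I) (P : pred I) (F : I -> 'M[C]_n -> C) :
  (forall i, polyfun (F i)) -> polyfun (fun X => \prod_(i <- r | P i) F i X).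
Proof.
move=> h; elim: r => [|i r IH].
  by apply: polyfun_eq (polyfun_cst 1) => X; rewrite big_nil.
apply: (@polyfun_eq (fun X => (if P i then F i X else 1) * \prod_(i <- r | P i) F i X)).
  by move=> X; rewrite big_cons; case: ifP => // _; rewrite mul1r.
by apply: polyfunM => //; case: (P i) => //; exact: polyfun_cst.
Qed.

Definition polymx p q (F : 'M[C]_n -> 'M[C]_(p, q)) := forall i j, polyfun (fun X => F X i j).

Lemma polymx_id : polymx id. Proof. exact: polyfun_coord. Qed.

Lemma polymx_cst p q (A : 'M[C]_(p, q)) : polymx (fun=> A).
Proof. by move=> i j; exact: polyfun_cst. Qed.

Lemma polymxM p q r (F1 : 'M[C]_n -> 'M[C]_(p, q)) (F2 : 'M[C]_n -> 'M[C]_(q, r)) :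
  polymx F1 -> polymx F2 -> polymx (fun X => F1 X *m F2 X).
Proof.
move=> h1 h2 i j; apply: (@polyfun_eq (fun X => \sum_k F1 X i k * F2 X k j)).
  by move=> X; rewrite mxE.
by apply: polyfun_sum => k; apply: polyfunM.
Qed.

Lemma polyfun_det p (F : 'M[C]_n -> 'M[C]_p) : polymx F -> polyfun (fun X => \det (F X)).
Proof.
move=> h; apply: polyfun_sum => s; apply: polyfunM; first exact: polyfun_cst.
by apply: polyfun_prod => i; exact: h.
Qed.

Lemma polymx_adj (F : 'M[C]_n -> 'M[C]_n) : polymx F -> polymx (fun X => \adj (F X)).
Proof.
move=> h i j; apply: (@polyfun_eq (fun X => cofactor (F X) j i)) => [X|].
  by rewrite mxE.
apply: polyfunM; first exact: polyfun_cst.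
apply: polyfun_det => a b.
apply: (@polyfun_eq (fun X => F X (lift j a) (lift i b))) => [X|]; last exact: h.
by rewrite !mxE.
Qed.

(** Composition of polynomials, one for each entry of L. *)
Lemma polyfun_comp F (L : 'M[C]_n -> 'M[C]_n) : polyfun F -> polymx L -> polyfun (fun X => F (L X)).
Proof.
move=> [f hf] hL.
have ex l : exists q : mpoly.mpoly (n * n) C,
    forall X, mxvec (L X) 0 l = mpoly.meval (fun l => mxvec X 0 l) q.
  case/mxvec_indexP: l => i j; have [q hq] := hL i j; exists q => X.
  by rewrite mxvecE hq.
have [q hq] := choice ex.
exists (mpoly.comp_mpoly [tuple q l | l < n * n] f) => X.
rewrite mpoly.comp_mpoly_meval hf; congr (mpoly.meval _ f).
by apply/funext => l; rewrite tnth_mktuple hq.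
Qed.

Lemma zariski_poly (S : set 'M[C]_n) F X : polyfun F -> (forall B, S B -> F B = 0) ->
  zariski_closure S X -> F X = 0.
Proof.
move=> [f hf] h hX; rewrite hf; apply: hX => B SB; by rewrite -hf h.
Qed.

Lemma sub_zariski (S : set 'M[C]_n) X : S X -> zariski_closure S X.
Proof. by move=> SX f h; exact: h. Qed.

Lemma zariski_mull (S : set 'M[C]_n) A X :
  (forall B, S B -> S (A *m B)) -> zariski_closure S X -> zariski_closure S (A *m X).
Proof.
move=> hA hX f hf.
apply: (@zariski_poly S (fun X => mpoly.meval (fun l => mxvec (A *m X) 0 l) f)) hX.
  apply: (polyfun_comp (F := fun X => mpoly.meval (fun l => mxvec X 0 l) f) (L := fun X => A *m X)).
    by exists f.
  by apply: polymxM; [exact: polymx_cst|exact: polymx_id].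
by move=> B SB; apply: hf; exact: hA.
Qed.

Lemma invmx_det1 X : \det X = 1 -> invmx X = \adj X.
Proof. by move=> d; rewrite /invmx unitmxE d unitr1 invr1 scale1r. Qed.

Variables (G : set 'M[R]_n) (g : {vspace 'M[R]_n}).
Hypothesis hG : closed_subgroup_SL G.
Hypothesis hg : is_lie_algebra G g.
Local Notation UC := (zariski_closure [set cplxmx A | A in G]).

(** The linear equations of g, read over C, are equations of [gC]. *)
Lemma gC_kernel : exists f : 'End('M[R]_n), forall X,
  gC g X <-> forall a b, \sum_i \sum_j X i j * (f (delta_mx i j) a b)%:C = 0.
Proof.
have [f hf] := vspace_kernel g; exists f => X.
have fE (A : 'M[R]_n) a b : f A a b = \sum_i \sum_j A i j * f (delta_mx i j) a b.
  rewrite {1}(matrix_sum_delta A) linear_sum summxE; apply: eq_bigr => i _.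
  by rewrite linear_sum summxE; apply: eq_bigr => j _; rewrite linearZ mxE.
have key a b : \sum_i \sum_j X i j * (f (delta_mx i j) a b)%:C =
    (f (rmx X) a b) +i* (f (imx X) a b).
  rewrite !fE; elim/big_rec3: _ => // i x y z _ ->.
  have -> : \sum_j X i j * (f (delta_mx i j) a b)%:C =
     (\sum_j rmx X i j * f (delta_mx i j) a b) +i* (\sum_j imx X i j * f (delta_mx i j) a b).
    elim/big_rec3: _ => // j x' y' z' _ ->; rewrite !mxE.
    by case: (X i j) => u v /=; apply/eqP; rewrite eq_complex /= !mulr0 subr0 add0r !eqxx.
  by [].
split.
  move=> [h1 h2] a b; rewrite key; move: h1 h2; rewrite !hf => /eqP -> /eqP ->.
  by rewrite !mxE.
move=> h; split; rewrite hf; apply/eqP/matrixP => a b; rewrite mxE.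
  by have := h a b; rewrite key => -[].
by have := h a b; rewrite key => -[].
Qed.

(** Where the determinant is 1 the inverse is the adjugate, which is polynomial.
    So membership in [normC] amounts to polynomial equations, and they hold on
    G. *)
Lemma UC_normC X : UC X -> normC g X.
Proof.
move=> hX; have d : \det X = 1.
  apply/eqP; rewrite -subr_eq0; apply/eqP; apply: (@zariski_poly _ (fun X => \det X - 1) _ _ _ hX).
    by apply: polyfunD; [apply: polyfun_det; exact: polymx_id|exact: polyfun_cst].
  by move=> _ [P GP <-]; rewrite det_cplx (G_det hG GP) subrr.
have [f hf] := gC_kernel.
have adP (P : 'M[R]_n) : G P -> \adj (cplxmx P) = invmx (cplxmx P).
  by move=> GP; rewrite invmx_det1 // det_cplx (G_det hG GP).
split => // Y hY; rewrite invmx_det1 //; split.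
  apply/hf => a b; apply: (@zariski_poly _ (fun X => \sum_i \sum_j (X *m Y *m \adj X) i j * (f (delta_mx i j) a b)%:C) _ _ _ hX).
    apply: polyfun_sum => i; apply: polyfun_sum => j; apply: polyfunM; last exact: polyfun_cst.
    apply: polymxM; last by apply: polymx_adj; exact: polymx_id.
    by apply: polymxM; [exact: polymx_id|exact: polymx_cst].
  move=> _ [P GP <-]; rewrite adP //.
  by have [_ h] := normC_G hG hg GP; have [h1 _] := h _ hY; exact: (proj1 (hf _) h1 a b).
apply/hf => a b; apply: (@zariski_poly _ (fun X => \sum_i \sum_j (\adj X *m Y *m X) i j * (f (delta_mx i j) a b)%:C) _ _ _ hX).
  apply: polyfun_sum => i; apply: polyfun_sum => j; apply: polyfunM; last exact: polyfun_cst.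
  apply: polymxM; last exact: polymx_id.
  by apply: polymxM; [apply: polymx_adj; exact: polymx_id|exact: polymx_cst].
move=> _ [P GP <-]; rewrite adP //.
by have [_ h] := normC_G hG hg GP; have [_ h1] := h _ hY; exact: (proj1 (hf _) h1 a b).
Qed.

Lemma UC_G P : G P -> UC (cplxmx P).
Proof. by move=> GP; apply: sub_zariski; exists P. Qed.

Lemma UC_mulG P X : G P -> UC X -> UC (cplxmx P *m X).
Proof.
move=> GP; apply: zariski_mull => _ [B GB <-]; exists (P *m B); last exact: cplxmxM.
exact: (G_mul hG).
Qed.

End Zariski.

(** * A limit of energy estimates *)

Section LimitInequality.
Variable R : realType.

(** Since F >= m, the left-hand side is about c m (eps sum F), while eps sum F is
    at least m (T - t0) and makes A negligible.  The first k0 terms, where F may be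
    smaller than m, take a time of at most t0 and cost a bounded amount. *)
Lemma limit_ineq (c s A m K t0 : R) : 0 < c -> 0 <= s -> 0 <= K -> 0 < m -> 0 <= t0 ->
  (forall e0 T : R, 0 < e0 -> exists eps (F : nat -> R) N k0,
     [/\ 0 < eps <= e0, T <= eps * N%:R, eps * k0%:R <= t0,
         (forall k, 0 <= F k <= c^-1) /\
         (forall k, (k0 <= k)%N -> (k < N)%N -> m <= F k) &
         eps * (c - 4 * eps) * (\sum_(k < N) F k ^+ 2) <=
         A + (c * s + K * eps) * (eps * \sum_(k < N) F k)]) ->
  m <= s.
Proof.
move=> c0 s0 K0 m0 t00 h; rewrite leNgt; apply/negP => sm.
have q0 : 0 < 4 * m + K + 1 by lra.
(* below c / 8 the factor c - 4 eps is at least c / 2; the second bound makes the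
   O(eps) terms at most half of the gap c (m - s) *)
pose e0 := Num.min (c / 8) (c * (m - s) / 2 / (4 * m + K + 1)).
have ms0 : 0 < m - s by lra.
have e00 : 0 < e0 by rewrite lt_min !divr_gt0 // mulr_gt0.
pose B := `|A| + m * t0; have B0 : 0 <= B by rewrite addr_ge0 // mulr_ge0 // ltW.
have cms : 0 < c * (m - s) / 2 by rewrite divr_gt0 // mulr_gt0.
(* the time that makes the gap exceed the constant B *)
pose T := t0 + (B + 1) / (c * (m - s) / 2) / m.
have [eps [F [N [k0 [/andP [ep0 epe] TN k0t [hF hm] le]]]]] := h e0 T e00.
move: epe; rewrite le_min => /andP [ep1 ep2].
have ep3 : eps * (4 * m + K + 1) <= c * (m - s) / 2 by rewrite -ler_pdivlMr.
set S1 := \sum_(k < N) F k in le; set S2 := \sum_(k < N) _ in le.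
have S10 : 0 <= S1 by apply: sumr_ge0 => k _; have /andP [] := hF k.
have kN : \sum_(k < N) (if (k < k0)%N then 1 else 0 : R) <= k0%:R.
  elim: (N) => [|M IH]; first by rewrite big_ord0.
  have IH2 : \sum_(k < M) (if (k < k0)%N then 1 else 0 : R) <= M%:R.
    have -> : M%:R = \sum_(k < M) (1 : R) by rewrite sumr_const card_ord.
    by apply: ler_sum => k _; case: ifP.
  rewrite big_ord_recr /=; case: ifP => kk; last by rewrite addr0.
  by apply: le_trans (lerD IH2 (lexx 1)) _; rewrite natr1 ler_nat.
have step k : (k < N)%N -> m * F k - m / c * (if (k < k0)%N then 1 else 0) <= F k ^+ 2.
  move=> kN'; have /andP [F0 Fc] := hF k; case: ifP => kk.
    rewrite mulr1; have := ler_wpM2l (ltW m0) Fc; have := sqr_ge0 (F k); lra.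
  have mF : m <= F k by apply: hm => //; rewrite leqNgt kk.
  by rewrite mulr0 subr0 expr2 ler_wpM2r.
have S12 : m * S1 - m / c * k0%:R <= S2.
  apply: (@le_trans _ _ (\sum_(k < N) (m * F k - m / c * (if (k < k0)%N then 1 else 0)))).
    rewrite sumrB -!mulr_sumr lerD2l lerN2 ler_wpM2l // divr_ge0 // ltW //.
  by apply: ler_sum => k _; apply: step.
have S1low : m * (N%:R - k0%:R) <= S1.
  have h1 k : (k < N)%N -> m - m * (if (k < k0)%N then 1 else 0) <= F k.
    move=> kN'; have /andP [F0 _] := hF k; case: ifP => kk; first by rewrite mulr1 subrr.
    by rewrite mulr0 subr0; apply: hm => //; rewrite leqNgt kk.
  apply: le_trans (ler_sum _ (fun (k : 'I_N) _ => h1 k (ltn_ord k))).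
  rewrite mulrBr sumrB -mulr_sumr sumr_const card_ord -[m *+ N]mulr_natr lerD2l lerN2 ler_wpM2l //.
  exact: ltW.
have l1 : eps * (c - 4 * eps) * (m * S1 - m / c * k0%:R) <= eps * (c - 4 * eps) * S2.
  by apply: ler_wpM2l => //; rewrite mulr_ge0 ?(ltW ep0) //; lra.
have S : 0 <= eps * S1 by rewrite mulr_ge0 // ltW.
have l2 : (c - 4 * eps) / c * (m * (eps * k0%:R)) <= m * t0.
  apply: (@le_trans _ _ (1 * (m * (eps * k0%:R)))).
    rewrite ler_wpM2r ?mulr_ge0 ?(ltW m0) ?(ltW ep0) //.
    by rewrite ler_pdivrMr // mul1r; lra.
  by rewrite mul1r ler_wpM2l // ltW.
have l1' : eps * (c - 4 * eps) * (m * S1 - m / c * k0%:R) =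
   (c - 4 * eps) * m * (eps * S1) - (c - 4 * eps) / c * (m * (eps * k0%:R)).
  by field; rewrite gt_eqF.
have l3 : (m * c - 4 * m * eps - c * s - K * eps) * (eps * S1) <= B.
  have := ler_norm A; rewrite /B; lra.
have l4 : c * (m - s) / 2 * (eps * S1) <= B.
  by apply: le_trans l3; rewrite ler_wpM2r //; lra.
have l5 : m * (T - t0) <= eps * S1.
  apply: (@le_trans _ _ (m * (eps * N%:R - eps * k0%:R))).
    by rewrite ler_wpM2l ?(ltW m0) //; lra.
  have -> : m * (eps * N%:R - eps * k0%:R) = eps * (m * (N%:R - k0%:R)) by ring.
  by rewrite ler_wpM2l // ltW.
have l6 : m * (T - t0) = (B + 1) / (c * (m - s) / 2).
  by rewrite /T; field; rewrite !gt_eqF //; lra.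
have := ler_wpM2l (ltW cms) l5; rewrite l6.
have -> : c * (m - s) / 2 * ((B + 1) / (c * (m - s) / 2)) = B + 1.
  by rewrite mulrCA mulfV ?mulr1 // gt_eqF.
lra.
Qed.

End LimitInequality.

(** * The momentum map and the gradient map *)

Section MomentumMap.
Variable R : realType.
Local Notation C := R[i].
Variable n : nat.
Implicit Types (A B P : 'M[R]_n) (X Y h : 'M[C]_n) (z w : 'cV[C]_n).

Lemma sqnZ (a : R) z : sqn (a%:C *: z) = a ^+ 2 * sqn z.
Proof. by rewrite /sqn mulr_sumr; apply: eq_bigr => i _; rewrite mxE sqmodM sqmodR. Qed.

Lemma hqrZ X (a : R) z : hqr X (a%:C *: z) = a ^+ 2 * hqr X z.
Proof.
rewrite /hqr /hq adjZ -scalemxAl -scalemxAl -scalemxAr !mxE.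
have -> : (a%:C)^* = a%:C by exact: conjc_real.
rewrite mulrA -rmorphM -expr2; set u := \sum_j _; case: u => u v /=.
by rewrite mul0r subr0.
Qed.

Definition normalised z : 'cV[C]_n := ((Num.sqrt (sqn z))^-1)%:C *: z.

Lemma sqn_normalised z : z != 0 -> sqn (normalised z) = 1.
Proof.
rewrite -sqn_gt0 => z0; rewrite sqnZ exprVn sqr_sqrtr ?sqn_ge0 // mulVf // gt_eqF //.
Qed.

Lemma hqr_normalised X z : hqr X (normalised z) = hqr X z / sqn z.
Proof. by rewrite hqrZ exprVn sqr_sqrtr ?sqn_ge0 // mulrC. Qed.

Lemma sqn_mul_normalised X z : sqn (X *m normalised z) = sqn (X *m z) / sqn z.
Proof. by rewrite -scalemxAr sqnZ exprVn sqr_sqrtr ?sqn_ge0 // mulrC. Qed.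

Lemma udgZ (V : 'M[C]_n) (a : R) d : a%:C *: udg V d = udg V (fun i => a * d i).
Proof.
rewrite /udg scalemxAl scalemxAr; congr (_ *m _ *m _); apply/matrixP => i j.
by rewrite mxE !dgE rmorphM mulrnAr.
Qed.

Lemma mulmx_neq0 h z : h \in unitmx -> z != 0 -> h *m z != 0.
Proof.
move=> uh; apply: contraNneq => e; by rewrite -[z](mulKmx uh) e mulmx0.
Qed.

Lemma exp_gram B (U : 'M[C]_n) b (eps : R) : U \is unitarymx -> B^T = B -> cplxmx B = udg U b ->
  (cplxmx (expmx ((- eps) *: B)))^t* *m cplxmx (expmx ((- eps) *: B)) =
  udg U (fun i => expR (- (2 * eps * b i))).
Proof.
move=> hU Bs eB; rewrite cplxmx_adj -expmx_tr linearZ /= Bs -cplxmxM -expmx_scaleD.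
rewrite -(expmx_spectral (S := (- eps - eps) *: B) (d := fun i => - (2 * eps * b i))) //.
rewrite cplxmxZ eB udgZ; congr udg; apply/funext => i; ring.
Qed.

(** The trace of the product, computed in the eigenbasis of Y. *)
Lemma trace_hqr X Y (V : 'M[C]_n) d : V \is unitarymx -> Y = udg V d -> X^t* = X ->
  complex.Re (\tr (X *m Y)) = \sum_i d i * hqr X (col i V).
Proof.
move=> hV -> hX.
have -> : \tr (X *m udg V d) = \tr (dg d *m (V^t* *m X *m V)).
  transitivity (\tr ((X *m V *m dg d) *m V^t*)); first by rewrite /udg !mulmxA.
  by rewrite mxtrace_mulC [RHS]mxtrace_mulC !mulmxA.
rewrite /mxtrace; have ReD (x y : C) : complex.Re (x + y) = complex.Re x + complex.Re y.
  by case: x; case: y.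
rewrite (big_morph _ ReD (erefl _)); apply: eq_bigr => i _.
rewrite /hqr hq_col /dg mul_diag_mx !mxE; set u := \sum_j _.
by case: u => a b /=; rewrite mul0r subr0.
Qed.

Lemma sum_hqr_frob X (Q : 'M[C]_n) : X^t* = X -> Q \is unitarymx ->
  \sum_i hqr X (col i Q) ^+ 2 <= frob2 X.
Proof.
move=> /herm_spectral [V [d [hV ->]]] hQ.
by rewrite (frob2_udg d hV); exact: (sum_hqr_le d hV hQ).
Qed.

Variables (G K : set 'M[R]_n) (g k : {vspace 'M[R]_n}).
Variables (ip : 'M[C]_n -> 'M[C]_n -> R) (c : R).
Variables (mu : {vspace 'cV[C]_n} -> 'M[C]_n) (mup : {vspace 'cV[C]_n} -> 'M[R]_n).
Hypothesis hG : closed_subgroup_SL G.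
Hypothesis hg : is_lie_algebra G g.
Hypothesis hK : K = G `&` @SO R n.
Hypothesis hk : is_lie_algebra K k.
Hypothesis c0 : 0 < c.
Hypothesis hip : forall X Y, su X -> su Y -> ip X Y = - c * complex.Re (\tr (X *m Y)).
Hypothesis hmu : is_momentum_map ip g k mu.
Hypothesis hmup : is_gradient_map ip g mup.

Lemma ipH_real A B : A^T = A -> \tr A = 0 -> B^T = B -> \tr B = 0 ->
  ipH ip (cplxmx A) (cplxmx B) = c * \tr (A *m B).
Proof.
move=> sA tA sB tB; rewrite /ipH hip; last 2 first.
- by apply: su_herm; rewrite ?cplxmx_adj ?sA ?mxtrace_cplx ?tA.
- by apply: su_herm; rewrite ?cplxmx_adj ?sB ?mxtrace_cplx ?tB.
rewrite -scalemxAl -scalemxAr scalerA -expr2 sqr_i scaleN1r -cplxmxM -cplxmxN mxtrace_cplx /=.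
by rewrite mxtrace_oppr mulrNN.
Qed.

Lemma rayleigh_hqr X z (x : R) : z != 0 -> x%:C = rayleigh X z -> x * sqn z = hqr X z.
Proof.
move=> z0 e; have s0 : sqn z != 0 by rewrite sqn_eq0.
have hz : (z^t* *m z) 0 0 = (sqn z)%:C by rewrite -hq1 /hq mulmx1.
have : (x * sqn z)%:C = hq X z.
  rewrite rmorphM /= e /rayleigh hz /hq mulfVK // -[0]/(0%:C) (inj_eq (@complexI R)) //.
by move=> e2; rewrite /hqr -e2.
Qed.

Lemma mup_p z : z != 0 -> ppart g (mup <[z]>%VS).
Proof. by move=> /hmup []. Qed.

Lemma mup_pair z B : z != 0 -> ppart g B ->
  c * \tr (mup <[z]>%VS *m B) * sqn z = hqr (cplxmx B) z.
Proof.
move=> z0 pB; have [pb hb] := hmup z0; apply: rayleigh_hqr => //.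
rewrite -(hb _ pB); have [_ sA tA] := pb; have [_ sB tB] := pB.
by rewrite ipH_real.
Qed.

Lemma norm_pE z : z != 0 ->
  norm_p ip (mup <[z]>%VS) = Num.sqrt c * Num.sqrt (\tr (mup <[z]>%VS *m mup <[z]>%VS)).
Proof.
by move=> /mup_p [_ s t]; rewrite /norm_p ipH_real // sqrtrM // ltW.
Qed.

Lemma herm_parts X : X^t* = X -> (rmx X)^T = rmx X /\ (imx X)^T = - imx X.
Proof.
move=> h; split; apply/matrixP => i j; rewrite !mxE -{1}h adjE; by case: (X i j).
Qed.

Lemma gC_herm_tr X : gC g X -> X^t* = X -> \tr X = 0.
Proof.
move=> [x1 x2] /herm_parts [h1 h2].
have [_ _ t1] := sym_in_p hG hg x1 h1.
rewrite (rimx X) mxtraceD mxtraceZ !mxtrace_cplx t1 add0r.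
have : \tr (imx X) = - \tr (imx X) by rewrite -{1}mxtrace_tr h2 mxtrace_oppr.
by move/eqP; rewrite -addr_eq0 -mulr2n mulrn_eq0 /= => /eqP ->; rewrite mulr0.
Qed.

(** The Hermitian elements of [gC] are those with symmetric real part and skew
    imaginary part, that is, those of i u. *)
Lemma gC_herm_ualg X : gC g X -> X^t* = X -> exists2 Y, ualg g k Y & 'i%C *: Y = X.
Proof.
move=> [x1 x2] /herm_parts [h1 h2].
exists (cplxmx (imx X) + 'i%C *: cplxmx (- rmx X)).
  exists (imx X), (- rmx X); split => //; first exact: (skew_in_k hG hg hK hk).
  apply: (sym_in_p hG hg); first by rewrite memvN.
  by rewrite linearN /= h1.
rewrite scalerDr scalerA -expr2 sqr_i cplxmxN scaleN1r opprK addrC; exact/esym/rimx.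
Qed.

(** The values of mu are skew-Hermitian; it is convenient to work in i u instead. *)
Definition xi z : 'M[C]_n := 'i%C *: mu <[z]>%VS.

Lemma ualg_su Y : ualg g k Y -> su Y.
Proof.
move=> [A [B [Ak [Bg Bs Bt] ->]]]; have As := k_skew hK hk Ak.
split.
  rewrite adjD adjZ !cplxmx_adj As Bs cplxmxN opprD conj_i.
  by rewrite scaleNr.
rewrite mxtraceD mxtraceZ !mxtrace_cplx Bt mulr0 addr0.
have : \tr A = - \tr A by rewrite -{1}mxtrace_tr As mxtrace_oppr.
by move/eqP; rewrite -addr_eq0 -mulr2n mulrn_eq0 /= => /eqP ->.
Qed.

Lemma xi_gC z : z != 0 -> gC g (xi z).
Proof.
move=> /hmu [[A [B [Ak [Bg Bs Bt] e]]] _]; rewrite /xi e.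
have -> : 'i%C *: (cplxmx A + 'i%C *: cplxmx B) = cplxmx (- B) + 'i%C *: cplxmx A.
  by rewrite scalerDr scalerA -expr2 sqr_i cplxmxN scaleN1r addrC.
split; rewrite ?rmxE ?imxE ?memvN //; exact: (k_sub_g hg hK hk).
Qed.

Lemma xi_herm z : z != 0 -> (xi z)^t* = xi z.
Proof.
move=> /hmu [/ualg_su [s _] _]; by rewrite /xi adjZ s conj_i scaleNr scalerN opprK.
Qed.

Lemma xi_pair z X : z != 0 -> gC g X -> X^t* = X ->
  c * complex.Re (\tr (xi z *m X)) * sqn z = hqr X z.
Proof.
move=> z0 gX hX; have [u hp] := hmu z0; apply: rayleigh_hqr => //.
have [Y uY eX] := gC_herm_ualg gX hX.
rewrite -hp; last by exists Y.
congr (_%:C); rewrite /ipH hip; last 2 first.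
- rewrite scalerA -expr2 sqr_i scaleN1r.
  have [s t] := ualg_su u.
  by split; rewrite ?adjN ?s ?mxtrace_oppr ?t ?oppr0 // raddfN /= t oppr0.
- by apply: su_herm => //; exact: gC_herm_tr.
have -> : ('i%C *: ('i%C *: mu <[z]>%VS)) *m ('i%C *: X) = - (xi z *m X).
  by rewrite scalerA -expr2 sqr_i scaleN1r mulNmx -scalemxAr -scalemxAl.
have -> : \tr (- (xi z *m X)) = - \tr (xi z *m X) by rewrite -scaleN1r mxtraceZ mulN1r.
by case: (\tr _) => a b /=; rewrite mulrNN.
Qed.

Lemma norm_suE z : z != 0 -> norm_su ip (mu <[z]>%VS) = Num.sqrt c * Num.sqrt (frob2 (xi z)).
Proof.
move=> z0; have [u _] := hmu z0; have su_u := ualg_su u.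
rewrite /norm_su -sqrtrM ?ltW //; congr Num.sqrt.
rewrite hip // mulNr -mulrN; congr (_ * _).
have := frob2E (xi z); rewrite xi_herm // /xi -scalemxAl -scalemxAr scalerA -expr2 sqr_i mxtraceZ mulN1r.
by case: (\tr _) => a b [-> _].
Qed.

(** Let D = xi - mu_p.  Its imaginary part is skew and contributes nothing to the
    Rayleigh quotient of D at a real vector, and its real part is in p.  So the
    pairings of xi and of mu_p with D have the same value, and D is orthogonal to
    itself. *)
Lemma xi_real (v : 'cV[R]_n) : v != 0 -> xi (cplxmx v) = cplxmx (mup <[cplxmx v]>%VS).
Proof.
move=> v0; set z := cplxmx v.
have z0 : z != 0.
  by rewrite /z /cplxmx map_mx_eq0.
have [Bg Bs Bt] := mup_p z0; set B := mup _ in Bg Bs Bt *.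
have s0 : sqn z != 0 by rewrite sqn_eq0.
set D := xi z - cplxmx B.
have hD : D^t* = D by rewrite /D adjD adjN xi_herm // cplxmx_adj Bs.
have gD : gC g D.
  apply: gCD; first exact: xi_gC.
  by rewrite -cplxmxN; apply: gC_cplx; rewrite memvN.
suff : frob2 D = 0 by move=> /frob2_eq0 /eqP; rewrite subr_eq0 => /eqP.
have [sR skI] := herm_parts hD.
have pR : ppart g (rmx D) by apply: (sym_in_p hG hg) sR; case: gD.
have e1 := xi_pair z0 gD hD.
have e2 := mup_pair z0 pR.
have e3 : hqr D z = hqr (cplxmx (rmx D)) z.
  rewrite /hqr {1}(rimx D) hqD hqZ.
  have -> : hq (cplxmx (imx D)) z = 0.
    rewrite /hq /z cplxmx_adj -!cplxmxM cplxmxE.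
    have : (v^T *m imx D *m v) 0 0 = - (v^T *m imx D *m v) 0 0.
      have -> : - (v^T *m imx D *m v) 0 0 = (v^T *m (- imx D) *m v) 0 0.
        by rewrite mulmxN mulNmx [RHS]mxE.
      rewrite -skI.
      have -> : v^T *m (imx D)^T *m v = (v^T *m imx D *m v)^T by rewrite !trmx_mul trmxK mulmxA.
      by rewrite [RHS]mxE.
    by move/eqP; rewrite -addr_eq0 -mulr2n mulrn_eq0 /= => /eqP ->.
  by rewrite mulr0 addr0.
have e4 : complex.Re (\tr (xi z *m D)) = \tr (B *m rmx D).
  have c1 : c != 0 by rewrite gt_eqF.
  by apply: (mulfI c1); apply: (mulIf s0); rewrite e1 e3 -e2.
have e5 : complex.Re (\tr (cplxmx B *m D)) = \tr (B *m rmx D).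
  rewrite {1}(rimx D) mulmxDr -scalemxAr -!cplxmxM mxtraceD mxtraceZ !mxtrace_cplx /=.
  by rewrite !mul0r mul1r subrr addr0.
have := frob2E D; rewrite hD {1}/D mulmxBl mxtraceD.
have -> : \tr (- (cplxmx B *m D)) = - \tr (cplxmx B *m D) by rewrite -scaleN1r mxtraceZ mulN1r.
move: e4 e5; case: (\tr (xi z *m D)) => a1 b1; case: (\tr (cplxmx B *m D)) => a2 b2 /= -> ->.
by move=> [<- _]; rewrite subrr.
Qed.

End MomentumMap.

(** * Lines as projectors *)

Section Projectors.
Variable R : realType.
Variable n : nat.
Implicit Types (A B P Q E : 'M[R]_n) (u v : 'cV[R]_n).

Definition dotv v : R := (v^T *m v) 0 0.
(** The projector [projmx], as a function of a spanning vector. *)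
Definition pr v : 'M[R]_n := (dotv v)^-1 *: (v *m v^T).

Lemma dotvE v : dotv v = \sum_i v i 0 ^+ 2.
Proof. by rewrite /dotv mxE; apply: eq_bigr => i _; rewrite mxE expr2. Qed.

Lemma sqn_cplx v : sqn (cplxmx v) = dotv v.
Proof. by rewrite dotvE; apply: eq_bigr => i _; rewrite mxE sqmodR. Qed.

Lemma dotv_gt0 v : v != 0 -> 0 < dotv v.
Proof. by rewrite -sqn_cplx sqn_gt0 /cplxmx map_mx_eq0. Qed.

Lemma prZ a v : a != 0 -> pr (a *: v) = pr v.
Proof.
move=> a0.
have e1 : (a *: v) *m (a *: v)^T = a ^+ 2 *: (v *m v^T).
  by rewrite linearZ -scalemxAl -scalemxAr scalerA expr2.
have e2 : dotv (a *: v) = a ^+ 2 * dotv v.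
  by rewrite !dotvE mulr_sumr; apply: eq_bigr => i _; rewrite mxE exprMn.
rewrite /pr e1 e2 scalerA; congr (_ *: _).
by rewrite invfM mulrAC mulVf ?mul1r // sqrf_eq0.
Qed.

Lemma line_vpick v : v != 0 -> exists2 a, a != 0 & vpick <[v]>%VS = a *: v.
Proof.
move=> v0; have /vlineP [a ea] := memv_pick <[v]>%VS.
exists a => //; apply: contraNneq v0 => a0.
by move: ea; rewrite a0 scale0r => /eqP; rewrite vpick0 => /eqP h; have := memv_line v; rewrite h memv0.
Qed.

Lemma projmx_line v : v != 0 -> projmx <[v]>%VS = pr v.
Proof. by move=> v0; have [a a0 e] := line_vpick v0; rewrite /projmx e -/(pr _) -/(dotv _) prZ. Qed.

Lemma act_line (F : fieldType) m (A : 'M[F]_m) (w : 'cV[F]_m) : act A <[w]>%VS = <[A *m w]>%VS.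
Proof. by rewrite /act limg_line lfunE. Qed.

Lemma projspace_line (F : fieldType) m (L : {vspace 'cV[F]_m}) : projspace L ->
  exists2 w, w != 0 & L = <[w]>%VS.
Proof.
move=> hL; exists (vpick L).
  by rewrite vpick0 -dimv_eq0 hL.
apply/eqP; rewrite eq_sym eqEdim -memvE memv_pick hL dim_vline.
by rewrite vpick0 -dimv_eq0 hL.
Qed.

Lemma line_projspace (F : fieldType) m (w : 'cV[F]_m) : w != 0 -> projspace <[w]>%VS.
Proof. by move=> w0; rewrite /projspace /= dim_vline w0. Qed.

Lemma cplxline_line v : cplxline <[v]>%VS = <[cplxmx v]>%VS.
Proof.
rewrite /cplxline; apply/eqP; rewrite eqEsubv; apply/andP; split.
  apply/span_subvP => _ /mapP [u /vbasis_mem /vlineP [a ->] ->].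
  by rewrite /cplxmx map_mxZ memvZ // memv_line.
rewrite -memvE; have vv := memv_line v.
have -> : cplxmx v = \sum_i (coord (vbasis <[v]>) i v)%:C *: cplxmx (vbasis <[v]>)`_i.
  rewrite {1}(coord_vbasis vv) /cplxmx map_mx_sum; apply: eq_bigr => i _.
  by rewrite map_mxZ.
apply: memv_suml => i _; apply: memvZ; apply: memv_span.
by apply/mapP; exists (vbasis <[v]>)`_i => //; rewrite -tnth_nth; exact: mem_tnth.
Qed.

Lemma pr_norm v : v != 0 -> `|pr v| <= 1.
Proof.
move=> v0; have d0 := dotv_gt0 v0; apply: mx_norm_le => // i j.
rewrite !mxE big_ord1 !mxE normrM ger0_norm ?invr_ge0 ?(ltW d0) //.
rewrite mulrC ler_pdivrMr // mul1r.
have le k : v k 0 ^+ 2 <= dotv v.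
  by rewrite dotvE (bigD1 k) //= lerDl sumr_ge0 // => l _; exact: sqr_ge0.
rewrite ler_norml; have := sqr_ge0 (v i 0 + v j 0); have := sqr_ge0 (v i 0 - v j 0).
have := le i; have := le j; move=> *; apply/andP; split; nra.
Qed.

Lemma tr_pr v : v != 0 -> \tr (pr v) = 1.
Proof.
move=> v0; rewrite /pr mxtraceZ mxtrace_mulC /mxtrace big_ord1 -/(dotv v) mulVf //.
by rewrite gt_eqF ?dotv_gt0.
Qed.

Lemma pr_mul A v : A \in unitmx -> v != 0 ->
  pr (A *m v) = (\tr (A *m pr v *m A^T))^-1 *: (A *m pr v *m A^T).
Proof.
move=> uA v0; have d0 := dotv_gt0 v0.
have -> : A *m pr v *m A^T = (dotv v)^-1 *: ((A *m v) *m (A *m v)^T).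
  by rewrite /pr -scalemxAr -scalemxAl trmx_mul !mulmxA.
rewrite mxtraceZ mxtrace_mulC /mxtrace big_ord1 -/(dotv (A *m v)) scalerA invfM invrK.
by rewrite mulrAC mulfV ?mul1r // gt_eqF.
Qed.

Lemma mxtrace_le A : `|\tr A| <= n%:R * `|A|.
Proof.
apply: le_trans (ler_norm_sum _ _ _) _.
have -> : n%:R * `|A| = \sum_(i < n) `|A| by rewrite sumr_const card_ord mulr_natl.
by apply: ler_sum => i _; exact: mx_entry_le.
Qed.

Lemma mxtrace_mul_le A B : `|\tr (A *m B)| <= n%:R ^+ 2 * (`|A| * `|B|).
Proof.
apply: le_trans (mxtrace_le _) _; rewrite expr2 -mulrA ler_wpM2l //; exact: mx_normM.
Qed.

(** The velocity at t = 0 of the projector onto the line spanned by exp(tB) v,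
    where P is the projector onto the line of v. *)
Definition vel B P : 'M[R]_n := B *m P + P *m B - (2 * \tr (B *m P)) *: P.

Lemma vel_norm B P (b : R) : `|P| <= 1 -> `|B| <= b ->
  `|vel B P| <= 2 * n%:R * b + 2 * n%:R ^+ 2 * b.
Proof.
move=> hP hB; have b0 : 0 <= b by apply: le_trans hB.
have h1 : `|B *m P| <= n%:R * b.
  apply: le_trans (mx_normM _ _) _; rewrite ler_wpM2l // -[X in _ <= X]mulr1; exact: ler_pM.
have h2 : `|P *m B| <= n%:R * b.
  apply: le_trans (mx_normM _ _) _; rewrite ler_wpM2l // -[X in _ <= X]mul1r; exact: ler_pM.
have h3 : `|(2 * \tr (B *m P)) *: P| <= 2 * (n%:R ^+ 2 * b).
  rewrite normrZ normrM ger0_norm // -mulrA ler_wpM2l //.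
  have h := mxtrace_mul_le B P.
  apply: le_trans (ler_pM _ _ h hP) _ => //; rewrite mulr1 ler_wpM2l ?sqr_ge0 //.
  by rewrite -[X in _ <= X]mulr1; exact: ler_pM.
apply: le_trans (ler_normB _ _) _; apply: le_trans (lerD (ler_normD _ _) (lexx _)) _; lra.
Qed.

Lemma scale_unsplit (q t : R) (A P W : 'M[R]_n) : q != 0 ->
  q^-1 *: A - P - t *: W = q^-1 *: (A - q *: (P + t *: W)).
Proof. by move=> q0; rewrite scalerBr scalerA mulVf // scale1r opprD addrA. Qed.

(** The projector onto the line of exp(tB) v is Q / tr Q with
    Q = exp(tB) P exp(tB) = P + t (BP + PB) + O(t^2) and
    tr Q = 1 + 2 t tr(BP) + O(t^2).  The Euler scheme is iterated, so the constants
    must be uniform: they depend on the bound b for B, and not on v. *)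
Lemma pr_step_bound (b : R) : 0 <= b -> exists C delta, [/\ 0 <= C, 0 < delta &
  forall v B t, v != 0 -> B^T = B -> `|B| <= b -> `|t| <= delta ->
   `|pr (expmx (t *: B) *m v) - pr v - t *: vel B (pr v)| <= C * t ^+ 2].
Proof.
move=> b0; pose N : R := n%:R; have N0 : 0 <= N by [].
pose r := 2 * (N * b) ^+ 2; have r0 : 0 <= r by rewrite mulr_ge0 ?sqr_ge0.
pose y := b + r; have y0 : 0 <= y by rewrite addr_ge0.
pose C2 := N * r + N * r + N * (N * (y * y)).
have C20 : 0 <= C2 by rewrite !addr_ge0 // !mulr_ge0.
pose w := 2 * N * b + 2 * N ^+ 2 * b.
have w0 : 0 <= w by rewrite addr_ge0 // !mulr_ge0 ?sqr_ge0.
pose C3 := C2 + 2 * (N ^+ 2 * b) * w + N * C2 * (1 + w).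
have NN : 0 <= N ^+ 2 by apply: sqr_ge0.
have C30 : 0 <= C3.
  by rewrite !addr_ge0 // !mulr_ge0 // addr_ge0.
have q1 : 0 < 2 * (N * b) + 1 by have := mulr_ge0 N0 b0; lra.
have q2 : 0 < 2 * (2 * (N ^+ 2 * b) + N * C2) + 1.
  by have := mulr_ge0 NN b0; have := mulr_ge0 N0 C20; lra.
pose delta := Num.min 1 (Num.min (2 * (N * b) + 1)^-1 (2 * (2 * (N ^+ 2 * b) + N * C2) + 1)^-1).
have d0 : 0 < delta by rewrite !lt_min ltr01 !invr_gt0 q1.
exists (2 * C3), delta; split => //; first by rewrite mulr_ge0.
move=> v B t v0 Bs hB; rewrite !le_min => /andP [t1 /andP [t2 t3]].
have a0 : 0 <= `|t| by [].
have tt : `|t| ^+ 2 = t ^+ 2 by rewrite real_normK ?num_real.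
have t2' : `|t| * (2 * (N * b) + 1) <= 1 by rewrite -ler_pdivlMr // div1r.
have t3' : `|t| * (2 * (2 * (N ^+ 2 * b) + N * C2) + 1) <= 1 by rewrite -ler_pdivlMr // div1r.
set P := pr v; have hP : `|P| <= 1 by exact: pr_norm.
pose X := expmx (t *: B); pose rho := X - 1%:M - t *: B.
have tb : n%:R * `|t *: B| <= `|t| * (N * b).
  by rewrite normrZ mulrCA ler_wpM2l // ler_wpM2l.
have hrho : `|rho| <= r * t ^+ 2.
  have := @expmx_quad R n (t *: B) => h; apply: le_trans (h _) _.
    by apply: le_trans tb _; lra.
  have -> : r * t ^+ 2 = 2 * (`|t| * (N * b)) ^+ 2 by rewrite /r exprMn -tt; ring.
  by rewrite ler_wpM2l // lerXn2r ?nnegrE ?mulr_ge0.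
pose Y := X - 1%:M.
have hY : `|Y| <= `|t| * y.
  have -> : Y = t *: B + rho by rewrite /rho addrC subrK.
  apply: le_trans (ler_normD _ _) _; rewrite normrZ mulrDr; apply: lerD.
    by rewrite ler_wpM2l.
  apply: le_trans hrho _; rewrite -tt expr2 mulrCA; rewrite ler_wpM2l //.
  by rewrite mulrC ler_piMl.
have XT : X^T = X by rewrite /X -expmx_tr linearZ /= Bs.
pose E := rho *m P + P *m rho + Y *m P *m Y.
have hE : `|E| <= C2 * t ^+ 2.
  apply: le_trans (ler_normD _ _) _; rewrite /C2 mulrDl; apply: lerD.
    apply: le_trans (ler_normD _ _) _; rewrite mulrDl; apply: lerD.
      apply: le_trans (mx_normM _ _) _; rewrite -mulrA ler_wpM2l // -[X in _ <= X]mulr1; exact: ler_pM.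
    apply: le_trans (mx_normM _ _) _; rewrite -mulrA ler_wpM2l // -[X in _ <= X]mul1r; exact: ler_pM.
  apply: le_trans (mx_normM _ _) _; rewrite -mulrA ler_wpM2l //.
  have -> : N * (y * y) * t ^+ 2 = (N * (`|t| * y)) * (`|t| * y) by rewrite -tt; ring.
  apply: ler_pM => //; apply: le_trans (mx_normM _ _) _; rewrite ler_wpM2l //.
  by rewrite -[X in _ <= X]mulr1; exact: ler_pM.
pose S := B *m P + P *m B.
have eQ : X *m P *m X^T = P + t *: S + E.
  rewrite XT; have -> : X = 1%:M + Y by rewrite /Y addrC subrK.
  have eY : Y = t *: B + rho by rewrite /rho addrC subrK.
  have e2 : Y *m P + P *m Y = t *: S + (rho *m P + P *m rho).
    by rewrite {1 2}eY mulmxDl mulmxDr -(scalemxAl t B P) -(scalemxAr t P B) addrACA -scalerDr.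
  transitivity (P + (Y *m P + P *m Y) + Y *m P *m Y); last by rewrite e2 /E !addrA.
  by rewrite mulmxDl mul1mx mulmxDr mulmx1 mulmxDl !addrA.
have uX : X \in unitmx by apply: expmx_unit.
have trS : \tr S = 2 * \tr (B *m P).
  by rewrite /S mxtraceD (mxtrace_mulC P) mulr2n mulrDl mul1r.
set tau := \tr (B *m P) in trS.
have htau : `|tau| <= N ^+ 2 * b.
  apply: le_trans (mxtrace_mul_le _ _) _; rewrite ler_wpM2l //.
  by rewrite -[X in _ <= X]mulr1; exact: ler_pM.
pose e := \tr E; have he : `|e| <= N * C2 * t ^+ 2.
  by apply: le_trans (mxtrace_le _) _; rewrite -mulrA ler_wpM2l.
have trQ : \tr (X *m P *m X^T) = 1 + 2 * t * tau + e.
  by rewrite eQ (mxtraceD _ E) (mxtraceD P) (tr_pr v0) (mxtraceZ t S) trS -/e; ring.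
set q := 1 + 2 * t * tau + e in trQ.
have hq : 1 / 2 <= q.
  have h1 : `|t * tau| <= `|t| * (N ^+ 2 * b) by rewrite normrM ler_wpM2l.
  have h2 : N * C2 * t ^+ 2 <= `|t| * (N * C2).
    rewrite -tt expr2 mulrA [X in _ <= X]mulrC ler_wpM2r // ler_piMr // mulr_ge0 //.
  move: h1 he; rewrite !ler_norml /q => /andP [h3 _] /andP [h4 _].
  have := t3'; lra.
have q0 : 0 < q by apply: lt_le_trans hq; lra.
rewrite pr_mul // -/P trQ eQ.
set W := vel B P; have hW : `|W| <= w by apply: vel_norm.
have WE : W = S - (2 * tau) *: P by [].
have -> : q^-1 *: (P + t *: S + E) - P - t *: W = q^-1 *: (E - (2 * tau * t ^+ 2) *: W - e *: (P + t *: W)).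
  have -> : q^-1 *: (P + t *: S + E) - P - t *: W = q^-1 *: (P + t *: S + E - q *: (P + t *: W)).
    by apply: scale_unsplit; rewrite gt_eqF.
  congr (_ *: _); apply/matrixP => i j; rewrite WE !mxE /q; ring.
rewrite normrZ gtr0_norm ?invr_gt0 //.
have hn : `|E - (2 * tau * t ^+ 2) *: W - e *: (P + t *: W)| <= C3 * t ^+ 2.
  apply: le_trans (ler_normB _ _) _; rewrite /C3 [X in _ <= X]mulrDl; apply: lerD.
    apply: le_trans (ler_normB _ _) _; rewrite [X in _ <= X]mulrDl; apply: lerD => //.
    have -> : 2 * (N ^+ 2 * b) * w * t ^+ 2 = (2 * (N ^+ 2 * b) * t ^+ 2) * w by ring.
    rewrite normrZ; apply: ler_pM => //.
    have -> : `|2 * tau * t ^+ 2| = 2 * `|tau| * t ^+ 2.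
      by rewrite normrM [`|2 * tau|]normrM [`|t ^+ 2|]ger0_norm ?sqr_ge0 // [`|2|]ger0_norm.
    by rewrite ler_wpM2r ?sqr_ge0 // ler_wpM2l.
  have -> : N * C2 * (1 + w) * t ^+ 2 = (N * C2 * t ^+ 2) * (1 + w) by ring.
  rewrite normrZ; apply: ler_pM => //.
  apply: le_trans (ler_normD _ _) _; apply: lerD => //.
  by rewrite normrZ -[X in _ <= X]mul1r; apply: ler_pM.
apply: le_trans (ler_wpM2l _ hn) _; first by rewrite invr_ge0 ltW.
have hq2 : q^-1 <= 2 by rewrite -[2]invrK lef_pV2 ?posrE ?invr_gt0 //; lra.
have -> : 2 * C3 * t ^+ 2 = 2 * (C3 * t ^+ 2) by ring.
by rewrite ler_wpM2r // mulr_ge0 ?sqr_ge0.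
Qed.

(** tr (B B) is the sum of the squares of the entries. *)
Lemma sym_entry_le (B : 'M[R]_n) : B^T = B -> `|B| ^+ 2 <= \tr (B *m B).
Proof.
move=> Bs.
have trE : \tr (B *m B) = \sum_i \sum_j B i j ^+ 2.
  apply: eq_bigr => i _; rewrite mxE; apply: eq_bigr => j _.
  by rewrite expr2 -{2}Bs mxE.
have tr0 : 0 <= \tr (B *m B).
  by rewrite trE; do 2!apply: sumr_ge0 => ? _; apply: sqr_ge0.
rewrite -[X in _ <= X](sqr_sqrtr tr0) lerXn2r ?nnegrE ?sqrtr_ge0 //.
apply: mx_norm_le => [|i j]; first exact: sqrtr_ge0.
rewrite -(sqrtr_sqr (B i j)) ler_sqrt // trE (bigD1 i) //= (bigD1 j) //= -addrA lerDl.
by rewrite addr_ge0 //; do ?[apply: sumr_ge0 => ? _]; rewrite ?sqr_ge0.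
Qed.

(** Each factor of the polynomial [vel] is replaced in turn. *)
Lemma vel_lip A B P Q (b : R) : `|A : 'M[R]_n| <= b -> `|B : 'M[R]_n| <= b ->
  `|P : 'M[R]_n| <= 1 -> `|Q : 'M[R]_n| <= 1 ->
  `|vel A P - vel B Q| <= (2 * n%:R + 2 * n%:R ^+ 2) * `|A - B|
     + (2 * n%:R * b + 4 * n%:R ^+ 2 * b) * `|P - Q|.
Proof.
move=> hA hB hP hQ; have b0 : 0 <= b by apply: le_trans hA.
have -> : vel A P - vel B Q = ((A - B) *m P + B *m (P - Q)) + (P *m (A - B) + (P - Q) *m B)
   - ((2 * (\tr ((A - B) *m P) + \tr (B *m (P - Q)))) *: P + (2 * \tr (B *m Q)) *: (P - Q)).
  rewrite /vel !mulmxBl !mulmxBr !raddfB /=.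
  move: (A *m P) (B *m P) (B *m Q) (P *m A) (P *m B) (Q *m B) => X1 X2 X3 X4 X5 X6.
  by apply/matrixP => i j; rewrite !mxE; ring.
set D := A - B; set E := P - Q.
have N0 : 0 <= (n%:R : R) by [].
have N2 : 0 <= (n%:R : R) ^+ 2 by rewrite sqr_ge0.
have h1 : `|D *m P| <= n%:R * `|D|.
  apply: le_trans (mx_normM _ _) _; rewrite ler_wpM2l // -[X in _ <= X]mulr1; exact: ler_pM.
have h2 : `|B *m E| <= n%:R * (b * `|E|).
  apply: le_trans (mx_normM _ _) _; rewrite ler_wpM2l //; exact: ler_pM.
have h3 : `|P *m D| <= n%:R * `|D|.
  apply: le_trans (mx_normM _ _) _; rewrite ler_wpM2l // -[X in _ <= X]mul1r; exact: ler_pM.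
have h4 : `|E *m B| <= n%:R * (b * `|E|).
  apply: le_trans (mx_normM _ _) _; rewrite ler_wpM2l // mulrC; exact: ler_pM.
have h5 : `|\tr (D *m P)| <= n%:R ^+ 2 * `|D|.
  apply: le_trans (mxtrace_mul_le _ _) _; rewrite ler_wpM2l // -[X in _ <= X]mulr1; exact: ler_pM.
have h6 : `|\tr (B *m E)| <= n%:R ^+ 2 * (b * `|E|).
  apply: le_trans (mxtrace_mul_le _ _) _; rewrite ler_wpM2l //; exact: ler_pM.
have h7 : `|\tr (B *m Q)| <= n%:R ^+ 2 * b.
  apply: le_trans (mxtrace_mul_le _ _) _; rewrite ler_wpM2l // -[X in _ <= X]mulr1; exact: ler_pM.
have h8 : `|(2 * (\tr (D *m P) + \tr (B *m E))) *: P| <= 2 * (n%:R ^+ 2 * `|D| + n%:R ^+ 2 * (b * `|E|)).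
  rewrite normrZ -[X in _ <= X]mulr1; apply: ler_pM => //.
  rewrite normrM ger0_norm // ler_wpM2l //; apply: le_trans (ler_normD _ _) _; exact: lerD.
have h9 : `|(2 * \tr (B *m Q)) *: E| <= 2 * (n%:R ^+ 2 * b) * `|E|.
  by rewrite normrZ ler_wpM2r // normrM ger0_norm // ler_wpM2l.
apply: le_trans (ler_normB _ _) _.
apply: le_trans (lerD (ler_normD _ _) (ler_normD _ _)) _.
apply: le_trans (lerD (lerD (ler_normD _ _) (ler_normD _ _)) (lexx _)) _.
apply: le_trans (lerD (lerD (lerD h1 h2) (lerD h3 h4)) (lerD h8 h9)) _.
by apply: le_of_eq; ring.
Qed.

End Projectors.

(** * Curves of matrices *)

Section MatrixCurves.
Variables (R : realType) (n : nat).

Lemma is_derive_entry (P : R -> 'M[R]_n) (t : R) L (i j : 'I_n) :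
  is_derive t 1 P L -> is_derive t 1 (fun s => P s i j : R) (L i j).
Proof.
move=> [dP vP]; apply: DeriveDef; first by move/derivable_mxP: dP; apply.
by have := derive_mx dP; rewrite vP => ->; rewrite mxE.
Qed.

(** The mean value theorem, entry by entry. *)
Lemma curve_step (P dP : R -> 'M[R]_n) L (a b M : R) : a <= b -> 0 <= M ->
  (forall t : R, is_derive t 1 P (dP t)) ->
  (forall t, a <= t <= b -> `|dP t - L| <= M) ->
  `|P b - P a - (b - a) *: L| <= M * (b - a).
Proof.
move=> ab M0 dPE hM; have ab0 : 0 <= b - a by rewrite subr_ge0.
apply: mx_norm_le => [|i j]; first exact: mulr_ge0.
pose f (s : R) : R := P s i j.
have df (t : R) : is_derive t 1 f (dP t i j) by exact: is_derive_entry.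
have cf : {within `[a, b], continuous f}.
  apply: continuous_subspaceT => t; apply: differentiable_continuous.
  by apply/derivable1_diffP; case: (df t).
have [s sab e] := MVT_segment ab (fun t _ => df t) cf.
rewrite !mxE -/(f b) -/(f a) e [_ * (b - a)]mulrC -mulrBr normrM ger0_norm // mulrC ler_wpM2r //.
have hs : a <= s <= b by rewrite in_itv in sab.
apply: le_trans (hM s hs).
by have := mx_entry_le (dP s - L) i j; rewrite !mxE.
Qed.

Lemma derive_of_quad (P : R -> 'M[R]_n) L (K delta : R) : 0 < delta ->
  (forall t, `|t| <= delta -> `|P t - P 0 - t *: L| <= K * t ^+ 2) ->
  derive1 P 0 = L.
Proof.
move=> d0 h; rewrite /derive1; apply/cvg_lim => //.
apply/cvgrPdist_le => e e0.
near=> t.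
have t0 : t != 0 by near: t; exact: nbhs_dnbhs_neq.
have td : `|t| <= delta by near: t; apply: dnbhs0_le.
have tK : `|t| * (`|K| + 1) <= e.
  rewrite -ler_pdivlMr ?ltr_wpDl //; near: t; apply: dnbhs0_le.
  by rewrite divr_gt0 // ltr_wpDl.
rewrite addr0.
have -> : L - t^-1 *: (P t - P 0) = - (t^-1 *: (P t - P 0 - t *: L)).
  by rewrite (scalerBr _ _ (t *: L)) scalerA mulVf // scale1r opprB.
rewrite normrN normrZ normfV ler_pdivrMl ?normr_gt0 //.
apply: le_trans (h t td) _; apply: le_trans (_ : `|t| * (`|t| * (`|K| + 1)) <= _); last by rewrite ler_wpM2l.
rewrite mulrA -expr2 real_normK ?num_real // mulrC ler_wpM2l ?sqr_ge0 //.
by have := ler_norm K; lra.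
Unshelve. all: by end_near.
Qed.

End MatrixCurves.

(** * Gradient descent *)

Section GradientFlow.
Variable R : realType.
Local Notation C := R[i].
Variable n : nat.
Variables (G : set 'M[R]_n) (g : {vspace 'M[R]_n}) (c : R).
Variable mup : {vspace 'cV[C]_n} -> 'M[R]_n.
Hypothesis c0 : 0 < c.
Hypothesis G_1 : G 1%:M.
Hypothesis G_mulH : forall A B, G A -> G B -> G (A *m B).
Hypothesis G_expH : forall A : 'M[R]_n, A \in g -> G (expmx A).
Hypothesis G_normC : forall P, G P -> normC g (cplxmx P).
Hypothesis polarH : forall (h V : 'M[C]_n) (d : 'I_n -> R), normC g h ->
  V \is unitarymx -> (forall i, 0 < d i) -> h^t* *m h = udg V d ->
  gC g (udg V (fun i => ln (d i))).
Hypothesis mup_pH : forall z, z != 0 -> ppart g (mup <[z]>%VS).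
Hypothesis mup_pairH : forall z B, z != 0 -> ppart g B ->
  c * \tr (mup <[z]>%VS *m B) * sqn z = hqr (cplxmx B) z.

(** mu_p at the real line spanned by v. *)
Definition gradmap (v : 'cV[R]_n) : 'M[R]_n := mup <[cplxmx v]>%VS.
Definition gradnorm (v : 'cV[R]_n) : R := Num.sqrt (\tr (gradmap v *m gradmap v)).

Lemma cplxcol_neq0 (v : 'cV[R]_n) : v != 0 -> cplxmx v != 0.
Proof. by move=> v0; rewrite /cplxmx map_mx_eq0. Qed.

(** The pairing of mu_p(v) with itself is on the one hand c F^2, on the other a
    mean of its eigenvalues, which are at most F; hence F <= 1 / c. *)
Lemma grad_spectral (v : 'cV[R]_n) : v != 0 -> exists (U : 'M[C]_n) b,
  [/\ U \is unitarymx, cplxmx (gradmap v) = udg U b, \sum_i b i ^+ 2 = gradnorm v ^+ 2,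
     (forall i, `|b i| <= gradnorm v) & (gradnorm v <= c^-1 /\
     hqr (udg U b) (cplxmx v) / sqn (cplxmx v) = c * gradnorm v ^+ 2)].
Proof.
move=> v0; have z0 := cplxcol_neq0 v0; have pg := mup_pH z0; have [_ Bs _] := pg.
have [U [b [hU eB]]] := sym_spectral Bs.
have trb : \tr (gradmap v *m gradmap v) = \sum_i b i ^+ 2.
  apply: complexI; rewrite -mxtrace_cplx cplxmxM [cplxmx (gradmap v)]eB (udgM _ _ hU).
  by rewrite (mxtrace_udg _ hU).
have F2 : \sum_i b i ^+ 2 = gradnorm v ^+ 2.
  rewrite /gradnorm sqr_sqrtr trb // sumr_ge0 // => i _; exact: sqr_ge0.
have F0 : 0 <= gradnorm v by apply: sqrtr_ge0.
have hb i : `|b i| <= gradnorm v by apply: sum_sq_entry; rewrite ?F2.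
have hq : hqr (udg U b) (cplxmx v) / sqn (cplxmx v) = c * gradnorm v ^+ 2.
  rewrite -eB -(mup_pairH z0 pg) mulfK ?sqn_eq0 //.
  by rewrite -/(gradmap v) trb F2.
exists U, b; split => //; split => //.
have [F00|F00] := eqVneq (gradnorm v) 0; first by rewrite F00 invr_ge0 ltW.
have F1 : 0 < gradnorm v by rewrite lt_def F00.
suff : c * gradnorm v ^+ 2 <= gradnorm v.
  rewrite expr2 mulrA -[X in _ <= X]mul1r ler_pM2r // => h.
  by rewrite -[c^-1]mul1r ler_pdivlMr // mulrC.
rewrite -hq -hqr_normalised hqr_udg.
have u1 := sqn_normalised z0.
have -> : gradnorm v = \sum_i gradnorm v * sqmod ((U^t* *m normalised (cplxmx v)) i 0).
  by rewrite -mulr_sumr (sum_sqmod_unitary _ hU) u1 mulr1.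
apply: ler_sum => i _; rewrite ler_wpM2r ?sqmod_ge0 //.
exact: le_trans (ler_norm _) (hb i).
Qed.

Lemma gradnorm_ge0 v : 0 <= gradnorm v. Proof. exact: sqrtr_ge0. Qed.

Definition gstep (eps : R) (v : 'cV[R]_n) : 'M[R]_n := expmx ((- eps) *: gradmap v).

Lemma small_step (eps b : R) : 0 < eps -> eps <= c / 4 -> `|b| <= c^-1 ->
  `|2 * eps * b| <= 1 / 2.
Proof.
move=> e0 ec hb; rewrite normrM gtr0_norm ?mulr_gt0 //.
apply: (@le_trans _ _ (2 * (c / 4) * c^-1)).
  by apply: ler_pM; rewrite ?mulr_ge0 ?(ltW e0) ?ler_wpM2l.
by apply: le_of_eq; field; rewrite gt_eqF.
Qed.

(** To first order |v|^2 is multiplied by 1 - 2 eps <mu_p(v) v, v> / |v|^2, and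
    this Rayleigh quotient is c F^2. *)
Lemma gstep_decrease eps (v : 'cV[R]_n) : v != 0 -> 0 < eps -> eps <= c / 4 ->
  ln (sqn (cplxmx (gstep eps v *m v))) <=
  ln (sqn (cplxmx v)) - 2 * eps * (c - 4 * eps) * gradnorm v ^+ 2.
Proof.
move=> v0 e0 ec; have z0 := cplxcol_neq0 v0; have [_ Bs _] := mup_pH z0.
have [U [b [hU eB F2 hb [Fc hq]]]] := grad_spectral v0.
have eE := exp_gram eps hU Bs eB.
have small i := small_step e0 ec (le_trans (hb i) Fc).
have := sqn_exp_le hU eE small (sqn_normalised z0).
rewrite hqr_normalised hq F2 sqn_mul_normalised -cplxmxM -/(gstep eps v).
have w0 : gstep eps v *m v != 0 by apply: contraNneq v0 => e; rewrite -[v](mulKmx (expmx_unit ((- eps) *: gradmap v))) e mulmx0.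
have sz : 0 < sqn (cplxmx v) by rewrite sqn_gt0.
have sw : 0 < sqn (cplxmx (gstep eps v *m v)) by rewrite sqn_gt0 cplxcol_neq0.
move=> h; have := ln_le_sub1 (divr_gt0 sw sz); rewrite ln_div ?posrE //.
set x := sqn _ / sqn _ in h *; lra.
Qed.

Lemma gstep_diagbound (e : 'I_n -> R) s eps (v : 'cV[R]_n) : v != 0 -> 0 <= s -> 0 < eps ->
  eps <= c / 4 -> \sum_i e i ^+ 2 <= s ^+ 2 ->
  diagbound e (cplxmx (gstep eps v))
   (s * (2 * eps * gradnorm v + 8 * n%:R * eps ^+ 2 * gradnorm v ^+ 2)).
Proof.
move=> v0 s0 e0 ec he; have z0 := cplxcol_neq0 v0; have [_ Bs _] := mup_pH z0.
have [U [b [hU eB F2 hb [Fc hq]]]] := grad_spectral v0.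
apply: (diagbound_step s0 (ltW e0) (gradnorm_ge0 v) he F2 hU (exp_gram eps hU Bs eB)) => i.
exact: small_step e0 ec (le_trans (hb i) Fc).
Qed.

(** The group elements y_j of the Euler scheme, so that the j-th iterate of v is
    y_j v. *)
Fixpoint descent (eps : R) (v : 'cV[R]_n) (j : nat) : 'M[R]_n :=
  if j is j'.+1 then gstep eps (descent eps v j' *m v) *m descent eps v j' else 1%:M.

Lemma G_neq0 P (v : 'cV[R]_n) : G P -> v != 0 -> P *m v != 0.
Proof.
move=> GP v0; have uP := normC_unit (G_normC GP).
have : cplxmx (P *m v) != 0 by rewrite cplxmxM mulmx_neq0 // cplxcol_neq0.
by apply: contraNneq => ->; rewrite /cplxmx map_mx0.
Qed.

Lemma descent_G eps (v : 'cV[R]_n) j : v != 0 -> G (descent eps v j).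
Proof.
move=> v0; elim: j => [//|j IH] /=; apply: G_mulH => //; apply: G_expH.
by apply: memvZ; have [] := mup_pH (cplxcol_neq0 (G_neq0 IH v0)).
Qed.

(** The property that defines xi = i mu at the line of z, on all of i u. *)
Definition momentum_pairing (xi : 'M[C]_n) (z : 'cV[C]_n) := forall X, gC g X -> X^t* = X ->
  c * complex.Re (\tr (xi *m X)) * sqn z = hqr X z.

(** The central estimate: an upper bound for ln |y_N v|^2 from the
    decrease in each step, and a lower bound from Jensen's inequality and the
    triangle inequality of [sing_bound]. *)
Lemma descent_bound (v : 'cV[R]_n) (h xi : 'M[C]_n) s : v != 0 -> normC g h ->
  xi^t* = xi -> 0 <= s -> frob2 xi = s ^+ 2 ->
  momentum_pairing xi (h *m cplxmx v) ->
  exists A, forall eps N, 0 < eps -> eps <= c / 4 ->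
    eps * (c - 4 * eps) * (\sum_(j < N) gradnorm (descent eps v j *m v) ^+ 2) <=
    A + (c * s + 4 * n%:R * s * eps) * (eps * \sum_(j < N) gradnorm (descent eps v j *m v)).
Proof.
move=> v0 Nh xiH s0 xis pair; have z0 := cplxcol_neq0 v0.
have uh := normC_unit Nh; have w0 := mulmx_neq0 uh z0.
set w := h *m cplxmx v in pair w0 *.
pose a := n%:R * (frob2 (invmx h) + frob2 (invmx (invmx h))).
exists ((ln (sqn (cplxmx v)) - ln (sqn w) + c * (s * a)) / 2) => eps N e0 ec.
pose y j := descent eps v j; pose F j := gradnorm (y j *m v).
rewrite -/(F _).
have yv j : y j *m v != 0 by apply: G_neq0 => //; exact: descent_G.
have F0 j : 0 <= F j by exact: gradnorm_ge0.
have Fc j : F j <= c^-1 by have [? [? [_ _ _ _ []]]] := grad_spectral (yv j).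
have up : ln (sqn (cplxmx (y N *m v))) <=
    ln (sqn (cplxmx v)) - 2 * eps * (c - 4 * eps) * \sum_(j < N) F j ^+ 2.
  elim: (N) => [|M IH]; first by rewrite big_ord0 mulr0 subr0 /y /= mul1mx.
  rewrite big_ord_recr /= mulrDr.
  have := gstep_decrease (yv M) e0 ec; rewrite mulmxA -/(F M); rewrite -[gstep _ _ *m y M]/(y M.+1).
  by lra.
pose M j : 'M[C]_n := cplxmx (y j) *m invmx h.
pose E j : 'M[C]_n := if j is j'.+1 then cplxmx (gstep eps (y j' *m v)) else invmx h.
pose b j : R := if j is j'.+1 then s * (2 * eps * F j' + 8 * n%:R * eps ^+ 2 * F j' ^+ 2) else s * a.
have NM : normC g (M N) by apply: normC_mul; [apply: G_normC; exact: descent_G|exact: normC_inv].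
have [V [d [hV d0 eM]]] := gram_pos (normC_unit NM).
set X := udg V (fun i => ln (d i)).
have gX : gC g X by apply: polarH eM.
have hX : X^t* = X by apply: adj_udg.
have uw := sqn_normalised w0.
(* M maps w to y_N v *)
have low : hqr X w / sqn w <= ln (sqn (cplxmx (y N *m v))) - ln (sqn w).
  rewrite -hqr_normalised; apply: le_trans (jensen_gram hV d0 eM uw) _.
  have eMw : M N *m w = cplxmx (y N *m v) by rewrite /M /w -mulmxA (mulKmx uh) cplxmxM.
  by rewrite sqn_mul_normalised eMw ln_div ?posrE ?sqn_gt0 // cplxcol_neq0.
have pX : hqr X w / sqn w = c * \sum_i ln (d i) * hqr xi (col i V).
  rewrite -pair // mulfK ?sqn_eq0 //; congr (_ * _).
  exact: (trace_hqr hV (erefl X)).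
pose e i := hqr xi (col i V).
have he : \sum_i e i ^+ 2 <= s ^+ 2 by rewrite -xis; exact: sum_hqr_frob.
(* M is the product of h^-1 and the N steps of the scheme *)
have tri : - \sum_i e i * ln (d i) <= \sum_(j < N.+1) b j.
  apply: (@sing_bound R n e E M b V d N) => //.
  - by rewrite /M /= cplxmx1 mul1mx.
  - by move=> j; rewrite /M /= cplxmxM mulmxA.
  - case=> [|j]; first by apply: diagbound_first => //; rewrite unitmx_inv.
    exact: gstep_diagbound.
have sb : \sum_(j < N.+1) b j <= s * a + s * ((2 * eps + 8 * n%:R * eps ^+ 2 / c) * \sum_(j < N) F j).
  rewrite big_ord_recl /= lerD2l [X in _ <= s * X]mulr_sumr mulr_sumr.
  apply: ler_sum => j _; rewrite ler_wpM2l // add0n [X in _ <= X]mulrDl lerD2l.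
  have q0 : 0 <= 8 * n%:R * eps ^+ 2 by rewrite mulr_ge0 ?sqr_ge0 // mulr_ge0 ?ler0n.
  by have := ler_wpM2l q0 (ler_wpM2r (F0 j) (Fc j)); rewrite -expr2 [X in _ <= X]mulrA.
have csum : c * - \sum_i e i * ln (d i) <=
    c * (s * a) + (2 * c * s + 8 * n%:R * s * eps) * (eps * \sum_(j < N) F j).
  apply: le_trans (ler_wpM2l (ltW c0) (le_trans tri sb)) _.
  apply: le_of_eq; field; by rewrite gt_eqF.
have comm : \sum_i ln (d i) * hqr xi (col i V) = \sum_i e i * ln (d i).
  by apply: eq_bigr => i _; rewrite mulrC.
move: low up csum; rewrite pX comm.
set S1 := \sum_(j < N) F j; set S2 := \sum_(j < N) F j ^+ 2; set Q := \sum_i _.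
set L := ln (sqn (cplxmx (y N *m v))); set L0 := ln (sqn (cplxmx v)); set Lw := ln (sqn w).
lra.
Qed.

Lemma gradnorm_le v : v != 0 -> gradnorm v <= c^-1.
Proof. by move=> v0; have [? [? [_ _ _ _ []]]] := grad_spectral v0. Qed.

(** [descent_bound] and [limit_ineq], all the F_k being at least m. *)
Lemma orbit_inf_le v h xi s m : v != 0 -> normC g h -> xi^t* = xi -> 0 <= s ->
  frob2 xi = s ^+ 2 -> momentum_pairing xi (h *m cplxmx v) ->
  (forall A, G A -> m <= gradnorm (A *m v)) -> m <= s.
Proof.
move=> v0 Nh xiH s0 xis pair hm; have [m0|m0] := leP m 0; first exact: le_trans s0.
have [A bd] := descent_bound v0 Nh xiH s0 xis pair.
have dG e j : G (descent e v j) by apply: descent_G.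
apply: (@limit_ineq R c s A m (4 * n%:R * s) 0 c0 s0) => // [|e0 T e00].
  by rewrite !mulr_ge0.
pose e := Num.min e0 (c / 4).
have ep : 0 < e by rewrite lt_min e00 divr_gt0.
have : e <= e by []; rewrite {2}/e le_min => /andP [ee0 ec].
exists e, (fun k => gradnorm (descent e v k *m v)), (Num.trunc (`|T| / e)).+1, 0%N.
split; first by rewrite ep.
- have Te : 0 <= `|T| / e by rewrite divr_ge0 // ltW.
  have /andP [_] := truncn_itv Te; rewrite ltr_pdivrMr // mulrC => /ltW h1.
  exact: le_trans (ler_norm T) h1.
- by rewrite mulr0.
- split=> k; last by move=> _ _; apply: hm.
  by rewrite gradnorm_ge0 gradnorm_le // G_neq0.
exact: bd.
Qed.

Lemma grad_p v : v != 0 -> ppart g (gradmap v).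
Proof. by move=> v0; apply: mup_pH; exact: cplxcol_neq0. Qed.

Lemma grad_sym v : v != 0 -> (gradmap v)^T = gradmap v.
Proof. by move=> /grad_p []. Qed.

Lemma gradnorm_sq v : v != 0 -> gradnorm v ^+ 2 = \tr (gradmap v *m gradmap v).
Proof.
move=> v0; rewrite sqr_sqrtr //; apply: le_trans (sym_entry_le (grad_sym v0)).
exact: sqr_ge0.
Qed.

Lemma grad_norm v : v != 0 -> `|gradmap v| <= c^-1.
Proof.
move=> v0; apply: le_trans (gradnorm_le v0); rewrite -(ler_pXn2r (n := 2)) ?nnegrE ?gradnorm_ge0 //.
rewrite gradnorm_sq //; exact: sym_entry_le (grad_sym v0).
Qed.

(** The defining property of the gradient map, in terms of the projector of v. *)
Lemma grad_pair v B : v != 0 -> ppart g B -> c * \tr (gradmap v *m B) = \tr (pr v *m B).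
Proof.
move=> v0 pB; have z0 := cplxcol_neq0 v0.
have ev : (cplxmx v)^t* = cplxmx v^T by rewrite -cplxmx_adj.
have eq1 : hqr (cplxmx B) (cplxmx v) = (v^T *m B *m v) 0 0.
  by rewrite /hqr /hq ev -!cplxmxM mxE.
have d0 := dotv_gt0 v0.
have := mup_pairH z0 pB; rewrite eq1 sqn_cplx => h.
have -> : \tr (pr v *m B) = (dotv v)^-1 * (v^T *m B *m v) 0 0.
  by rewrite /pr -scalemxAl mxtraceZ -mulmxA mxtrace_mulC /mxtrace big_ord1.
by rewrite -h [RHS]mulrC mulfK ?gt_eqF.
Qed.

(** [grad_pair] at B = mu_p(u) - mu_p(v), which is an element of p. *)
Lemma grad_lip u v : u != 0 -> v != 0 ->
  `|gradmap u - gradmap v| <= n%:R ^+ 2 / c * `|pr u - pr v|.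
Proof.
move=> u0 v0; set D := gradmap u - gradmap v.
have [gu su tu] := grad_p u0; have [gv sv tv] := grad_p v0.
have pD : ppart g D.
  split; first exact: memvB.
    by rewrite /D linearB /= su sv.
  by rewrite /D raddfB /= tu tv subrr.
have e : c * \tr (D *m D) = \tr ((pr u - pr v) *m D).
  rewrite {1}/D (mulmxBl (gradmap u) (gradmap v) D) (mulmxBl (pr u) (pr v) D).
  rewrite (raddfB _ (gradmap u *m D)) (raddfB _ (pr u *m D)) /= mulrBr.
  by rewrite (grad_pair u0 pD) (grad_pair v0 pD).
have [->|D0] := eqVneq D 0; first by rewrite normr0 mulr_ge0 // divr_ge0 ?sqr_ge0 // ltW.
have Dp : 0 < `|D| by rewrite normr_gt0.
rewrite mulrAC ler_pdivlMr // -(ler_pM2r Dp).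
have [_ sD _] := pD; have h := ler_wpM2l (ltW c0) (sym_entry_le sD).
rewrite e in h; apply: le_trans (_ : c * `|D| ^+ 2 <= _); first by apply: le_of_eq; ring.
apply: le_trans h _; rewrite -mulrA; exact: le_trans (ler_norm _) (mxtrace_mul_le _ _).
Qed.

Lemma gradnorm_lip u v : u != 0 -> v != 0 ->
  `|gradnorm u ^+ 2 - gradnorm v ^+ 2| <= 2 * n%:R ^+ 4 / c ^+ 2 * `|pr u - pr v|.
Proof.
move=> u0 v0; rewrite !gradnorm_sq //.
set A := gradmap u; set B := gradmap v.
have -> : \tr (A *m A) - \tr (B *m B) = \tr ((A - B) *m A) + \tr (B *m (A - B)).
  by rewrite mulmxBl mulmxBr !raddfB /= addrA subrK.
have lip := grad_lip u0 v0; rewrite -/A -/B in lip.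
have hA : `|A| <= c^-1 by exact: grad_norm.
have hB : `|B| <= c^-1 by exact: grad_norm.
have N0 : 0 <= (n%:R : R) ^+ 2 by rewrite sqr_ge0.
apply: le_trans (ler_normD _ _) _.
have -> : 2 * n%:R ^+ 4 / c ^+ 2 * `|pr u - pr v| =
   n%:R ^+ 2 * ((n%:R ^+ 2 / c * `|pr u - pr v|) * c^-1) +
   n%:R ^+ 2 * (c^-1 * (n%:R ^+ 2 / c * `|pr u - pr v|)).
  by field; rewrite gt_eqF.
apply: lerD; apply: le_trans (mxtrace_mul_le _ _) _; rewrite ler_wpM2l //; exact: ler_pM.
Qed.

(** The gradient of nu_p, up to the normalisation of the metric, as a velocity of
    projectors. *)
Definition gradfield v := vel (gradmap v) (pr v).

Definition field_sup : R := 2 * n%:R * c^-1 + 2 * n%:R ^+ 2 * c^-1.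

Lemma field_norm v : v != 0 -> `|gradfield v| <= field_sup.
Proof. by move=> v0; apply: vel_norm; [exact: pr_norm|exact: grad_norm]. Qed.

Lemma field_sup_ge0 : 0 <= field_sup.
Proof. by rewrite addr_ge0 // !mulr_ge0 ?sqr_ge0 ?invr_ge0 // ltW. Qed.

Definition field_lipschitz : R := (2 * n%:R + 2 * n%:R ^+ 2) * (n%:R ^+ 2 / c)
     + (2 * n%:R * c^-1 + 4 * n%:R ^+ 2 * c^-1).

Lemma field_lipschitz_ge0 : 0 <= field_lipschitz.
Proof. by rewrite addr_ge0 ?mulr_ge0 ?addr_ge0 ?mulr_ge0 ?sqr_ge0 ?invr_ge0 // ltW. Qed.

Lemma field_lip u v : u != 0 -> v != 0 ->
  `|gradfield u - gradfield v| <= field_lipschitz * `|pr u - pr v|.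
Proof.
move=> u0 v0; apply: le_trans (vel_lip (grad_norm u0) (grad_norm v0) (pr_norm u0) (pr_norm v0)) _.
by rewrite /field_lipschitz [X in _ <= X]mulrDl lerD2r -mulrA ler_wpM2l ?grad_lip //.
Qed.

Lemma fundfield_line (B : 'M[R]_n) (v : 'cV[R]_n) : v != 0 -> B^T = B ->
  fundfield B <[v]>%VS = vel B (pr v).
Proof.
move=> v0 Bs; have [K [delta [K0 d0 h]]] := @pr_step_bound R n `|B| (normr_ge0 B).
have e t : projmx (act (expmx (t *: B)) <[v]>%VS) = pr (expmx (t *: B) *m v).
  rewrite act_line projmx_line //.
  by apply: contraNneq v0 => e; rewrite -[v](mulKmx (expmx_unit (t *: B))) e mulmx0.
apply: (derive_of_quad (K := K) d0) => t td.
by rewrite !e scale0r expmx0 mul1mx; apply: h.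
Qed.

Lemma flow_line_lift x0 (x : R -> {vspace 'cV[R]_n}) :
  neg_flow_line (fun y => mup (cplxline y)) x0 x -> exists v : R -> 'cV[R]_n,
  [/\ (forall t, v t != 0), (forall t, x t = <[v t]>%VS) &
      forall t : R, is_derive t 1 (fun s => pr (v s)) (- gradfield (v t))].
Proof.
move=> [_ px dx]; exists (fun t => vpick (x t)).
have v0 t : vpick (x t) != 0.
  by have [w w0 ->] := projspace_line (px t); rewrite vpick0 -dimv_eq0 dim_vline w0.
have ex t : x t = <[vpick (x t)]>%VS.
  apply/eqP; rewrite eq_sym eqEdim -memvE memv_pick (px t) dim_vline.
  by rewrite v0.
split => // t; have := dx t.
have -> : @projmx R n \o x = (fun s => pr (vpick (x s))).
  by apply: funext => s /=; rewrite {1}ex projmx_line.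
have -> // : fundfield (mup (cplxline (x t))) (x t) = gradfield (vpick (x t)).
rewrite {1 2}ex cplxline_line fundfield_line //.
exact: (grad_sym (v0 t)).
Qed.

Section FlowLine.
Variable v : R -> 'cV[R]_n.
Hypothesis v0 : forall t, v t != 0.
Hypothesis dv : forall t : R, is_derive t 1 (fun s => pr (v s)) (- gradfield (v t)).

Lemma flow_lip s t : s <= t -> `|pr (v t) - pr (v s)| <= field_sup * (t - s).
Proof.
move=> st; have W0 := field_sup_ge0.
have := curve_step (L := 0) st W0 dv; rewrite scaler0 subr0; apply => u _.
by rewrite subr0 normrN; apply: (field_norm).
Qed.

(** The derivative of the flow moves by at most [field_lipschitz] times the
    distance travelled, and the speed is at most [field_sup]. *)
Lemma flow_step t e : 0 <= e ->
  `|pr (v (t + e)) - pr (v t) + e *: gradfield (v t)| <= field_lipschitz * field_sup * e ^+ 2.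
Proof.
move=> e0; have te : t <= t + e by rewrite lerDl.
have W0 := field_sup_ge0; have L0 := field_lipschitz_ge0.
have M0 : 0 <= field_lipschitz * (field_sup * e) by rewrite !mulr_ge0.
have := curve_step (L := - gradfield (v t)) te M0 dv.
have -> : t + e - t = e by rewrite addrC addKr.
rewrite scalerN (opprK (e *: gradfield (v t))) => h.
have -> : field_lipschitz * field_sup * e ^+ 2 = field_lipschitz * (field_sup * e) * e by rewrite expr2 !mulrA.
apply: h => u /andP [tu ue].
have -> : - gradfield (v u) - - gradfield (v t) = - (gradfield (v u) - gradfield (v t)) by rewrite (opprK (gradfield (v t))) (opprB (gradfield (v u))) addrC.
rewrite normrN.
apply: le_trans (field_lip (v0 _) (v0 _)) _.
rewrite ler_wpM2l //; apply: le_trans (flow_lip tu) _.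
by rewrite ler_wpM2l // lerBlDl.
Qed.

(** Discrete Gronwall inequality: the error of one step is O(e^2), and previous
    errors are multiplied by at most 1 + [field_lipschitz] e. *)
Lemma euler_error : exists K delta, [/\ 0 <= K, 0 < delta &
  forall e k, 0 < e -> e <= delta ->
    `|pr (descent e (v 0) k *m v 0) - pr (v (e * k%:R))|
      <= expR (field_lipschitz * (e * k%:R)) * (K * (e * k%:R)) * e].
Proof.
have ci0 : 0 <= c^-1 by rewrite invr_ge0 ltW.
have [K1 [delta [K10 d0 h]]] := @pr_step_bound R n c^-1 ci0.
have W0 := field_sup_ge0; have L0 := field_lipschitz_ge0.
pose K := K1 + field_lipschitz * field_sup; have K0 : 0 <= K by rewrite addr_ge0 ?mulr_ge0.
exists K, delta; split => // e k e0 ed.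
pose y j := descent e (v 0) j *m v 0.
have y0 j : y j != 0.
  by apply: G_neq0 => //; apply: descent_G.
pose q := 1 + field_lipschitz * e; have q1 : 1 <= q by rewrite lerDl mulr_ge0 // ltW.
have rec j : `|pr (y j.+1) - pr (v (e * j.+1%:R))|
    <= q * `|pr (y j) - pr (v (e * j%:R))| + K * e ^+ 2.
  have te : e * j.+1%:R = e * j%:R + e by rewrite -natr1 mulrDr mulr1.
  have ty : y j.+1 = expmx ((- e) *: gradmap (y j)) *m y j.
    exact: esym (mulmxA _ _ _).
  set t := e * j%:R in te *.
  have h1 : `|pr (y j.+1) - pr (y j) + e *: gradfield (y j)| <= K1 * e ^+ 2.
    have -> : e *: gradfield (y j) = - ((- e) *: gradfield (y j)) by rewrite scaleNr (opprK (e *: _)).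
    rewrite ty -(sqrrN e); apply: h => //; last by rewrite normrN gtr0_norm.
      exact: (grad_sym (y0 j)).
    exact: (grad_norm (y0 j)).
  have h2 := flow_step t (ltW e0).
  have h3 := field_lip (y0 j) (v0 t).
  rewrite te.
  have -> : pr (y j.+1) - pr (v (t + e)) =
     (pr (y j.+1) - pr (y j) + e *: gradfield (y j)) - (pr (v (t + e)) - pr (v t) + e *: gradfield (v t))
     + (pr (y j) - pr (v t)) - e *: (gradfield (y j) - gradfield (v t)).
    by apply/matrixP => a b; rewrite !mxE; ring.
  apply: le_trans (ler_normB _ _) _; rewrite normrZ gtr0_norm //.
  apply: le_trans (lerD (le_trans (ler_normD _ _) (lerD (le_trans (ler_normB _ _) (lerD h1 h2)) (lexx _))) (ler_wpM2l (ltW e0) h3)) _.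
  by apply: le_of_eq; rewrite /q /K; ring.
have bound : `|pr (y k) - pr (v (e * k%:R))| <= q ^+ k * (K * (e ^+ 2 * k%:R)).
  elim: k => [|k IH]; first by rewrite /y /= mul1mx mulr0 subrr normr0 !mulr0.
  apply: le_trans (rec k) _.
  have q0 : 0 <= q by apply: le_trans q1.
  apply: le_trans (lerD (ler_wpM2l q0 IH) (lexx _)) _.
  rewrite mulrA -exprS -natr1 mulrDr mulr1 mulrDr [X in _ <= X]mulrDr lerD2l.
  by apply: ler_peMl; [rewrite mulr_ge0 ?sqr_ge0|exact: exprn_ege1].
apply: le_trans bound _.
have -> : expR (field_lipschitz * (e * k%:R)) * (K * (e * k%:R)) * e = expR (field_lipschitz * (e * k%:R)) * (K * (e ^+ 2 * k%:R)) by ring.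
apply: ler_wpM2r; first by rewrite mulr_ge0 // mulr_ge0 // sqr_ge0.
rewrite [field_lipschitz * _]mulrA expRM_natr lerXn2r ?nnegrE ?expR_ge0 //; first exact: le_trans q1.
exact: expR_ge1Dx.
Qed.

(** The step size e may be chosen after the time T, so it can compensate the
    exponential growth in T of the constant of [euler_error]. *)
Lemma flow_approx (P : 'M[R]_n) : pr (v t) @[t --> +oo%R] --> P ->
  forall rho, 0 < rho -> exists2 t0, 0 <= t0 & forall e0 T, 0 < e0 ->
  exists e N k0, [/\ 0 < e <= e0, T <= e * N%:R, e * k0%:R <= t0, (k0 < N)%N &
    forall k, (k0 <= k)%N -> (k < N)%N -> `|pr (descent e (v 0) k *m v 0) - P| <= rho].
Proof.
move=> /cvgrPdist_le lim rho r0; have r2 : 0 < rho / 2 by rewrite divr_gt0.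
have [M [_ hM]] := lim _ r2.
pose t1 := `|M| + 1; have t10 : 0 <= t1 by rewrite addr_ge0.
have ht1 t : t1 <= t -> `|pr (v t) - P| <= rho / 2.
  by move=> tt; rewrite distrC; apply: hM; have := ler_norm M; rewrite /t1 in tt; lra.
have [K [delta [K0 d0 err]]] := euler_error.
have L0 := field_lipschitz_ge0.
exists (t1 + 1) => [|e0 T e00]; first by rewrite addr_ge0.
pose T' := Num.max T (t1 + 1); have T'1 : t1 + 1 <= T' by rewrite le_max lexx orbT.
have T'0 : 0 <= T' by apply: le_trans T'1; rewrite addr_ge0.
pose H := expR (field_lipschitz * (T' + 1)) * (K * (T' + 1)).
have H0 : 0 <= H by rewrite mulr_ge0 ?expR_ge0 // mulr_ge0 // addr_ge0.
pose e := Num.min (Num.min e0 1) (Num.min delta (rho / 2 / (H + 1))).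
have H1 : 0 < H + 1 by rewrite ltr_wpDl.
have ep : 0 < e by rewrite !lt_min e00 ltr01 d0 divr_gt0.
have : e <= e by []; rewrite {2}/e !le_min => /andP [/andP [ee0 e1] /andP [ed]].
rewrite ler_pdivlMr // => er.
pose fl (s : R) := (Num.trunc (s / e)).+1.
have flP s : 0 <= s -> s < e * (fl s)%:R <= s + e.
  move=> s0; have se : 0 <= s / e by rewrite divr_ge0 // ltW.
  have /andP [a b] := truncn_itv se.
  rewrite ltr_pdivrMr // in b; rewrite ler_pdivlMr // in a.
  rewrite mulrC b /= /fl -natr1 mulrDl mul1r; by rewrite lerD2r.
have /andP [k1 k2] := flP _ t10; have /andP [N1 N2] := flP _ T'0.
exists e, (fl T'), (fl t1); split => //.
- by rewrite ep.
- by apply: le_trans (ltW N1); rewrite le_max lexx.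
- by apply: le_trans k2 _; rewrite lerD2l.
- rewrite -(ltr_nat R) -(ltr_pM2l ep); apply: le_lt_trans k2 _; apply: le_lt_trans N1.
  by apply: le_trans T'1; rewrite lerD2l.
move=> k kk kN; set t := e * k%:R.
have tk : t1 <= t by apply: le_trans (ltW k1) _; rewrite ler_pM2l // ler_nat.
have tT : t <= T' + 1.
  apply: le_trans (_ : e * (fl T')%:R <= _); first by rewrite ler_pM2l // ler_nat ltnW.
  by apply: le_trans N2 _; rewrite lerD2l.
have t0 : 0 <= t by apply: le_trans tk.
have herr : `|pr (descent e (v 0) k *m v 0) - pr (v t)| <= rho / 2.
  apply: le_trans (err e k ep ed) _; rewrite -/t.
  apply: le_trans (_ : H * e <= _); last by move: er; rewrite mulrDr mulr1 mulrC; lra.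
  rewrite /H ler_wpM2r ?(ltW ep) //; apply: ler_pM; [exact: expR_ge0|exact: mulr_ge0| |].
    by rewrite ler_expR ler_wpM2l.
  by rewrite ler_wpM2l.
have := ler_normD (pr (descent e (v 0) k *m v 0) - pr (v t)) (pr (v t) - P).
rewrite addrA subrK; have := ht1 _ tk; lra.
Qed.

Variable voo : 'cV[R]_n.
Hypothesis voo0 : voo != 0.
Hypothesis lim : pr (v t) @[t --> +oo%R] --> pr voo.

Lemma descent_near_limit d : 0 < d -> exists2 t0, 0 <= t0 & forall e0 T, 0 < e0 ->
  exists e N k0, [/\ 0 < e <= e0, T <= e * N%:R, e * k0%:R <= t0, (k0 < N)%N &
    forall k, (k0 <= k)%N -> (k < N)%N ->
      `|gradnorm (descent e (v 0) k *m v 0) ^+ 2 - gradnorm voo ^+ 2| <= d].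
Proof.
move=> d0; pose L := 2 * n%:R ^+ 4 / c ^+ 2 + 1.
have L0 : 0 < L by rewrite ltr_wpDl // divr_ge0 ?mulr_ge0 ?exprn_ge0 // ltW.
have dL : 0 < d / L by rewrite divr_gt0.
have [t0 t00 h] := flow_approx lim dL.
exists t0 => // e0 T e00; have [e [N [k0 [h1 h2 h3 h4 h5]]]] := h e0 T e00.
exists e, N, k0; split => // k kk kN.
have y0 : descent e (v 0) k *m v 0 != 0.
  by apply: G_neq0 => //; apply: descent_G.
apply: le_trans (gradnorm_lip y0 voo0) _.
have := h5 k kk kN; rewrite ler_pdivlMr //; apply: le_trans.
by rewrite mulrC ler_wpM2l // /L lerDl.
Qed.

(** Suppose s < |mu_p(voo)| and let m be the midpoint.  After the time t0 the
    scheme is so close to voo that F_k >= m, and [limit_ineq] gives m <= s. *)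
Lemma flow_limit_le h xi s : normC g h -> xi^t* = xi -> 0 <= s ->
  frob2 xi = s ^+ 2 -> momentum_pairing xi (h *m cplxmx (v 0)) -> gradnorm voo <= s.
Proof.
move=> Nh xiH s0 xis pair; set M := gradnorm voo.
have M0 : 0 <= M by exact: gradnorm_ge0.
have [A bd] := descent_bound (v0 0) Nh xiH s0 xis pair.
rewrite leNgt; apply/negP => sM; pose m := (s + M) / 2.
have m1 : s < m by rewrite /m; lra.
have m2 : m < M by rewrite /m; lra.
have m0 : 0 < m by apply: le_lt_trans m1.
have d0 : 0 < M ^+ 2 - m ^+ 2 by rewrite subr_gt0 ltr_pXn2r ?nnegrE // ltW.
have [t0 t00 near] := descent_near_limit d0.
suff : m <= s by rewrite leNgt m1.
apply: (@limit_ineq R c s A m (4 * n%:R * s) t0 c0 s0) => // [|e0 T e00].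
  by rewrite !mulr_ge0.
have e0p : 0 < Num.min e0 (c / 4) by rewrite lt_min e00 divr_gt0.
have [e [N [k0 [/andP [ep]]]]] := near _ T e0p.
rewrite le_min => /andP [ee0 ec] TN kt kN hk.
exists e, (fun k => gradnorm (descent e (v 0) k *m v 0)), N, k0.
split => //; [by rewrite ep| |exact: bd].
split=> k.
  rewrite gradnorm_ge0 gradnorm_le // G_neq0 //.
  exact: descent_G.
move=> kk kN'; have := hk k kk kN'; rewrite ler_norml => /andP [h1 _].
rewrite -(ler_pXn2r (n := 2)) ?nnegrE ?gradnorm_ge0 ?(ltW m0) //.
by move: h1; rewrite /M; lra.
Qed.

(** The iterates lie in the orbit of [v 0] under G and come arbitrarily close to
    voo. *)
Lemma orbit_inf_le_limit m : (forall A, G A -> m <= gradnorm (A *m v 0)) ->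
  m <= gradnorm voo.
Proof.
move=> hm; have [m0|m0] := leP m 0; first exact: le_trans (gradnorm_ge0 _).
rewrite -(ler_pXn2r (n := 2)) ?nnegrE ?gradnorm_ge0 ?(ltW m0) //.
apply/ler_addgt0Pr => d d0; have [t0 t00 near] := descent_near_limit d0.
have [e [N [k0 [_ _ _ kN hk]]]] := near 1 0 ltr01.
have := hk k0 (leqnn _) kN; rewrite ler_norml => /andP [_ h].
have : m ^+ 2 <= gradnorm (descent e (v 0) k0 *m v 0) ^+ 2.
  rewrite ler_pXn2r ?nnegrE ?gradnorm_ge0 ?(ltW m0) //.
  by apply: hm; apply: descent_G.
by move: h; lra.
Qed.

End FlowLine.
End GradientFlow.

(** * The two equalities *)

Theorem proposition8 (R : realType) (n : nat)
    (G K : set 'M[R]_n) (g k : {vspace 'M[R]_n}) (UC : set 'M[R[i]]_n)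
    (ip : 'M[R[i]]_n -> 'M[R[i]]_n -> R)
    (mu : {vspace 'cV[R[i]]_n} -> 'M[R[i]]_n)
    (mup : {vspace 'cV[R[i]]_n} -> 'M[R]_n)
    (hG : closed_subgroup_SL G) (hGconn : connected G) (hGnc : ~ compact G)
    (hg : is_lie_algebra G g) (hss : lie_semisimple g)
    (hK : K = G `&` @SO R n) (hk : is_lie_algebra K k)
    (hpolar : G = [set A *m expmx B | A in K & B in ppart g])
    (hirrR : irreducible_on G)
    (hirrC : irreducible_on [set cplxmx A | A in G])
    (hUC : UC = zariski_closure [set cplxmx A | A in G])
    (hip : invariant_scalar_product ip)
    (hmu : is_momentum_map ip g k mu)
    (hmup : is_gradient_map ip g mup) :
  (forall (x0 : {vspace 'cV[R]_n}) (x : R -> {vspace 'cV[R]_n})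
      (xoo : {vspace 'cV[R]_n}),
    projspace x0 ->
    neg_flow_line (fun y => mup (cplxline y)) x0 x ->
    flow_limit x xoo ->
    norm_p ip (mup (cplxline xoo)) =
      inf [set norm_p ip (mup (cplxline (act A x0))) | A in G] /\
    inf [set norm_p ip (mup (cplxline (act A x0))) | A in G] =
      inf [set norm_su ip (mu (act A (cplxline x0))) | A in UC]) /\
  (forall x0 : {vspace 'cV[R[i]]_n},
    projspace x0 ->
    orbit_of UC x0 `&` @realpoints R n !=set0 ->
    inf [set norm_su ip (mu (act A x0)) | A in UC] =
    inf [set norm_p ip (mup y) | y in orbit_of UC x0 `&` @realpoints R n]).
Proof.
have n0 : (0 < n)%N by case: hirrR.
have [c c0 ipE] := ip_trace hip n0.
have gtr A : A \in g -> A^T \in g by exact: (g_tr hG hg hK hpolar).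
have gbr A B : A \in g -> B \in g -> A *m B - B *m A \in g by exact: (g_bracket hG hg).
have gtr0 A : A \in g -> \tr A = 0.
  move=> gA; have [|_ _] := sym_in_p hG hg (memvD gA (gtr A gA)).
    by rewrite linearD /= trmxK addrC.
  rewrite mxtraceD mxtrace_tr -mulr2n => /eqP; by rewrite mulrn_eq0 /= => /eqP.
have G_1 : G 1%:M := G_one hG.
have G_m : forall A B, G A -> G B -> G (A *m B) := @G_mul _ _ _ hG.
have G_e : forall A : 'M[R]_n, A \in g -> G (expmx A) := @g_exp _ _ _ _ hg.
have G_N : forall P, G P -> normC g (cplxmx P) := @normC_G _ _ _ _ hG hg.
have polar := @polar_in_gC _ _ _ _ hG hg gtr gbr hGconn hirrC gtr0.
have mp := @mup_p _ _ _ _ _ hmup.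
have mpair := @mup_pair _ _ _ _ _ _ ipE hmup.
pose rc := Num.sqrt c; have rc0 : 0 < rc by rewrite sqrtr_gt0.
pose s (z : 'cV[R[i]]_n) := Num.sqrt (frob2 (xi mu z)).
have s0 z : 0 <= s z by exact: sqrtr_ge0.
have sE z : frob2 (xi mu z) = s z ^+ 2 by rewrite sqr_sqrtr ?frob2_ge0.
have suE z : z != 0 -> norm_su ip (mu <[z]>%VS) = rc * s z by exact: (norm_suE hK hk c0 ipE hmu).
have pE (v : 'cV[R]_n) : v != 0 -> norm_p ip (mup <[cplxmx v]>%VS) = rc * gradnorm mup v.
  by move=> v0; apply: (norm_pE c0 ipE hmup); exact: cplxcol_neq0.
have sR (v : 'cV[R]_n) : v != 0 -> s (cplxmx v) = gradnorm mup v.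
  move=> v0; rewrite /s (xi_real hG hg hK hk c0 ipE hmu hmup v0); congr Num.sqrt.
  apply: complexI; rewrite -frob2E -mxtrace_cplx cplxmxM cplxmx_adj.
  by rewrite (grad_sym mp v0).
have pair (h : 'M[R[i]]_n) (v : 'cV[R]_n) : normC g h -> v != 0 -> momentum_pairing g c (xi mu (h *m cplxmx v)) (h *m cplxmx v).
  move=> Nh v0 X gX Xh; apply: (xi_pair hG hg hK hk ipE hmu) => //.
  by apply: mulmx_neq0; [exact: normC_unit Nh|exact: cplxcol_neq0].
have hz (h : 'M[R[i]]_n) (v : 'cV[R]_n) : normC g h -> v != 0 -> h *m cplxmx v != 0.
  by move=> Nh v0; apply: mulmx_neq0; [exact: normC_unit Nh|exact: cplxcol_neq0].
(* a lower bound of |mu_p| on a real orbit bounds |mu| on the orbit under normC *)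
have stat (h : 'M[R[i]]_n) (v : 'cV[R]_n) m : normC g h -> v != 0 -> (forall A, G A -> m <= rc * gradnorm mup (A *m v)) ->
    m <= rc * s (h *m cplxmx v).
  move=> Nh v0 hm; rewrite mulrC -ler_pdivrMr //.
  apply: (orbit_inf_le c0 G_1 G_m G_e G_N polar mp mpair v0 Nh (xi_herm hK hk hmu (hz _ _ Nh v0)) (s0 _) (sE _) (pair _ _ Nh v0)).
  by move=> A GA; rewrite ler_pdivrMr // mulrC; exact: hm.
have Gv (A : 'M[R]_n) (v : 'cV[R]_n) : G A -> v != 0 -> A *m v != 0 by exact: (G_neq0 G_N).
split.
- move=> x0 x xoo px0 fl [pxoo lim].
  have [x_0 _ _] := fl.
  have [v [v0 xv dv]] := flow_line_lift mp fl.
  have [w w0 ew] := projspace_line pxoo.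
  have ex0 : x0 = <[v 0%R]>%VS by rewrite -x_0.
  have lim' : pr (v t) @[t --> +oo%R] --> pr w.
    move: lim; rewrite ew projmx_line //.
    by have -> : (fun t => projmx (x t)) = (fun t => pr (v t)) by apply: funext => t; rewrite xv projmx_line.
  have eqG A : G A -> norm_p ip (mup (cplxline (act A x0))) = rc * gradnorm mup (A *m v 0).
    by move=> GA; rewrite ex0 act_line cplxline_line pE // Gv.
  set S := [set _ | A in G].
  set S' := [set _ | A in UC].
  have Sne : S !=set0 by exists (norm_p ip (mup (cplxline (act 1%:M x0)))), 1%:M.
  have Slb : has_lbound S by exists 0 => _ [A _ <-]; exact: sqrtr_ge0.
  have S'lb : has_lbound S' by exists 0 => _ [A _ <-]; exact: sqrtr_ge0.
  have SS' : S `<=` S'.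
    move=> _ [A GA <-]; exists (cplxmx A); first by rewrite hUC; exact: UC_G.
    rewrite ex0 act_line !cplxline_line act_line -cplxmxM suE ?cplxcol_neq0 ?Gv //.
    by rewrite pE ?Gv // sR ?Gv.
  have S'ne : S' !=set0 by case: Sne => y /SS'; exists y.
  split.
  + rewrite ew cplxline_line pE //; apply/eqP; rewrite eq_le; apply/andP; split.
      apply: lb_le_inf => // _ [A GA <-]; rewrite eqG // ler_pM2l // -(sR (A *m v 0)) ?Gv //.
      have NA := G_N _ GA; rewrite cplxmxM.
      exact: (flow_limit_le c0 G_1 G_m G_e G_N polar mp mpair v0 dv w0 lim' NA (xi_herm hK hk hmu (hz _ _ NA (v0 0))) (s0 _) (sE _) (pair _ _ NA (v0 0))).
    rewrite mulrC -ler_pdivrMr //.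
    apply: (orbit_inf_le_limit c0 G_1 G_m G_e G_N mp mpair v0 dv w0 lim') => A GA.
    by rewrite ler_pdivrMr // mulrC -eqG //; apply: ge_inf => //; exists A.
  + apply/eqP; rewrite eq_le; apply/andP; split.
      apply: lb_le_inf => // _ [A UA <-]; have NA : normC g A by apply: (UC_normC hG hg); rewrite -hUC.
      rewrite ex0 cplxline_line act_line suE ?hz //; apply: stat => // B GB.
      by rewrite -eqG //; apply: ge_inf => //; exists B.
    by apply: lb_le_inf => // y /SS' S'y; apply: ge_inf.
- move=> x0 px0 [y0 [[h Uh eh] [L pL eL]]].
  have [z z0 ez] := projspace_line px0; have [v v0 ev] := projspace_line pL.
  have Nh : normC g h by apply: (UC_normC hG hg); rewrite -hUC.
  set S' := [set _ | A in UC].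
  set S := [set _ | y in _].
  have Slb : has_lbound S by exists 0 => _ [A _ <-]; exact: sqrtr_ge0.
  have S'lb : has_lbound S' by exists 0 => _ [A _ <-]; exact: sqrtr_ge0.
  have Sne : S !=set0 by exists (norm_p ip (mup y0)), y0 => //; split; [exists h|exists L].
  have SS' : S `<=` S'.
    move=> _ [y [[A UA eA] [M pM eM]] <-]; exists A => //.
    have [u u0 eu] := projspace_line pM.
    by rewrite eA -eM eu cplxline_line suE ?cplxcol_neq0 // pE // sR.
  have S'ne : S' !=set0 by case: Sne => y /SS'; exists y.
  have ehv : act h x0 = <[cplxmx v]>%VS by rewrite eh -eL ev cplxline_line.
  apply/eqP; rewrite eq_le; apply/andP; split.
    by apply: lb_le_inf => // y /SS' S'y; apply: ge_inf.
  apply: lb_le_inf => // _ [A UA <-].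
  have NA : normC g A by apply: (UC_normC hG hg); rewrite -hUC.
  (* A x_0 is the image of the real point h x_0 under A h^-1 *)
  have NAh : normC g (A *m invmx h) by apply: normC_mul => //; exact: normC_inv.
  have -> : act A x0 = <[(A *m invmx h) *m cplxmx v]>%VS.
    by rewrite -act_line -ehv ez !act_line -mulmxA mulKmx // (normC_unit Nh).
  rewrite suE ?hz //; apply: stat => // B GB.
  rewrite -pE ?Gv //; apply: ge_inf => //; exists <[cplxmx (B *m v)]>%VS => //; split.
    exists (cplxmx B *m h); first by rewrite hUC; apply: (UC_mulG hG) => //; rewrite -hUC.
    by rewrite cplxmxM -act_line -ehv ez !act_line mulmxA.
  exists <[B *m v]>%VS; last by rewrite cplxline_line.
  by apply: line_projspace; rewrite Gv.
Qed.
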